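(* Let $\alpha$ be a composition of $n$, and let $\mathscr D:=D(\mathcal V_\alpha,\mathrm w_{RB})$, $\mathscr E:=D(X_\alpha,\mathrm w_{RB})$ and $\mathscr C:=D_{\alpha,\mathcal C}$. For $I\subseteq\mathfrak S_n$ write $Iw_0=\{\zeta w_0:\zeta\in I\}$. Then: (a) $C_{\mathcal R\mathcal V_\alpha}=\{Iw_0: I\in C_{\mathcal V_\alpha}\}$, and $(C_{\mathcal R\mathcal V_\alpha},\preceq)\cong(\mathsf{ST}((\mathscr D^{t})^x),\trianglelefteq)$ as posets. (b) $C_{\mathcal RX_\alpha}=\{Iw_0: I\in C_{X_\alpha}\}$, and $(C_{\mathcal RX_\alpha},\preceq)\cong(\mathsf{ST}((\mathscr E^{t})^x),\trianglelefteq)$ as posets. (c) $C_{\mathcal R\widehat{\mathbf S}_{\alpha,\mathcal C}}=\{Iw_0: I\in C_{\widehat{\mathbf S}_{\alpha,\mathcal C}}\}$, and $(C_{\mathcal R\widehat{\mathbf S}_{\alpha,\mathcal C}},\preceq)\cong(\mathsf{ST}((\mathscr C^{t})^x),\trianglelefteq)$ as posets.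
   Context: Permutations. $n$ is a positive integer, $[n]=\{1,\dots,n\}$, $\mathfrak S_n$ the symmetric group (product = composition of maps; permutations written as words), $s_i=(i,i+1)$, $\ell(\sigma)$ Coxeter length, $w_0$ the longest element. $\mathrm{Des}_L(\sigma)=\{i:\ell(s_i\sigma)<\ell(\sigma)\}$, $\mathrm{Des}_R(\sigma)=\{i:\ell(\sigma s_i)<\ell(\sigma)\}$. $\preceq_L$ (resp. $\preceq_R$) has covers $\sigma\prec s_i\sigma$, $i\notin\mathrm{Des}_L(\sigma)$ (resp. $\sigma\prec\sigma s_i$, $i\notin\mathrm{Des}_R(\sigma)$); $[\sigma,\rho]_L$ is the interval for $\preceq_L$; $\mathrm{Int}(n)$ is the set of nonempty such intervals. For $S\subseteq[n-1]$, $S^c=[n-1]\setminus S$ and $w_0(S)$ is the longest element of the subgroup generated by $\{s_i:i\in S\}$. For a composition $\alpha=(\alpha_1,\dots,\alpha_l)$, $\ell(\alpha)=l$, $\mathrm{set}(\alpha)=\{\alpha_1,\dots,\alpha_1+\dots+\alpha_{l-1}\}$. Classes. $I_1\sim_D I_2$ iff there is a poset isomorphism $f:(I_1,\preceq_L)\to(I_2,\preceq_L)$ with $\mathrm{Des}_L(f(\gamma))=\mathrm{Des}_L(\gamma)$ for all $\gamma$. On a class $C$: $[\sigma,\rho]_L\preceq[\sigma',\rho']_L$ iff $\sigma\preceq_R\sigma'$. Modules. $H_n(0)$ is the unital $\mathbb C$-algebra generated by $\pi_1,\dots,\pi_{n-1}$ with $\pi_i^2=\pi_i$, $\pi_i\pi_{i+1}\pi_i=\pi_{i+1}\pi_i\pi_{i+1}$,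 $\pi_i\pi_j=\pi_j\pi_i$ ($|i-j|\ge2$); $\overline\pi_i=\pi_i-1$. For $I\in\mathrm{Int}(n)$, $\mathsf B(I)$ has basis $I$ and $\pi_i\cdot\gamma=\gamma$ if $i\in\mathrm{Des}_L(\gamma)$; $0$ if $i\notin\mathrm{Des}_L(\gamma)$, $s_i\gamma\notin I$; $s_i\gamma$ if $i\notin\mathrm{Des}_L(\gamma)$, $s_i\gamma\in I$. It is known that $I\sim_D J$ iff $\mathsf B(I)\cong\mathsf B(J)$. Let $\theta$ be the automorphism $\overline\pi_i\mapsto-\pi_i$ and $\chi$ the anti-automorphism $\overline\pi_i\mapsto\overline\pi_i$; $\theta\circ\chi[M]$ is the dual space $M^*$ with $(h\cdot\delta)(v)=\delta(\theta(\chi(h))\cdot v)$. It is known that $\theta\circ\chi[\mathsf B([\sigma,\rho]_L)]\cong\mathsf B([\rho w_0,\sigma w_0]_L)$. Diagrams. Boxes are $(x,y)$ with $x$ = column from the left, $y$ = row from the bottom. $D^t=\{(j,i):(i,j)\in D\}$; $D^x$ is the reflection of $D$ across the $x$-axis, shifted upward to the first quadrant so that it touches the axes. $\mathsf{ST}(D)$: bijections $T:D\to[n]$ with $T(i,j)\le T(k,l)$ whenever $i\le k$, $j\le l$; $T\trianglelefteq U$ iff $\mathrm w_{TL}(T)\preceq_L\mathrm w_{TL}(U)$, where $\mathrm w_{TL}$ reads each column top to bottom, leftmost column first. $\mathrm{tcd}(\alpha)=\{(j,i):1\le i\le\ell(\alpha),1\le j\le\alpha_i\}$. $\mathrm w_{RB}$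 reads each row right to left, bottom row first. The classes $C_{\mathcal V_\alpha},C_{X_\alpha},C_{\widehat{\mathbf S}_{\alpha,\mathcal C}}$ are the $\sim_D$-classes of the sets $\mathrm w_{RB}(\mathcal B)=\{\mathrm w_{RB}(T):T\in\mathcal B\}$ (each known to be a left weak Bruhat interval with minimum $w_0(\mathrm{set}(\alpha)^c)$), where $\mathcal B$ is respectively: the set of bijective fillings of $\mathrm{tcd}(\alpha)$ by $[n]$ with rows increasing left to right and first column increasing bottom to top (standard immaculate tableaux); those with rows increasing left to right and all columns increasing bottom to top (standard extended tableaux); the canonical class $\mathcal C$ of standard Young composition tableaux (SYCTs). Here an SYCT is a bijective filling $\tau$ of $\mathrm{tcd}(\alpha)$ by $[n]$ with rows increasing left to right, first column increasing bottom to top, and such that for rows $r<r'$ and column $k$ with $(k+1,r),(k,r')\in\mathrm{tcd}(\alpha)$ and $\tau(k,r')<\tau(k+1,r)$ one has $(k+1,r')\in\mathrm{tcd}(\alpha)$ and $\tau(k+1,r')<\tau(k+1,r)$; two SYCTs are equivalent if entries in each column have the same relative order; $\mathcal C$ is the class of the SYCT filled with $1,\dots,n$ along rows left to right, bottom row first. The modules $\mathcal V_\alpha,X_\alpha,\widehat{\mathbf S}_{\alpha,\mathcal C}$ are, up to isomorphism, $\mathsf B(\mathrm w_{RB}(\mathcal B))$ for the corresponding $\mathcal B$. The row-strict analogues satisfy $\mathcal R\mathcal V_\alpha\cong\theta\circ\chi[\mathcal V_\alpha]$, $\mathcal RX_\alpha\cong\theta\circ\chi[X_\alpha]$, $\mathcal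 R\widehat{\mathbf S}_{\alpha,\mathcal C}\cong\theta\circ\chi[\widehat{\mathbf S}_{\alpha,\mathcal C}]$ (which may be taken as definitions), and for each such module $Y$, $C_Y$ is the $\sim_D$-class of intervals $I$ with $\mathsf B(I)\cong Y$. $D(\mathcal V_\alpha,\mathrm w_{RB})=\{(i,1):1\le i\le\ell(\alpha)\}\cup\{(i,j+k_i):1\le i\le\ell(\alpha),2\le j\le\alpha_i\}$ with $k_i=\sum_{i<r\le\ell(\alpha)}(\alpha_r-1)$. $D(X_\alpha,\mathrm w_{RB})=\mathrm{tcd}(\alpha)^t$. $D_{\alpha,\mathcal C}$ is defined as follows. Let $X_i=\{(1,i),\dots,(\alpha_i,i)\}$, $1\le i\le\ell(\alpha)$. Let $\mathsf{BB}(\alpha)\subseteq\mathrm{tcd}(\alpha)$ consist of the boxes $(1,y)$ with $y<\ell(\alpha)$ and $\alpha_y>1$, the box $(1,\ell(\alpha))$, and the boxes $(x,y)$, $x>1$, such that no box of $\mathrm{tcd}(\alpha)$ in column $x$ or $x-1$ lies strictly above row $y$. List $\mathsf{BB}(\alpha)$ by column index, and within column $1$ by row index, as $(b_1,d_1),\dots,(b_l,d_l)$. Put $Y_1=\{(1,d_1),\dots,(1,1)\}$, $A_1=\mathrm{tcd}(\alpha)\setminus Y_1$. For $j=1,\dots,l-1$: start $Y_{j+1}$ with the list $(1,d_{j+1}),(1,d_{j+1}-1),\dots,(1,d_j+1)$ if $b_{j+1}=1$, and with the single box $(b_{j+1},d_{j+1})$ otherwise; then repeatedly, with $\kappa$ the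 last box listed, in column $c$, if there is a box of $A_j$ not yet in $Y_{j+1}$ in column $c+1$ strictly below $\kappa$, append the lowermost such box, otherwise stop; put $A_{j+1}=A_j\setminus Y_{j+1}$. Finally $D_{\alpha,\mathcal C}=\{(i,j):X_i\cap Y_j\neq\emptyset\}$. *)

(* Defs.v *)
From HB Require Import structures.
From mathcomp Require Import all_boot all_order all_fingroup all_algebra.
From mathcomp Require Import finmap zify.
From mathcomp Require Import boolp generic_quotient.

Set Implicit Arguments.
Unset Strict Implicit.
Unset Printing Implicit Defensive.

Import GRing.Theory.

Section Permutations.
Local Open Scope nat_scope.
Context {n : nat}.

(* [n] is encoded as 'I_n (shifted by one) and [n-1] as 'I_n.-1. *)

(* MathComp's product of permutations applies the left factor first. *)
Definition pcomp (s t : 'S_n) : 'S_n := (t * s)%g.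

Lemma pcompE (s t : 'S_n) (x : 'I_n) : pcomp s t x = s (t x).
Proof. by rewrite permM. Qed.

Fact ord_lo_subproof (i : 'I_n.-1) : i < n.
Proof. by have := ltn_ord i; lia. Qed.

Fact ord_hi_subproof (i : 'I_n.-1) : i.+1 < n.
Proof. by have := ltn_ord i; lia. Qed.

Definition ord_lo (i : 'I_n.-1) : 'I_n := Ordinal (ord_lo_subproof i).
Definition ord_hi (i : 'I_n.-1) : 'I_n := Ordinal (ord_hi_subproof i).

Definition sadj (i : 'I_n.-1) : 'S_n := tperm (ord_lo i) (ord_hi i).

Definition word_prod (w : seq 'I_n.-1) : 'S_n :=
  foldr (fun i s => pcomp (sadj i) s) 1%g w.

Definition ninv (s : 'S_n) : nat :=
  #|[set ab : 'I_n * 'I_n | (ab.1 < ab.2) && (s^-1 ab.2 < s^-1 ab.1)%g]|.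

Lemma sadj_inv (i : 'I_n.-1) (s : 'S_n) x :
  ((pcomp (sadj i) s)^-1)%g x = (s^-1)%g (sadj i x).
Proof. by rewrite /pcomp invMg permM tpermV. Qed.

Lemma sadj_val (i : 'I_n.-1) (a : 'I_n) :
  sadj i a = (if a == i :> nat then i.+1 else if a == i.+1 :> nat then nat_of_ord i
                  else nat_of_ord a) :> nat.
Proof.
rewrite /sadj; case: tpermP => [->|->|] /=.
- by rewrite eqxx.
- by rewrite eqxx; case: eqP => //; lia.
- move=> /eqP/negbTE h1 /eqP/negbTE h2.
  by rewrite -!val_eqE /= in h1 h2; rewrite h1 h2.
Qed.

Lemma sadjK (i : 'I_n.-1) (s : 'S_n) :
  pcomp (sadj i) (pcomp (sadj i) s) = s.
Proof. by rewrite /pcomp -mulgA tperm2 mulg1. Qed.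

Lemma ninv_up (i : 'I_n.-1) (s : 'S_n) :
  ((s^-1)%g (ord_lo i) < (s^-1)%g (ord_hi i)) ->
  ninv (pcomp (sadj i) s) = (ninv s).+1.
Proof.
move=> h; pose f (ab : 'I_n * 'I_n) := (sadj i ab.1, sadj i ab.2).
have fK : involutive f by case=> a b; rewrite /f /= !tpermK.
rewrite /ninv -(card_imset [set ab : 'I_n * 'I_n | (ab.1 < ab.2) && (s^-1 ab.2 < s^-1 ab.1)%g] (inv_inj fK)).
set B := imset _ _.
have sNB : (ord_lo i, ord_hi i) \notin B.
  apply/imsetP => -[[a b]]; rewrite inE /= => /andP[ab _] [ha hb].
  have := sadj_val i a; have := sadj_val i b; rewrite -ha -hb /=.
  by do ![case: eqP]; lia.
transitivity #|(ord_lo i, ord_hi i) |: B|; last by rewrite cardsU1 sNB.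
apply: eq_card => -[a b]; rewrite !inE /= !sadj_inv.
rewrite -[(a, b)]fK mem_imset; last exact: inv_inj fK.
rewrite inE fK /f /=.
have [[-> ->]|nab] := (a, b) =P (ord_lo i, ord_hi i).
  by rewrite tpermL tpermR /= ltnSn h.
have [[-> ->]|nba] := (a, b) =P (ord_hi i, ord_lo i).
  by rewrite tpermL tpermR /= ![in X in _ = X]ltnNge (ltnW h) andbF ltnNge leqnSn.
have /negbTE e1 : (a, b) != (ord_lo i, ord_hi i) by apply/eqP.
have /negbTE e2 : (a, b) != (ord_hi i, ord_lo i) by apply/eqP.
rewrite !xpair_eqE -!val_eqE /= in e1 e2; rewrite /=.
congr andb; rewrite !sadj_val; move: e1 e2.
by do ![case: eqP]; lia.
Qed.

Lemma ninv_down (i : 'I_n.-1) (s : 'S_n) :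
  (s^-1)%g (ord_hi i) < (s^-1)%g (ord_lo i) ->
  (ninv (pcomp (sadj i) s)).+1 = ninv s.
Proof.
move=> h; rewrite -[in RHS](sadjK i s); apply/esym/ninv_up.
by rewrite !sadj_inv tpermL tpermR.
Qed.

Lemma pos_neq (i : 'I_n.-1) (s : 'S_n) : s (ord_lo i) <> s (ord_hi i) :> nat.
Proof. by move/val_inj/perm_inj/(congr1 val) => /= /n_Sn. Qed.

Lemma no_descent (p : 'S_n) :
  (forall i : 'I_n.-1, p (ord_lo i) < p (ord_hi i)) -> p = 1%g.
Proof.
move=> h.
have step k (a b : 'I_n) : b = a + k.+1 :> nat -> p a < p b.
  elim: k b => [|k IH] b e.
    have ai : a < n.-1 by have := ltn_ord b; lia.
    have := h (Ordinal ai); congr (p _ < p _); apply: val_inj => /=; lia.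
  have bi : a + k.+1 < n.-1 by have := ltn_ord b; lia.
  apply: (@ltn_trans (p (ord_lo (Ordinal bi)))); first exact: IH.
  by have := h (Ordinal bi); congr (_ < p _); apply: val_inj => /=; lia.
have mono (a b : 'I_n) : a < b -> p a < p b.
  by move=> ab; apply: (step (b - a).-1); lia.
have ge (q : 'S_n) : (forall a b : 'I_n, a < b -> q a < q b) -> forall a : 'I_n, a <= q a.
  move=> hq [a]; elim: a => // a IH an /=.
  have an' : a < n by lia.
  apply: leq_ltn_trans (hq (Ordinal an') _ _) => //=; exact: IH.
have mono' (a b : 'I_n) : a < b -> (p^-1)%g a < (p^-1)%g b.
  move=> ab; rewrite ltnNge leq_eqVlt; apply/negP => /orP[/eqP/val_inj/perm_inj e|/mono].
    by rewrite e ltnn in ab.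
  by rewrite !permKV ltnNge (ltnW ab).
apply/permP => a; rewrite perm1; apply: val_inj; apply/eqP.
by rewrite eqn_leq ge // andbT; have := ge _ mono' (p a); rewrite permK.
Qed.

Lemma ninv1 : ninv 1%g = 0.
Proof.
apply/eqP; rewrite cards_eq0; apply/eqP/setP => -[a b].
by rewrite !inE invg1 !perm1 /=; case: ltngtP.
Qed.

Lemma ninv_word_le (w : seq 'I_n.-1) : ninv (word_prod w) <= size w.
Proof.
elim: w => [|i w IH] /=; first by rewrite ninv1.
have := @pos_neq i (word_prod w)^-1%g.
case: (ltngtP ((word_prod w)^-1%g (ord_lo i)) ((word_prod w)^-1%g (ord_hi i))) => // h _.
  by rewrite ninv_up.
by rewrite (leq_trans _ (leqW IH)) // -(ninv_down h).
Qed.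

Lemma ninv_word_ex (s : 'S_n) : exists w : (ninv s).-tuple 'I_n.-1, word_prod w == s.
Proof.
move: {2}(ninv s) (erefl (ninv s)) => m; elim: m s => [|m IH] s hm.
  rewrite hm; exists [tuple] => /=; rewrite eq_sym -[s]invgK invg_eq1; apply/eqP/no_descent => i.
  rewrite ltnNge leq_eqVlt; apply/negP => /orP[/eqP/esym/pos_neq //|/ninv_down].
  by rewrite hm.
have [i hi] : exists i : 'I_n.-1, (s^-1)%g (ord_hi i) < (s^-1)%g (ord_lo i).
  apply/existsP; apply: contraT; rewrite negb_exists => /forallP h.
  suff s1 : (s^-1 = 1)%g by rewrite -[s]invgK s1 invg1 ninv1 in hm.
  apply: no_descent => i; have := h i; rewrite -leqNgt leq_eqVlt.
  by case/orP => // /eqP/pos_neq.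
have := ninv_down hi; rewrite hm => -[hm'].
have [w /eqP hw] := IH _ hm'.
have hsz : size (i :: w) == m.+1 by rewrite /= size_tuple hm'.
by exists (Tuple hsz); rewrite /= hw sadjK.
Qed.

Fact word_exists (s : 'S_n) :
  exists k, [exists w : k.-tuple 'I_n.-1, word_prod w == s].
Proof. by exists (ninv s); apply/existsP; exact: ninv_word_ex. Qed.

Definition coxlen (s : 'S_n) : nat := ex_minn (word_exists s).

Lemma coxlenE (s : 'S_n) : coxlen s = ninv s.
Proof.
rewrite /coxlen; case: ex_minnP => k /existsP[w /eqP hw] hmin.
apply/eqP; rewrite eqn_leq hmin; last by apply/existsP; exact: ninv_word_ex.
by rewrite -hw (leq_trans (ninv_word_le w)) // size_tuple.
Qed.

Definition DesL (s : 'S_n) : {set 'I_n.-1} :=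
  [set i | coxlen (pcomp (sadj i) s) < coxlen s].

Definition DesR (s : 'S_n) : {set 'I_n.-1} :=
  [set i | coxlen (pcomp s (sadj i)) < coxlen s].

Lemma in_DesL (s : 'S_n) i :
  (i \in DesL s) = (s^-1%g (ord_hi i) < s^-1%g (ord_lo i)).
Proof.
rewrite inE !coxlenE; have := @pos_neq i s^-1%g.
case: (ltngtP (s^-1%g (ord_lo i)) (s^-1%g (ord_hi i))) => // h _.
  by rewrite ninv_up // ltnNge leqnSn.
by rewrite -(ninv_down h) ltnSn.
Qed.

Definition leL : rel 'S_n :=
  connect (fun s t => [exists i, (i \notin DesL s) && (t == pcomp (sadj i) s)]).

Definition leR : rel 'S_n :=
  connect (fun s t => [exists i, (i \notin DesR s) && (t == pcomp s (sadj i))]).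

(* The longest element; it is unique, so the choice made by [arg max] and its
   starting point are immaterial. *)
Definition w0 : 'S_n := [arg max_(s > 1%g) coxlen s].

Definition intervalL (s r : 'S_n) : {set 'S_n} := [set g | leL s g && leL g r].

(* Membership in Int(n). *)
Definition is_intervalL (I : {set 'S_n}) : bool :=
  [exists s, exists r, leL s r && (I == intervalL s r)].

Definition demazure (i : 'I_n.-1) (s : 'S_n) : 'S_n :=
  if i \in DesL s then s else pcomp (sadj i) s.

Lemma demazure_idem i s : demazure i (demazure i s) = demazure i s.
Proof.
rewrite {2 3}/demazure; case: (boolP (i \in DesL s)) => h.
  by rewrite /demazure h.
have h' : i \in DesL (pcomp (sadj i) s).
  move: h; rewrite !in_DesL !sadj_inv tpermL tpermR -leqNgt leq_eqVlt.
  by case/orP => // /eqP/pos_neq.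
by rewrite /demazure h'.
Qed.

Lemma sadj_out (i j : 'I_n.-1) : (i.+1 < j) || (j.+1 < i) ->
  sadj i (ord_lo j) = ord_lo j /\ sadj i (ord_hi j) = ord_hi j.
Proof.
by move=> h; split; apply: val_inj; rewrite /= sadj_val /=; do ![case: eqP]; lia.
Qed.

Lemma demazure_comm (i j : 'I_n.-1) s : (i.+1 < j) || (j.+1 < i) ->
  demazure i (demazure j s) = demazure j (demazure i s).
Proof.
move=> h; have h' : (j.+1 < i) || (i.+1 < j) by rewrite orbC.
have [e1 e2] := sadj_out h; have [e3 e4] := sadj_out h'.
have c : pcomp (sadj i) (pcomp (sadj j) s) = pcomp (sadj j) (pcomp (sadj i) s).
  rewrite /pcomp -!mulgA; congr (_ * _)%g; apply/permP => x; rewrite !permM.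
  by apply: val_inj; rewrite /= !sadj_val /=; do ![case: eqP => /=]; lia.
have d1 : (i \in DesL (pcomp (sadj j) s)) = (i \in DesL s).
  by rewrite !in_DesL !sadj_inv e3 e4.
have d2 : (j \in DesL (pcomp (sadj i) s)) = (j \in DesL s).
  by rewrite !in_DesL !sadj_inv e1 e2.
rewrite /demazure; case: (boolP (i \in DesL s)) => hi; case: (boolP (j \in DesL s)) => hj.
all: by rewrite ?d1 ?d2 ?hi ?hj ?(negbTE hi) ?(negbTE hj) ?c.
Qed.

Lemma braid_aux (T : Type) (di dj : T -> bool) (f g : T -> T) (s : T) (x y z : nat) :
    x <> y -> y <> z -> x <> z ->
    di s = (y < x) -> dj s = (z < y) -> di (f s) = (x < y) -> dj (g s) = (y < z) ->
    di (g s) = (z < x) -> dj (f s) = (z < x) ->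
    di (g (f s)) = (z < y) -> dj (f (g s)) = (y < x) ->
    f (g (f s)) = g (f (g s)) ->
  let mi t := if di t then t else f t in
  let mj t := if dj t then t else g t in
  mi (mj (mi s)) = mj (mi (mj s)).
Proof.
move=> nxy nyz nxz i1 j1 i2 j2 i3 j3 i4 j4 b mi mj.
move: i1 j1 i2 j2 i3 j3 i4 j4; rewrite /mi /mj.
case: (ltngtP x y) nxy => // h1 _; case: (ltngtP y z) nyz => // h2 _;
case: (ltngtP x z) nxz => // h3 _; try by lia.
all: move=> i1 j1 i2 j2 i3 j3 i4 j4.
all: by do 3?[rewrite ?i1 ?j1 ?i2 ?j2 ?i3 ?j3 ?i4 ?j4 ?b /=].
Qed.

Lemma demazure_braid (i j : 'I_n.-1) s : j = i.+1 :> nat ->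
  demazure i (demazure j (demazure i s)) = demazure j (demazure i (demazure j s)).
Proof.
move=> hij.
have hAB : ord_lo j = ord_hi i by apply: val_inj.
have iC : sadj i (ord_hi j) = ord_hi j.
  by apply: val_inj; rewrite /= sadj_val /=; do ![case: eqP]; lia.
have jA : sadj j (ord_lo i) = ord_lo i.
  by apply: val_inj; rewrite /= sadj_val /=; do ![case: eqP]; lia.
have iA : sadj i (ord_lo i) = ord_hi i by apply: tpermL.
have iB : sadj i (ord_hi i) = ord_lo i by apply: tpermR.
have jB : sadj j (ord_hi i) = ord_hi j by rewrite -hAB; apply: tpermL.
have jC : sadj j (ord_hi j) = ord_hi i by rewrite -hAB; apply: tpermR.
have b : pcomp (sadj i) (pcomp (sadj j) (pcomp (sadj i) s)) =
         pcomp (sadj j) (pcomp (sadj i) (pcomp (sadj j) s)).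
  rewrite /pcomp -!mulgA; congr (_ * _)%g; apply/permP => x; rewrite !permM.
  by apply: val_inj; rewrite /= !sadj_val /=; do ![case: eqP => /=]; lia.
have nAB := @pos_neq i s^-1%g; have := @pos_neq j s^-1%g; rewrite hAB => nBC.
have nAC : s^-1%g (ord_lo i) <> s^-1%g (ord_hi j) :> nat.
  by move/val_inj/perm_inj/(congr1 val) => /=; lia.
have dI t : (i \in DesL t) = (t^-1%g (ord_hi i) < t^-1%g (ord_lo i)) by rewrite in_DesL.
have dJ t : (j \in DesL t) = (t^-1%g (ord_hi j) < t^-1%g (ord_hi i)).
  by rewrite in_DesL hAB.
pose E := (sadj_inv, iA, iB, iC, jA, jB, jC).
apply: (@braid_aux _ (fun t => i \in DesL t) (fun t => j \in DesL t)
  (pcomp (sadj i)) (pcomp (sadj j)) s _ _ _ nAB nBC nAC).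
all: by rewrite ?dI ?dJ ?E.
Qed.

Lemma leL_demazure i s t : leL s t -> leL s (demazure i t).
Proof.
rewrite /demazure; case: (boolP (i \in DesL t)) => // hi st.
apply: connect_trans st (connect1 _); apply/existsP; exists i.
by rewrite hi eqxx.
Qed.

Lemma leL_step i s : i \notin DesL s -> leL s (pcomp (sadj i) s).
Proof.
by move=> hi; have := @leL_demazure i s s (connect0 _ _); rewrite /demazure (negbTE hi).
Qed.
End Permutations.

Section HeckeAlgebra.
Local Open Scope ring_scope.
Context (K : fieldType) (n : nat).

(* H_n(0) is presented by the generators pi_i over K: its elements are the
   noncommutative polynomial expressions in the generators, modulo the smallest
   congruence containing the axioms of unital associative K-algebras and the
   0-Hecke relations. *)
Inductive hterm : Type :=
  | HScal of K
  | HGen of 'I_n.-1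
  | HAdd of hterm & hterm
  | HMul of hterm & hterm.

Inductive hcong : hterm -> hterm -> Prop :=
  | hc_refl x : hcong x x
  | hc_sym x y : hcong x y -> hcong y x
  | hc_trans x y z : hcong x y -> hcong y z -> hcong x z
  | hc_add x x' y y' : hcong x x' -> hcong y y' -> hcong (HAdd x y) (HAdd x' y')
  | hc_mul x x' y y' : hcong x x' -> hcong y y' -> hcong (HMul x y) (HMul x' y')
  | hc_addA x y z : hcong (HAdd x (HAdd y z)) (HAdd (HAdd x y) z)
  | hc_addC x y : hcong (HAdd x y) (HAdd y x)
  | hc_add0 x : hcong (HAdd (HScal 0) x) x
  | hc_addN x : hcong (HAdd (HMul (HScal (-1)) x) x) (HScal 0)
  | hc_mulA x y z : hcong (HMul x (HMul y z)) (HMul (HMul x y) z)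
  | hc_mul1 x : hcong (HMul (HScal 1) x) x
  | hc_mulDl x y z : hcong (HMul (HAdd x y) z) (HAdd (HMul x z) (HMul y z))
  | hc_mulDr x y z : hcong (HMul x (HAdd y z)) (HAdd (HMul x y) (HMul x z))
  | hc_scalD a b : hcong (HScal (a + b)) (HAdd (HScal a) (HScal b))
  | hc_scalM a b : hcong (HScal (a * b)) (HMul (HScal a) (HScal b))
  | hc_scalC a x : hcong (HMul (HScal a) x) (HMul x (HScal a))
  | hc_idem i : hcong (HMul (HGen i) (HGen i)) (HGen i)
  | hc_braid (i j : 'I_n.-1) : j = i.+1 :> nat ->
      hcong (HMul (HGen i) (HMul (HGen j) (HGen i)))
            (HMul (HGen j) (HMul (HGen i) (HGen j)))
  | hc_comm (i j : 'I_n.-1) : (i.+1 < j)%N || (j.+1 < i)%N ->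
      hcong (HMul (HGen i) (HGen j)) (HMul (HGen j) (HGen i)).

HB.instance Definition _ := gen_eqMixin hterm.
HB.instance Definition _ := gen_choiceMixin hterm.

Definition hcongb : rel hterm := fun x y => `[< hcong x y >].

Fact hcongb_refl : reflexive hcongb.
Proof. by move=> x; apply/asboolP; exact: hc_refl. Qed.

Fact hcongb_sym : symmetric hcongb.
Proof. by move=> x y; apply/asboolP/asboolP; exact: hc_sym. Qed.

Fact hcongb_trans : transitive hcongb.
Proof.
by move=> y x z /asboolP xy /asboolP yz; apply/asboolP; exact: hc_trans xy yz.
Qed.

Definition hcong_equiv := EquivRel hcongb hcongb_refl hcongb_sym hcongb_trans.

Definition hecke : Type := {eq_quot hcong_equiv}%qT.

Definition hclass (t : hterm) : hecke := (\pi_({eq_quot hcong_equiv}) t)%qT.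
Definition hrepr (h : hecke) : hterm := repr (h : {eq_quot hcong_equiv}%qT).

Lemma hclass_repr h : hclass (hrepr h) = h.
Proof. exact: reprK. Qed.

Lemma hclassP x y : hcong x y -> hclass x = hclass y.
Proof. by move=> xy; apply/eqmodP/asboolP. Qed.

Lemma hrepr_class x : hcong (hrepr (hclass x)) x.
Proof. by apply/asboolP; have /eqmodP := hclass_repr (hclass x). Qed.

Lemma hecke_ind (P : hecke -> Prop) : (forall t, P (hclass t)) -> forall h, P h.
Proof. by move=> Pt h; rewrite -[h]hclass_repr. Qed.

Definition hadd (x y : hecke) := hclass (HAdd (hrepr x) (hrepr y)).
Definition hmul (x y : hecke) := hclass (HMul (hrepr x) (hrepr y)).
Definition hopp (x : hecke) := hmul (hclass (HScal (-1))) x.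
Definition hscale (a : K) (x : hecke) := hmul (hclass (HScal a)) x.

Lemma haddE x y : hadd (hclass x) (hclass y) = hclass (HAdd x y).
Proof. by apply: hclassP; apply: hc_add; exact: hrepr_class. Qed.

Lemma hmulE x y : hmul (hclass x) (hclass y) = hclass (HMul x y).
Proof. by apply: hclassP; apply: hc_mul; exact: hrepr_class. Qed.

Lemma haddA : associative hadd.
Proof.
elim/hecke_ind=> x; elim/hecke_ind=> y; elim/hecke_ind=> z.
by rewrite !haddE; apply: hclassP; exact: hc_addA.
Qed.

Lemma haddC : commutative hadd.
Proof.
elim/hecke_ind=> x; elim/hecke_ind=> y.
by rewrite !haddE; apply: hclassP; exact: hc_addC.
Qed.

Lemma hadd0 : left_id (hclass (HScal 0)) hadd.
Proof. by elim/hecke_ind=> x; rewrite haddE; apply: hclassP; exact: hc_add0. Qed.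

Lemma hmulA : associative hmul.
Proof.
elim/hecke_ind=> x; elim/hecke_ind=> y; elim/hecke_ind=> z.
by rewrite !hmulE; apply: hclassP; exact: hc_mulA.
Qed.

Lemma hmul1 : left_id (hclass (HScal 1)) hmul.
Proof. by elim/hecke_ind=> x; rewrite hmulE; apply: hclassP; exact: hc_mul1. Qed.

Lemma hscalC a x : hmul (hclass (HScal a)) x = hmul x (hclass (HScal a)).
Proof. by elim/hecke_ind: x => x; rewrite !hmulE; apply: hclassP; exact: hc_scalC. Qed.

Lemma hmulr1 : right_id (hclass (HScal 1)) hmul.
Proof. by move=> x; rewrite -hscalC hmul1. Qed.

Lemma hmulDl : left_distributive hmul hadd.
Proof.
elim/hecke_ind=> x; elim/hecke_ind=> y; elim/hecke_ind=> z.
by rewrite !(haddE, hmulE); apply: hclassP; exact: hc_mulDl.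
Qed.

Lemma hmulDr : right_distributive hmul hadd.
Proof.
elim/hecke_ind=> x; elim/hecke_ind=> y; elim/hecke_ind=> z.
by rewrite !(haddE, hmulE); apply: hclassP; exact: hc_mulDr.
Qed.

Lemma hscalD a b : hclass (HScal (a + b)) = hadd (hclass (HScal a)) (hclass (HScal b)).
Proof. by rewrite haddE; apply: hclassP; exact: hc_scalD. Qed.

Lemma hscalM a b : hclass (HScal (a * b)) = hmul (hclass (HScal a)) (hclass (HScal b)).
Proof. by rewrite hmulE; apply: hclassP; exact: hc_scalM. Qed.

Lemma haddN : left_inverse (hclass (HScal 0)) hopp hadd.
Proof.
by elim/hecke_ind=> x; rewrite /hopp hmulE haddE; apply: hclassP; exact: hc_addN.
Qed.

HB.instance Definition _ := Choice.copy hecke {eq_quot hcong_equiv}%qT.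
HB.instance Definition _ :=
  GRing.isZmodule.Build hecke haddA haddC hadd0 haddN.

Section Eval.
Context (A : algType K) (g : 'I_n.-1 -> A).

Fixpoint heval (t : hterm) : A :=
  match t with
  | HScal a => a%:A
  | HGen i => g i
  | HAdd x y => heval x + heval y
  | HMul x y => heval x * heval y
  end.

Definition hecke_relations : Prop :=
  [/\ forall i, g i * g i = g i,
      forall i j : 'I_n.-1, j = i.+1 :> nat -> g i * (g j * g i) = g j * (g i * g j)
    & forall i j : 'I_n.-1, (i.+1 < j)%N || (j.+1 < i)%N -> g i * g j = g j * g i].

Lemma heval_cong x y : hecke_relations -> hcong x y -> heval x = heval y.
Proof.
move=> [gI gB gC]; elim=> {x y} /=.
- by [].
- by move=> x y _ ->.
- by move=> x y z _ -> _ ->.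
- by move=> x x' y y' _ -> _ ->.
- by move=> x x' y y' _ -> _ ->.
- by move=> x y z; rewrite addrA.
- by move=> x y; rewrite addrC.
- by move=> x; rewrite scale0r add0r.
- by move=> x; rewrite scaleN1r mulN1r addNr scale0r.
- by move=> x y z; rewrite mulrA.
- by move=> x; rewrite scale1r mul1r.
- by move=> x y z; rewrite mulrDl.
- by move=> x y z; rewrite mulrDr.
- by move=> a b; rewrite scalerDl.
- by move=> a b; rewrite -scalerAl mul1r scalerA.
- by move=> a x; rewrite -scalerAl -scalerAr mul1r mulr1.
- exact: gI.
- exact: gB.
- exact: gC.
Qed.
End Eval.

Fact hone_neq0 : hclass (HScal 1) != 0.
Proof.
apply/negP => /eqP /(@eqmodP _ hcong_equiv) /asboolP.
have rel0 : hecke_relations (fun _ : 'I_n.-1 => (0 : K^o)).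
  by split=> *; rewrite !mul0r.
move/(heval_cong rel0) => /= /eqP.
by rewrite scale1r scale0r oner_eq0.
Qed.

HB.instance Definition _ := GRing.Zmodule_isNzRing.Build hecke
  hmulA hmul1 hmulr1 hmulDl hmulDr hone_neq0.

Fact hscaleA a b x : hscale a (hscale b x) = hscale (a * b) x.
Proof. by rewrite /hscale hmulA -hscalM. Qed.

Fact hscale1 : left_id 1 hscale.
Proof. exact: hmul1. Qed.

Fact hscaleDr : right_distributive hscale +%R.
Proof. by move=> a x y; exact: hmulDr. Qed.

Fact hscaleDl x : {morph hscale^~ x : a b / a + b}.
Proof. by move=> a b; rewrite /hscale hscalD; exact: hmulDl. Qed.

HB.instance Definition _ := GRing.Zmodule_isLmodule.Build K hecke
  hscaleA hscale1 hscaleDr hscaleDl.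

Fact hscaleAl (a : K) (x y : hecke) : a *: (x * y) = (a *: x) * y.
Proof. exact: hmulA. Qed.

HB.instance Definition _ := GRing.Lmodule_isLalgebra.Build K hecke hscaleAl.

Fact hscaleAr (a : K) (x y : hecke) : a *: (x * y) = x * (a *: y).
Proof.
rewrite /GRing.scale /= /hscale /GRing.mul /=.
by rewrite hmulA hscalC -hmulA.
Qed.

HB.instance Definition _ := GRing.Lalgebra_isAlgebra.Build K hecke hscaleAr.

Definition hpi (i : 'I_n.-1) : hecke := hclass (HGen i).
Definition hpibar (i : 'I_n.-1) : hecke := hpi i - 1.

Lemma hclass_scal a : hclass (HScal a) = a%:A.
Proof. by rewrite -[LHS]hmulr1. Qed.
Lemma hclass_gen i : hclass (HGen i) = hpi i. Proof. by []. Qed.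
Lemma hclass_add x y : hclass (HAdd x y) = hclass x + hclass y.
Proof. by rewrite -haddE. Qed.
Lemma hclass_mul x y : hclass (HMul x y) = hclass x * hclass y.
Proof. by rewrite -hmulE. Qed.

Lemma hpi_relations : hecke_relations hpi.
Proof.
have e i j k : hpi i * (hpi j * hpi k) = hclass (HMul (HGen i) (HMul (HGen j) (HGen k))).
  by rewrite !hclass_mul.
split=> [i|i j ij|i j ij]; rewrite ?e -?hclass_mul; apply: hclassP.
- exact: hc_idem.
- exact: (hc_braid ij).
- exact: (hc_comm ij).
Qed.

(* Extension of pi_i |-> g i to H_n(0), an algebra morphism as soon as the g i
   satisfy the 0-Hecke relations. *)
Definition hlift (A : algType K) (g : 'I_n.-1 -> A) (h : hecke) : A :=
  heval g (hrepr h).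

Lemma hlift_class (A : algType K) (g : 'I_n.-1 -> A) t :
  hecke_relations g -> hlift g (hclass t) = heval g t.
Proof. by move=> gP; apply: (heval_cong gP); exact: hrepr_class. Qed.

Lemma hlift_gen (A : algType K) (g : 'I_n.-1 -> A) i :
  hecke_relations g -> hlift g (hpi i) = g i.
Proof. exact: hlift_class. Qed.

Lemma hlift1 (A : algType K) (g : 'I_n.-1 -> A) :
  hecke_relations g -> hlift g 1 = 1.
Proof. by move=> gP; rewrite hlift_class //= scale1r. Qed.

Lemma hliftM (A : algType K) (g : 'I_n.-1 -> A) :
  hecke_relations g -> {morph hlift g : x y / x * y}.
Proof.
move=> gP; elim/hecke_ind=> x; elim/hecke_ind=> y.
by rewrite -hclass_mul !hlift_class.
Qed.

Lemma hlift_linear (A : algType K) (g : 'I_n.-1 -> A) :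
  hecke_relations g -> linear (hlift g).
Proof.
move=> gP a; elim/hecke_ind=> x; elim/hecke_ind=> y.
rewrite -[a *: hclass x]mulr_algl -hclass_scal -hclass_mul -hclass_add.
by rewrite !hlift_class //= mulr_algl.
Qed.

(* theta sends pibar_i to - pi_i, that is pi_i = 1 + pibar_i to 1 - pi_i. *)
Definition htheta : hecke -> hecke := hlift (fun i => 1 - hpi i).

Lemma theta_relations : hecke_relations (fun i => 1 - hpi i).
Proof.
have [pI pB pC] := hpi_relations.
have e x y : (1 - x) * (1 - y) = 1 - x - y + x * y :> hecke.
  by rewrite mulrBl mul1r mulrBr mulr1 opprB [x * y - x]addrC addrA [1 - y - x]addrAC.
split=> [i|i j ij|i j ij].
- by rewrite e pI addrNK.
- have f x y : x * x = x -> (1 - x) * ((1 - y) * (1 - x)) =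
      1 - y - x + y * x + (x * y - x * (y * x)) :> hecke.
    move=> xx; rewrite e mulrBl mul1r; congr (_ + _).
    rewrite !mulrDr !mulrN mulr1 xx [x - _]addrC addrK opprD opprK.
    by [].
  rewrite !f // (pB _ _ ij) !addrA; congr (_ - _).
  by rewrite [1 - hpi j - _]addrAC [in RHS]addrAC.
- by rewrite !e pC // [1 - _ - _]addrAC.
Qed.

Lemma hthetaM : {morph htheta : x y / x * y}.
Proof. exact: hliftM theta_relations. Qed.
Lemma htheta1 : htheta 1 = 1.
Proof. exact: hlift1 theta_relations. Qed.
Lemma htheta_linear : linear htheta.
Proof. exact: hlift_linear theta_relations. Qed.

HB.instance Definition _ :=
  GRing.isLinear.Build K hecke hecke _ htheta htheta_linear.

Lemma htheta_pibar i : htheta (hpibar i) = - hpi i.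
Proof.
by rewrite raddfB /= htheta1 /htheta (hlift_gen _ theta_relations) addrAC subrr add0r.
Qed.

Fixpoint hterm_rev (t : hterm) : hterm :=
  match t with
  | HAdd x y => HAdd (hterm_rev x) (hterm_rev y)
  | HMul x y => HMul (hterm_rev y) (hterm_rev x)
  | _ => t
  end.

Lemma hterm_rev_cong x y : hcong x y -> hclass (hterm_rev x) = hclass (hterm_rev y).
Proof.
have [pI pB pC] := hpi_relations.
elim=> {x y} /=.
- by [].
- by move=> x y _ ->.
- by move=> x y z _ -> _ ->.
- by move=> x x' y y' _ ex _ ey; rewrite !hclass_add ex ey.
- by move=> x x' y y' _ ex _ ey; rewrite !hclass_mul ex ey.
- by move=> x y z; rewrite !hclass_add addrA.
- by move=> x y; rewrite !hclass_add addrC.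
- by move=> x; rewrite hclass_add hclass_scal scale0r add0r.
- by move=> x; rewrite hclass_add hclass_mul !hclass_scal scaleN1r mulrN1 addNr scale0r.
- by move=> x y z; rewrite !hclass_mul mulrA.
- by move=> x; rewrite hclass_mul hclass_scal scale1r mulr1.
- by move=> x y z; rewrite !(hclass_mul, hclass_add) mulrDr.
- by move=> x y z; rewrite !(hclass_mul, hclass_add) mulrDl.
- by move=> a b; rewrite hclass_add !hclass_scal scalerDl.
- by move=> a b; rewrite hclass_mul !hclass_scal mulr_algl scalerA mulrC.
- by move=> a x; rewrite !hclass_mul hclass_scal mulr_algl mulr_algr.
- by move=> i; rewrite hclass_mul pI.
- by move=> i j ij; rewrite !hclass_mul -!mulrA pB.
- by move=> i j ij; rewrite !hclass_mul; apply/esym/pC.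
Qed.

(* The anti-automorphism fixing every pi_i, hence every pibar_i. *)
Definition hchi (h : hecke) : hecke := hclass (hterm_rev (hrepr h)).

Lemma hchi_class t : hchi (hclass t) = hclass (hterm_rev t).
Proof. by apply: hterm_rev_cong; exact: hrepr_class. Qed.

Lemma hchiM x y : hchi (x * y) = hchi y * hchi x.
Proof.
elim/hecke_ind: x => x; elim/hecke_ind: y => y.
by rewrite -hclass_mul !hchi_class -hclass_mul.
Qed.

Lemma hchi1 : hchi 1 = 1.
Proof. by rewrite hchi_class. Qed.

Lemma hchi_linear : linear hchi.
Proof.
move=> a; elim/hecke_ind=> x; elim/hecke_ind=> y.
rewrite -[a *: hclass x]mulr_algl -hclass_scal -hclass_mul -hclass_add.
by rewrite !hchi_class /= hclass_add hclass_mul hclass_scal mulr_algr.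
Qed.

HB.instance Definition _ :=
  GRing.isLinear.Build K hecke hecke _ hchi hchi_linear.

Lemma hchi_pibar i : hchi (hpibar i) = hpibar i.
Proof. by rewrite raddfB /= hchi1 hchi_class. Qed.
End HeckeAlgebra.

Section HeckeModules.
Local Open Scope ring_scope.
Context {K : fieldType} {n : nat}.

(* Finite-dimensional left H_n(0)-modules. *)
Record heckeModule := HeckeModule {
  hm_space :> vectType K;
  hact : hecke K n -> hm_space -> hm_space;
  hact_linear : forall h, linear (hact h);
  hact_linearl : forall v, linear (hact^~ v);
  hact1 : forall v, hact 1 v = v;
  hactM : forall h h' v, hact (h * h') v = hact h (hact h' v)
}.

HB.instance Definition _ (M : heckeModule) h :=
  GRing.isLinear.Build K M M _ (@hact M h) (@hact_linear M h).

Definition hm_iso (M N : heckeModule) : Prop :=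
  exists f : 'Hom(M, N), bijective f /\ forall h v, f (hact h v) = hact h (f v).

(* The module theta o chi [M]. *)
Section Dual.
Context (M : heckeModule).

Definition dual_act (h : hecke K n) (d : 'Hom(M, K^o)) : 'Hom(M, K^o) :=
  linfun (d \o hact (htheta (hchi h))).

Lemma dual_actE h d v : dual_act h d v = d (hact (htheta (hchi h)) v).
Proof. by rewrite lfunE. Qed.

Fact dual_act_linear h : linear (dual_act h).
Proof.
by move=> a d e; apply/lfunP => v; rewrite !(add_lfunE, scale_lfunE, dual_actE).
Qed.

Fact dual_act_linearl d : linear (dual_act^~ d).
Proof.
move=> a h h'; apply/lfunP => v; rewrite !(add_lfunE, scale_lfunE, dual_actE).
by rewrite !linearP hact_linearl linearP.
Qed.

Fact dual_act1 d : dual_act 1 d = d.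
Proof. by apply/lfunP => v; rewrite dual_actE hchi1 htheta1 hact1. Qed.

Fact dual_actM h h' d : dual_act (h * h') d = dual_act h (dual_act h' d).
Proof. by apply/lfunP => v; rewrite !dual_actE hchiM hthetaM hactM. Qed.

Definition hm_dual : heckeModule :=
  HeckeModule dual_act_linear dual_act_linearl dual_act1 dual_actM.
End Dual.

Section GeneratorAction.
Context (V : vectType K) (op : 'I_n.-1 -> V -> V).

Fixpoint tact (t : hterm K n) (v : V) : V :=
  match t with
  | HScal a => a *: v
  | HGen i => op i v
  | HAdd x y => tact x v + tact y v
  | HMul x y => tact x (tact y v)
  end.

Definition op_act (h : hecke K n) (v : V) : V := tact (hrepr h) v.

Context (opL : forall i, linear (op i)).
Context (opI : forall i v, op i (op i v) = op i v).
Context (opB : forall (i j : 'I_n.-1) v, j = i.+1 :> nat ->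
  op i (op j (op i v)) = op j (op i (op j v))).
Context (opC : forall (i j : 'I_n.-1) v, (i.+1 < j)%N || (j.+1 < i)%N ->
  op i (op j v) = op j (op i v)).

Lemma tact_linear t : linear (tact t).
Proof.
elim: t => [b|i|x IHx y IHy|x IHx y IHy] a u v /=.
- by rewrite scalerDr !scalerA mulrC.
- exact: opL.
- by rewrite IHx IHy scalerDr addrACA.
- by rewrite IHy IHx.
Qed.

Lemma tact_cong x y : hcong x y -> tact x =1 tact y.
Proof.
have tD t u v : tact t (u + v) = tact t u + tact t v.
  by have := tact_linear t 1 u v; rewrite !scale1r.
have t0 t : tact t 0 = 0 by have := tact_linear t (-1) 0 0; rewrite !scaleN1r !oppr0 !addr0 addNr.
have tZ t a u : tact t (a *: u) = a *: tact t u.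
  by have := tact_linear t a u 0; rewrite t0 !addr0.
elim=> {x y} /=.
- by [].
- by move=> x y _ e v; rewrite e.
- by move=> x y z _ e _ e' v; rewrite e e'.
- by move=> x x' y y' _ e _ e' v; rewrite e e'.
- by move=> x x' y y' _ e _ e' v; rewrite e e'.
- by move=> x y z v; rewrite addrA.
- by move=> x y v; rewrite addrC.
- by move=> x v; rewrite scale0r add0r.
- by move=> x v; rewrite scaleN1r addNr scale0r.
- by [].
- by move=> x v; rewrite scale1r.
- by [].
- by move=> x y z v; rewrite tD.
- by move=> a b v; rewrite scalerDl.
- by move=> a b v; rewrite scalerA.
- by move=> a x v; rewrite tZ.
- by move=> i v; rewrite opI.
- by move=> i j ij v; rewrite opB.
- by move=> i j ij v; rewrite opC.
Qed.

Lemma op_act_class t v : op_act (hclass t) v = tact t v.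
Proof. by apply: tact_cong; exact: hrepr_class. Qed.

Lemma op_act_gen i v : op_act (hpi K i) v = op i v.
Proof. exact: op_act_class. Qed.

Fact op_act_linear h : linear (op_act h).
Proof. exact: tact_linear. Qed.

Fact op_act_linearl v : linear (op_act^~ v).
Proof.
move=> a; elim/hecke_ind=> x; elim/hecke_ind=> y.
by rewrite -[a *: hclass x]mulr_algl -hclass_scal -hclass_mul -hclass_add !op_act_class.
Qed.

Fact op_act1 v : op_act 1 v = v.
Proof. by rewrite op_act_class /= scale1r. Qed.

Fact op_actM h h' v : op_act (h * h') v = op_act h (op_act h' v).
Proof.
elim/hecke_ind: h => x; elim/hecke_ind: h' => y.
by rewrite -hclass_mul !op_act_class.
Qed.

Definition hm_of_op : heckeModule :=
  HeckeModule op_act_linear op_act_linearl op_act1 op_actM.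
End GeneratorAction.

(* B(I) is the space of K-valued functions on I; [bvec g] is the basis vector
   of g, and 0 when g is not in I. *)
Section IntervalModule.
Context (I : {set 'S_n}).

Definition bspace : vectType K := {ffun {g : 'S_n | g \in I} -> K^o}.

Definition bvec (g : 'S_n) : bspace := [ffun x => (val x == g)%:R].

Definition bgen (i : 'I_n.-1) (g : 'S_n) : bspace :=
  if i \in DesL g then bvec g
  else if pcomp (sadj i) g \in I then bvec (pcomp (sadj i) g) else 0.

Definition bop (i : 'I_n.-1) (v : bspace) : bspace :=
  \sum_x (v x : K) *: bgen i (val x).

Lemma bvec_out g : g \notin I -> bvec g = 0.
Proof.
move=> gI; apply/ffunP => x; rewrite !ffunE; case: eqP => // e.
by rewrite -e (valP x) in gI.
Qed.

Lemma bgenE i g : bgen i g = bvec (demazure i g).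
Proof.
rewrite /bgen /demazure; case: ifP => // _; case: ifP => // /negbT.
by move/bvec_out.
Qed.

Lemma bop_linear i : linear (bop i).
Proof.
move=> a u v; rewrite /bop scaler_sumr -big_split /=; apply: eq_bigr => x _.
by rewrite !ffunE scalerDl scalerA.
Qed.

Lemma bop_bvec i g : g \in I -> bop i (bvec g) = bgen i g.
Proof.
move=> gI; rewrite /bop (bigD1 (Sub g gI)) //= ffunE eqxx scale1r.
rewrite big1 ?addr0 // => x; rewrite -val_eqE /= => /negbTE xg.
by rewrite ffunE xg scale0r.
Qed.

Lemma bvec_span (v : bspace) : v = \sum_x (v x : K) *: bvec (val x).
Proof.
apply/ffunP => y; rewrite sum_ffunE (bigD1 y) //= !ffunE eqxx.
rewrite big1 ?addr0 => [|x]; first by rewrite /GRing.scale /= mulr1.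
by rewrite !ffunE eq_sym val_eqE => /negbTE ->; rewrite scaler0.
Qed.

Context (hI : is_intervalL I).

Lemma bop_up i s r g : I = intervalL s r -> leL s g -> bop i (bvec g) = bvec (demazure i g).
Proof.
move=> eI sg; have [gI|gI] := boolP (g \in I); first by rewrite bop_bvec // bgenE.
have e0 : bop i 0 = 0.
  by rewrite /bop big1 // => x _; rewrite ffunE scale0r.
rewrite bvec_out // e0 bvec_out //.
apply: contra gI; rewrite eI !inE sg => /andP[_ hr] /=.
by apply: connect_trans hr; exact: leL_demazure (connect0 _ _).
Qed.

Lemma bop_ext (f g : bspace -> bspace) s r : I = intervalL s r ->
  linear f -> linear g ->
  (forall x, leL s x -> f (bvec x) = g (bvec x)) -> f =1 g.
Proof.
move=> eI fL gL e v.
pose F := HB.pack_for {linear bspace -> bspace} f (GRing.isLinear.Build _ _ _ _ f fL).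
pose G := HB.pack_for {linear bspace -> bspace} g (GRing.isLinear.Build _ _ _ _ g gL).
rewrite (bvec_span v) -[f]/(F : _ -> _) -[g]/(G : _ -> _) !linear_sum.
apply: eq_bigr => x _; rewrite !linearZ /= e //.
have : sval x \in intervalL s r by rewrite -eI (valP x).
by rewrite inE => /andP[].
Qed.

Lemma comp_linear (f g : bspace -> bspace) : linear f -> linear g -> linear (f \o g).
Proof. by move=> fL gL a u v /=; rewrite gL fL. Qed.

Lemma interval_ends : exists s r, I = intervalL s r.
Proof. by have /existsP[s /existsP[r /andP[_ /eqP]]] := hI; exists s, r. Qed.

Fact bopI i v : bop i (bop i v) = bop i v.
Proof.
have [s [r eI]] := interval_ends; have L := bop_linear i.
apply: (bop_ext eI (comp_linear L L) L) v => x sx /=.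
by rewrite !(bop_up _ eI) ?leL_demazure // demazure_idem.
Qed.

Fact bopB (i j : 'I_n.-1) v : j = i.+1 :> nat ->
  bop i (bop j (bop i v)) = bop j (bop i (bop j v)).
Proof.
move=> ij; have [s [r eI]] := interval_ends.
have L := bop_linear i; have L' := bop_linear j.
apply: (bop_ext eI (comp_linear L (comp_linear L' L))
                (comp_linear L' (comp_linear L L'))) v => x sx /=.
by rewrite !(bop_up _ eI) ?leL_demazure // demazure_braid.
Qed.

Fact bopC (i j : 'I_n.-1) v : (i.+1 < j)%N || (j.+1 < i)%N ->
  bop i (bop j v) = bop j (bop i v).
Proof.
move=> ij; have [s [r eI]] := interval_ends.
have L := bop_linear i; have L' := bop_linear j.
apply: (bop_ext eI (comp_linear L L') (comp_linear L' L)) v => x sx /=.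
by rewrite !(bop_up _ eI) ?leL_demazure // demazure_comm.
Qed.

Definition Bmod : heckeModule := hm_of_op bop_linear bopI bopB bopC.

Lemma Bmod_pi i g : g \in I ->
  hact (hpi K i) (bvec g : Bmod) =
    if i \in DesL g then bvec g
    else if pcomp (sadj i) g \in I then bvec (pcomp (sadj i) g) else 0.
Proof. by move=> gI; rewrite [LHS](op_act_gen bop_linear bopI bopB bopC) bop_bvec. Qed.
End IntervalModule.

End HeckeModules.

Arguments heckeModule : clear implicits.
Arguments Bmod K {n I} hI.

Local Open Scope nat_scope.

Section Classes.
Context {n : nat}.

Definition order_iso {T U : finType} (A : {set T}) (rA : rel T)
    (B : {set U}) (rB : rel U) (f : T -> U) : Prop :=
  [/\ {in A &, injective f}, f @: A = B
    & {in A &, forall x y, rB (f x) (f y) = rA x y}].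

Definition posets_isomorphic {T U : finType} (A : {set T}) (rA : rel T)
    (B : {set U}) (rB : rel U) : Prop :=
  exists f : T -> U, order_iso A rA B rB f.

Definition simD (I J : {set 'S_n}) : Prop :=
  exists f : 'S_n -> 'S_n, order_iso I leL J leL f /\
    {in I, forall g, DesL (f g) = DesL g}.

Definition simD_class (J : {set 'S_n}) : {set {set 'S_n}} :=
  [set I | is_intervalL I && `[< simD I J >]].

Definition class_le : rel {set 'S_n} := fun I I' =>
  [exists s, exists r, exists s', exists r',
    [&& leL s r, leL s' r', I == intervalL s r, I' == intervalL s' r' & leR s s']].

(* C_Y for an H_n(0)-module Y. *)
Definition module_class (K : fieldType) (Y : heckeModule K n) : {set {set 'S_n}} :=
  [set I | `[< exists hI : is_intervalL I, hm_iso (Bmod K hI) Y >]].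

(* C_Y for Y = theta o chi [B(J)]; the module B(J) only makes sense when J is a
   left weak Bruhat interval. *)
Definition row_strict_class (K : fieldType) (J : {set 'S_n}) : {set {set 'S_n}} :=
  [set I | `[< exists hJ : is_intervalL J,
                 I \in module_class (hm_dual (Bmod K hJ)) >]].

Definition mul_w0 (I : {set 'S_n}) : {set 'S_n} := [set pcomp z w0 | z in I].
End Classes.

Definition is_composition (n : nat) (alpha : seq nat) : bool :=
  all (leq 1) alpha && (sumn alpha == n).

(* Boxes are pairs (column, row); rows, columns and the parts of a composition
   are numbered from 1. *)
Definition cpart (alpha : seq nat) (i : nat) : nat := nth 0 alpha i.-1.

Definition tcd_boxes (alpha : seq nat) : seq (nat * nat) :=
  [seq (j, i) | i <- iota 1 (size alpha), j <- iota 1 (cpart alpha i)].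

Definition diagram := {fset nat * nat}.

Definition tcd (alpha : seq nat) : diagram := [fset b in tcd_boxes alpha]%fset.

Definition transpose (D : diagram) : diagram := [fset (b.2, b.1) | b in D]%fset.

Definition flip_box (h : nat) (b : nat * nat) : nat * nat := (b.1, h.+1 - b.2).

(* Reflection across the x-axis, followed by the upward shift that makes row 1
   the lowest row. *)
Definition flip_x (D : diagram) : diagram :=
  [fset flip_box (\max_(c <- D) c.2) b | b in D]%fset.

Section Fillings.
Context {n : nat} {D : diagram}.
Implicit Types (T U : {ffun D -> 'I_n}) (b c : D).

Definition bcol b : nat := (val b).1.
Definition brow b : nat := (val b).2.

Definition bij_filling T : bool :=
  injectiveb T && [forall k, exists b, T b == k].

(* The permutation with one-line notation w. *)
Definition word_perm (w : seq 'I_n) : 'S_n :=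
  odflt 1%g [pick s : 'S_n | [seq s k | k <- enum 'I_n] == w].

Definition order_TL b c : bool :=
  (bcol b < bcol c) || (bcol b == bcol c) && (brow c <= brow b).
Definition order_RB b c : bool :=
  (brow b < brow c) || (brow b == brow c) && (bcol c <= bcol b).

Definition w_TL T : 'S_n := word_perm [seq T b | b <- sort order_TL (enum {: D})].
Definition w_RB T : 'S_n := word_perm [seq T b | b <- sort order_RB (enum {: D})].

Definition tleq : rel {ffun D -> 'I_n} := fun T U => leL (w_TL T) (w_TL U).

Definition rows_increasing T : bool :=
  [forall b, forall c, (brow b == brow c) && (bcol b < bcol c) ==> (T b < T c)].

Definition column_increasing (k : nat) T : bool :=
  [forall b, forall c,
    [&& bcol b == k, bcol c == k & brow b < brow c] ==> (T b < T c)].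

Definition columns_increasing T : bool :=
  [forall b, column_increasing (bcol b) T].

(* Here b = (k+1, r), c = (k, r') and d = (k+1, r'). *)
Definition triple_condition T : bool :=
  [forall b, forall c,
    [&& bcol b == (bcol c).+1, brow b < brow c & T c < T b] ==>
    [exists d, [&& bcol d == (bcol c).+1, brow d == brow c & T d < T b]]].

Definition same_column_order T U : bool :=
  [forall b, forall c, (bcol b == bcol c) ==> ((T b < T c) == (U b < U c))].
End Fillings.

Definition ST (n : nat) (D : diagram) : {set {ffun D -> 'I_n}} :=
  [set T | bij_filling T &&
    [forall b, forall c, (bcol b <= bcol c) && (brow b <= brow c) ==> (T b <= T c)]].

Section Tableaux.
Context (n : nat) (alpha : seq nat).
Implicit Types T : {ffun tcd alpha -> 'I_n}.

Definition SIT : {set {ffun tcd alpha -> 'I_n}} :=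
  [set T | [&& bij_filling T, rows_increasing T & column_increasing 1 T]].

Definition SET : {set {ffun tcd alpha -> 'I_n}} :=
  [set T | [&& bij_filling T, rows_increasing T & columns_increasing T]].

Definition SYCT : {set {ffun tcd alpha -> 'I_n}} :=
  [set T | [&& bij_filling T, rows_increasing T, column_increasing 1 T
             & triple_condition T]].

(* The entry of box b is alpha_1 + ... + alpha_(r-1) + c for b = (c, r);
   entries in 'I_n are shifted by one. *)
Definition is_canonical T : bool :=
  [forall b, (T b).+1 == sumn (take (brow b).-1 alpha) + bcol b].

Definition canonical_SYCT : {set {ffun tcd alpha -> 'I_n}} :=
  [set T in SYCT |
    [exists U, [&& U \in SYCT, is_canonical U & same_column_order U T]]].

Definition wRB_SIT : {set 'S_n} := [set w_RB T | T in SIT].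
Definition wRB_SET : {set 'S_n} := [set w_RB T | T in SET].
Definition wRB_canonical : {set 'S_n} := [set w_RB T | T in canonical_SYCT].
End Tableaux.

Section Diagrams.
Context (alpha : seq nat).
Let l := size alpha.

Definition diagram_V_boxes : seq (nat * nat) :=
  let k i := \sum_(i.+1 <= r < l.+1) (cpart alpha r - 1) in
  [seq (i, 1) | i <- iota 1 l] ++
  [seq (i, j + k i) | i <- iota 1 l, j <- iota 2 (cpart alpha i - 1)].

Definition diagram_V : diagram := [fset b in diagram_V_boxes]%fset.

Definition diagram_X : diagram := transpose (tcd alpha).

Definition in_BB (b : nat * nat) : bool :=
  if b.1 == 1 then (b.2 < l) && (1 < cpart alpha b.2) || (b.2 == l)
  else ~~ has (fun c => ((c.1 == b.1) || (c.1.+1 == b.1)) && (b.2 < c.2))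
              (tcd_boxes alpha).

Definition BB : seq (nat * nat) :=
  sort (fun b c => (b.1 < c.1) || (b.1 == c.1) && (b.2 <= c.2))
       [seq b <- tcd_boxes alpha | in_BB b].

(* Appends boxes of A to Y, starting from the last box listed, kappa; every
   step moves one column to the right and uses up a box of A, so that fuel
   equal to the size of A is enough. *)
Fixpoint extend (fuel : nat) (A Y : seq (nat * nat)) (kappa : nat * nat) :
    seq (nat * nat) :=
  if fuel isn't f.+1 then Y else
  match sort (fun b c => b.2 <= c.2)
             [seq b <- A | [&& b \notin Y, b.1 == kappa.1.+1 & b.2 < kappa.2]] with
  | [::] => Y
  | b :: _ => extend f A (rcons Y b) b
  end.

(* [(1, d), (1, d-1), ..., (1, d'+1)] *)
Definition column1 (d d' : nat) : seq (nat * nat) :=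
  [seq (1, y) | y <- rev (iota d'.+1 (d - d'))].

(* The lists Y_(j+1), ..., Y_l, where A = A_j, d = d_j and
   bs = (b_(j+1), d_(j+1)), ..., (b_l, d_l). *)
Fixpoint Ylists (A : seq (nat * nat)) (d : nat) (bs : seq (nat * nat)) :
    seq (seq (nat * nat)) :=
  if bs isn't b :: bs' then [::] else
  let start := if b.1 == 1 then column1 b.2 d else [:: b] in
  let Y := extend (size A) A start (last b start) in
  Y :: Ylists [seq c <- A | c \notin Y] b.2 bs'.

Definition Y_all : seq (seq (nat * nat)) :=
  if BB isn't b :: bs then [::] else
  let Y1 := column1 b.2 0 in
  Y1 :: Ylists [seq c <- tcd_boxes alpha | c \notin Y1] b.2 bs.

Definition X_row (i : nat) : seq (nat * nat) :=
  [seq (j, i) | j <- iota 1 (cpart alpha i)].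

Definition diagram_C_boxes : seq (nat * nat) :=
  [seq p <- [seq (i, j) | i <- iota 1 l, j <- iota 1 (size Y_all)]
     | has (mem (X_row p.1)) (nth [::] Y_all p.2.-1)].

Definition diagram_C : diagram := [fset b in diagram_C_boxes]%fset.
End Diagrams.

(* Main.v *)
From HB Require Import structures.
Require Import Defs.
From mathcomp Require Import all_boot all_order all_fingroup all_algebra.
From mathcomp Require Import finmap boolp reals.
From mathcomp.real_closed Require Import complex.
From mathcomp Require Import zify.
(* Defs.pcomp and ssrfun.pcomp share their name. *)
Import Defs.

(* For a left weak Bruhat interval J, the signed dual basis identifies
   theta o chi [B(J)] with B(J w0), and an isomorphism B(I) -> B(J) forces
   I ~_D J: by induction on the length, its diagonal coefficients along the
   elements w s do not vanish, where s is the minimum of I, because the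
   0-Hecke action is monotone for the Bruhat order.  Hence the class of the
   row-strict module is {I w0 : I ~_D J}.

   Two equivalent intervals differ by right multiplication by a permutation.
   When J is the set of reading words of the linear extensions of a diagram D
   (ordered by the product order) in which no covering pair differs in both
   coordinates, I ~_D J iff I consists of the same linear extensions read in an
   order extending the relation "weakly right and weakly below".  The opposite
   reading orders are the tableaux of the shape obtained from the transpose of
   D by a reflection, and comparing minima gives the order isomorphism.

   It remains to see that each of the three families of tableaux consists of
   the linear extensions of the given diagram, box (c, r) of tcd(alpha) being
   sent to column r and to a row determined by c and r.  For the canonical
   class the row is the index of the chain Y_j through (c, r); following
   that chain leftwards to the first column, through virtual rows above the
   last one if necessary, makes the index comparable with the tableau order. *)

Set Implicit Arguments.
Unset Strict Implicit.
Unset Printing Implicit Defensive.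

(** * The weak order *)

Section WeakOrder.
Context {n : nat}.
Implicit Types (s t u : 'S_n) (i : 'I_n.-1) (p q : 'I_n).

(** An isomorphism of modules need not send basis vectors to basis vectors, and the operators
    [demazure i] do not preserve the left weak order: 1 lies below s_1, yet s_2 and s_2 s_1 are
    incomparable. They do preserve the Bruhat order, in which comparable permutations of equal
    length coincide; lengths therefore isolate a single term of each image.

    Descents of a reading word compare only boxes carrying consecutive entries. Hence the condition
    on covering pairs: one differing in both coordinates can carry consecutive entries while its
    reading positions are unrelated, so its descents would vary with the reading order. Conversely,
    boxes whose reading order is prescribed are linked through pairs that are consecutive in some
    linear extension, so descents determine the prescribed part.

    The greedy lists Y_j run rightwards and downwards and depend on what earlier lists left.
    Backwards the rule has no memory: from column c+1 go to the lowest higher row that reaches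
    column c. With the virtual rows, the end of this walk is a monotone function of the starting
    row. *)

Lemma leL_refl s : leL s s. Proof. exact: connect0. Qed.

Lemma leL_trans : transitive (@leL n). Proof. exact: connect_trans. Qed.

Lemma leL_cover i s : i \notin DesL s -> leL s (pcomp (sadj i) s).
Proof. exact: leL_step. Qed.

Lemma notin_DesL s i :
  (i \notin DesL s) = ((s^-1)%g (ord_lo i) < (s^-1)%g (ord_hi i)).
Proof.
rewrite in_DesL -leqNgt leq_eqVlt; case: eqP => // e.
by have := @pos_neq n i s^-1%g e.
Qed.

Lemma DesL_sadj s i : (i \in DesL (pcomp (sadj i) s)) = (i \notin DesL s).
Proof. by rewrite in_DesL notin_DesL !sadj_inv tpermL tpermR. Qed.

Lemma ninv_cover s i : i \notin DesL s -> ninv (pcomp (sadj i) s) = (ninv s).+1.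
Proof. by rewrite notin_DesL; apply: ninv_up. Qed.

(** Inversions are pairs of positions: left multiplication by [sadj i] exchanges two values, so
    going up in the left weak order only adds such pairs. *)
Definition inv_sub s t : Prop := forall p q, p < q -> s q < s p -> t q < t p.

Lemma perm_neq s p q : p < q -> s p <> s q :> nat.
Proof. by move=> pq /val_inj /perm_inj e; rewrite e ltnn in pq. Qed.

Lemma sadj_lt i (a b : 'I_n) : (a != ord_lo i) || (b != ord_hi i) -> a < b ->
  sadj i a < sadj i b.
Proof.
rewrite -!val_eqE /= !sadj_val => h ab.
by move: h; do ![case: eqP => /=]; lia.
Qed.

Lemma inv_sub_cover s i : i \notin DesL s -> inv_sub s (pcomp (sadj i) s).
Proof.
move=> hi p q pq sqp; rewrite !pcompE; apply: sadj_lt => //.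
apply: contraT; rewrite negb_or !negbK => /andP[/eqP e1 /eqP e2].
by move: hi; rewrite notin_DesL -e1 -e2 !permK ltnNge (ltnW pq).
Qed.

(** The step receives bounds by both [s] and [t], because many properties are known only on an
    interval: with convexity, the bounds keep the walk inside it. *)
Lemma leL_ind_step (P : 'S_n -> Prop) s t : P s ->
  (forall u i, leL s u -> i \notin DesL u -> leL (pcomp (sadj i) u) t -> P u ->
     P (pcomp (sadj i) u)) ->
  leL s t -> P t.
Proof.
move=> Ps step /connectP[w wP et]; move: step; rewrite {}et.
move: wP; elim/last_ind: w => // w x IH; rewrite rcons_path last_rcons => /andP[wP].
move=> /existsP[i /andP[hi /eqP e]] step.
have wl : leL s (last s w) by apply/connectP; exists w.
have Pw : P (last s w).
  apply: IH => // u j su hj ujt; apply: step => //.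
  by apply: leL_trans ujt _; rewrite e; exact: leL_cover.
by rewrite e; apply: step => //; rewrite e; exact: leL_refl.
Qed.

Lemma leL_inv_sub s t : leL s t -> inv_sub s t.
Proof.
move=> st; apply: (leL_ind_step _ _ st) => // u i _ hi _ su p q pq /(su _ _ pq).
exact: inv_sub_cover.
Qed.

(** Take a descent i of t s^-1, so that [t] inverts the order of the positions of i and i+1 in [s].
    If i were a descent of [s], inclusion would force the opposite order in [t]. *)
Lemma inv_subP s t : inv_sub s t -> s <> t ->
  exists2 i, i \notin DesL s & inv_sub (pcomp (sadj i) s) t.
Proof.
move=> st snt.
have [i hi] : exists i : 'I_n.-1,
    t ((s^-1)%g (ord_hi i)) < t ((s^-1)%g (ord_lo i)).
  apply/existsP; apply: contraT; rewrite negb_exists => /forallP h.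
  case: snt; suff e : (s^-1 * t = 1)%g by apply/eqP; rewrite eq_mulVg1 e.
  apply: no_descent => i; rewrite !permM; have := h i; rewrite -leqNgt leq_eqVlt.
  by case/orP => // /eqP/val_inj/perm_inj/perm_inj/(congr1 val) /= /n_Sn.
exists i.
  rewrite notin_DesL ltn_neqAle; apply/andP; split; first by apply/eqP/pos_neq.
  rewrite leqNgt; apply/negP => /st; rewrite !permKV /= ltnSn => /(_ isT).
  by rewrite ltnNge (ltnW hi).
move=> p q pq; rewrite !pcompE => h.
case: (boolP ((s p == ord_lo i) && (s q == ord_hi i))) => [/andP[/eqP e1 /eqP e2]|].
  by move: hi; rewrite -e1 -e2 !permK.
rewrite negb_and => /sadj_lt h'.
apply: st => //; rewrite ltnNge leq_eqVlt negb_or; apply/andP; split.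
  by apply/eqP/perm_neq.
by apply/negP => /h'; rewrite ltnNge (ltnW h).
Qed.

Lemma inv_sub_ninv s t : inv_sub s t -> ninv s <= ninv t.
Proof.
have E u : ninv u = #|[set ab : 'I_n * 'I_n | (ab.1 < ab.2) && (u ab.2 < u ab.1)]|.
  pose f (ab : 'I_n * 'I_n) := (u ab.2, u ab.1).
  have fI : injective f by case=> a b [c d] [/perm_inj -> /perm_inj ->].
  rewrite -(card_imset _ fI); apply: eq_card => -[a b]; rewrite !inE /=.
  apply/idP/imsetP => [/andP[ab ba]|[[c d]]].
    by exists ((u^-1)%g b, (u^-1)%g a); rewrite ?inE /f /= ?permKV ?ba ?ab.
  by rewrite inE /= => /andP[cd dc] [-> ->]; rewrite !permK dc cd.
move=> st; rewrite !E; apply/subset_leq_card/subsetP => -[a b]; rewrite !inE /=.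
by move=> /andP[ab ba]; rewrite ab st.
Qed.

Lemma leLP s t : reflect (inv_sub s t) (leL s t).
Proof.
apply: (iffP idP) => [|st]; first exact: leL_inv_sub.
have [k] := ubnP (ninv t - ninv s); elim: k => // k IH in s st * => hk.
have [-> |/eqP snt] := eqVneq s t; first exact: leL_refl.
have [i hi st'] := inv_subP st snt.
apply: leL_trans (leL_cover hi) (IH _ st' _).
by have := inv_sub_ninv st'; rewrite ninv_cover //; lia.
Qed.

Lemma leL_first s t : leL s t -> s <> t ->
  exists2 i, i \notin DesL s & leL (pcomp (sadj i) s) t.
Proof. by move=> /leLP st /(inv_subP st)[i hi /leLP]; exists i. Qed.

Lemma leL_ninv s t : leL s t -> ninv s <= ninv t.
Proof. by move/leLP/inv_sub_ninv. Qed.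

Lemma leL_ninv_eq s t : leL s t -> ninv t <= ninv s -> s = t.
Proof.
move=> st h; apply: contrapT => /(leL_first st)[i hi /leL_ninv].
by rewrite ninv_cover //; lia.
Qed.

Lemma leL_anti s t : leL s t -> leL t s -> s = t.
Proof. by move=> st /leL_ninv; apply: leL_ninv_eq. Qed.

Lemma ninvV s : ninv (s^-1)%g = ninv s.
Proof.
pose f (ab : 'I_n * 'I_n) := ((s^-1)%g ab.2, (s^-1)%g ab.1).
have fI : injective f by case=> a b [c d] [/perm_inj -> /perm_inj ->].
rewrite [RHS]/ninv -(card_imset _ fI); apply: eq_card => -[a b].
rewrite !inE invgK /=; apply/idP/imsetP => [/andP[ab ba]|[[c d]]].
  by exists (s b, s a); rewrite ?inE /f /= ?permK ?ba ?ab.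
by rewrite inE /= => /andP[cd dc] [-> ->]; rewrite !permKV dc cd.
Qed.

Lemma sadjV i : ((sadj i)^-1)%g = sadj i. Proof. exact: tpermV. Qed.

Lemma pcompV s t : ((pcomp s t)^-1)%g = pcomp (t^-1)%g (s^-1)%g.
Proof. exact: invMg. Qed.

Lemma DesR_V s : DesR s = DesL (s^-1)%g.
Proof.
apply/setP => i; rewrite !inE !coxlenE ninvV.
by rewrite -[in RHS](sadjV i) -pcompV ninvV.
Qed.

Lemma leR_V s t : leR s t = leL (s^-1)%g (t^-1)%g.
Proof.
pose e (a b : 'S_n) := [exists i, (i \notin DesL a) && (b == pcomp (sadj i) a)].
pose e' (a b : 'S_n) := [exists i, (i \notin DesR a) && (b == pcomp a (sadj i))].
have ee a b : e' a b = e (a^-1)%g (b^-1)%g.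
  apply: eq_existsb => i; rewrite DesR_V; congr andb.
  by rewrite -{2}(sadjV i) -pcompV (inj_eq invg_inj).
have map_path_e a w : path e' a w = path e (a^-1)%g (map invg w).
  by rewrite path_map; apply: eq_path => b c; rewrite ee.
rewrite -[leR s t]/(connect e' s t) -[leL _ _]/(connect e (s^-1)%g (t^-1)%g).
apply/connectP/connectP => -[w wP wl].
  by exists (map invg w); rewrite -?map_path_e // last_map -wl.
exists (map invg w).
  by rewrite map_path_e -map_comp (eq_map (@invgK _)) map_id.
by rewrite -[s in last s]invgK last_map -wl invgK.
Qed.

Lemma DesL_w0 i : i \in DesL (@w0 n).
Proof.
apply: contraT => hi; rewrite /w0 in hi *; case: arg_maxnP hi => // s _ smax hi.
by have := smax (pcomp (sadj i) s) isT; rewrite !coxlenE ninv_cover //; lia.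
Qed.

Definition rev_perm : 'S_n := perm rev_ord_inj.

(** Pins down [w0], which is given only by maximal length: maximality makes every i a descent, and
    then the reversal followed by [s^-1] has no descent. *)
Lemma DesL_full s : (forall i, i \in DesL s) -> s = rev_perm.
Proof.
move=> h; suff e : (rev_perm * s^-1 = 1)%g.
  by apply/esym/eqP; rewrite eq_mulgV1 e.
apply: no_descent => i; rewrite !permM !(permE rev_ord_inj).
have hi : n.-2 - i < n.-1 by have := ltn_ord i; lia.
have -> : rev_ord (ord_lo i) = ord_hi (Ordinal hi).
  by apply: val_inj => /=; have := ltn_ord i; lia.
have -> : rev_ord (ord_hi i) = ord_lo (Ordinal hi).
  by apply: val_inj => /=; have := ltn_ord i; lia.
by rewrite -in_DesL.
Qed.

Lemma w0E : @w0 n = rev_perm. Proof. exact/DesL_full/DesL_w0. Qed.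

Lemma w0_val (x : 'I_n) : @w0 n x = rev_ord x. Proof. by rewrite w0E permE. Qed.

Lemma w0V : ((@w0 n)^-1)%g = w0.
Proof.
apply/eqP; rewrite eq_invg_mul; apply/eqP.
by apply/permP => x; rewrite permM !w0_val rev_ordK perm1.
Qed.

Lemma pcompw0K s : pcomp (pcomp s w0) w0 = s.
Proof. by rewrite /pcomp mulgA -{1}w0V mulVg mul1g. Qed.

Lemma DesL_mulw0 s i : (i \in DesL (pcomp s w0)) = (i \notin DesL s).
Proof.
rewrite in_DesL notin_DesL pcompV w0V !pcompE !w0_val /=.
by have := ltn_ord ((s^-1)%g (ord_lo i)); have := ltn_ord ((s^-1)%g (ord_hi i)); lia.
Qed.

Lemma pcompA s t u : pcomp s (pcomp t u) = pcomp (pcomp s t) u.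
Proof. exact: (esym (mulgA _ _ _)). Qed.

Lemma leL_mulw0 s t : leL (pcomp s w0) (pcomp t w0) = leL t s.
Proof.
suff h (a b : 'S_n) : leL a b -> leL (pcomp b w0) (pcomp a w0).
  by apply/idP/idP => /h //; rewrite !pcompw0K.
move=> ab; pose P b := leL (pcomp b w0) (pcomp a w0).
apply: (@leL_ind_step P _ _ _ _ ab); first exact: leL_refl.
move=> u i _ hi _; rewrite /P; apply: leL_trans; rewrite -[X in leL _ (pcomp X w0)](sadjK i u) -[X in leL _ X]pcompA.
by apply: leL_cover; rewrite DesL_mulw0 negbK DesL_sadj.
Qed.

End WeakOrder.

(** * The Bruhat order *)

Section Bruhat.
Context {n : nat}.
Implicit Types (s t u : 'S_n) (i : 'I_n.-1) (p q : nat) (w : seq 'I_n.-1).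

(** The rank matrix; its entrywise comparison is the usual criterion for the Bruhat order, taken
    here as its definition. *)
Definition rk s p q : nat := #|[set x : 'I_n | (x < p) && (q <= s x)]|.

Definition bruhat s t : Prop := forall p q, rk s p q <= rk t p q.

Lemma rk_step s p (v : 'I_n) : rk s p v = ((s^-1)%g v < p) + rk s p v.+1.
Proof.
rewrite /rk [LHS](cardsD1 ((s^-1)%g v)) inE permKV leqnn andbT; congr addn.
apply: eq_card => x; rewrite !inE [v < _]ltn_neqAle andbCA; congr (_ && (_ && _)).
by rewrite -(inj_eq (@perm_inj _ s)) permKV -val_eqE eq_sym.
Qed.

(** After the operator, the value i+1 stands at the earlier of the two positions of i and i+1, which
    affects only the entries with q = i+1. The minimum expresses this through the neighbouring
    entries and is monotone in them, whence [bruhat_demazure]. *)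
Lemma rk_demazure i s p q :
  rk (demazure i s) p q =
    if q == i.+1 then minn (rk s p i) (rk s p i.+2).+1 else rk s p q.
Proof.
have out r : r != i.+1 -> rk (demazure i s) p r = rk s p r.
  move=> hr; rewrite /demazure; case: ifP => // _.
  apply: eq_card => x; rewrite !inE pcompE sadj_val; congr andb.
  by move: hr; do ![case: eqP => /=]; lia.
case: eqP => [->|/eqP]; last exact: out.
rewrite -[i.+1]/(val (ord_hi i)) rk_step /= out; last by rewrite eqn_leq ltnn.
have := rk_step s p (ord_lo i); have := rk_step s p (ord_hi i) => /= -> ->.
have -> : ((demazure i s)^-1)%g (ord_hi i) =
    minn ((s^-1)%g (ord_lo i)) ((s^-1)%g (ord_hi i)) :> nat.
  rewrite /demazure; case: ifPn; first by rewrite in_DesL; lia.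
  by rewrite notin_DesL sadj_inv tpermR; lia.
by case: leqP; case: leqP; case: leqP; lia.
Qed.

Lemma bruhat_trans s t u : bruhat s t -> bruhat t u -> bruhat s u.
Proof. by move=> st tu p q; apply: leq_trans (tu p q). Qed.

Lemma bruhat_anti s t : bruhat s t -> bruhat t s -> s = t.
Proof.
move=> st ts; have e p q : rk s p q = rk t p q by apply/eqP; rewrite eqn_leq st ts.
have e' p (v : 'I_n) : ((s^-1)%g v < p) = ((t^-1)%g v < p).
  have := rk_step s p v; rewrite e rk_step e => /addIn.
  by do 2!case: (_ < p).
apply: invg_inj; apply/permP => v; apply: val_inj; apply/eqP; rewrite eqn_leq.
by rewrite -ltnS e' ltnSn -ltnS -e' ltnSn.
Qed.

Lemma bruhat_demazure i s t : bruhat s t -> bruhat (demazure i s) (demazure i t).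
Proof.
move=> st p q; rewrite !rk_demazure; case: ifP => // _.
by have := st p i; have := st p i.+2; lia.
Qed.

Lemma demazure_ge i s : bruhat s (demazure i s).
Proof.
move=> p q; rewrite rk_demazure; case: eqP => // ->.
have := rk_step s p (ord_lo i); have := rk_step s p (ord_hi i) => /=.
by case: (_ < p); case: (_ < p); lia.
Qed.

Definition dem w s : 'S_n := foldr demazure s w.

Lemma dem_cat w1 w2 s : dem (w1 ++ w2) s = dem w1 (dem w2 s).
Proof. exact: foldr_cat. Qed.

Lemma bruhat_dem w s t : bruhat s t -> bruhat (dem w s) (dem w t).
Proof. by move=> st; elim: w => //= i w; apply: bruhat_demazure. Qed.

Lemma dem_ge w s : bruhat s (dem w s).
Proof. by elim: w => //= i w IH; apply: bruhat_trans IH (demazure_ge _ _). Qed.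

Lemma leL_dem w s : leL s (dem w s).
Proof. by elim: w => [|i w IH] /=; [exact: leL_refl | exact: leL_demazure]. Qed.

(* The word w climbs from s in the left weak order, last letter first. *)
Fixpoint climbs w s : bool :=
  if w is i :: w' then climbs w' s && (i \notin DesL (dem w' s)) else true.

Lemma climbs_ninv w s : climbs w s -> ninv (dem w s) = size w + ninv s.
Proof.
elim: w => //= i w IH /andP[/IH e hi].
by rewrite /demazure (negbTE hi) ninv_cover // e.
Qed.

Lemma leL_climb s t : leL s t -> exists2 w, climbs w s & dem w s = t.
Proof.
move=> st; pose P t := exists2 w, climbs w s & dem w s = t.
apply: (@leL_ind_step _ P _ _ _ _ st) => [|u i _ hi _ [w wP e]]; first by exists [::].
by exists (i :: w); rewrite /= ?wP e ?hi // /demazure (negbTE hi).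
Qed.

Lemma climbs_cat w1 w2 s : climbs (w1 ++ w2) s = climbs w2 s && climbs w1 (dem w2 s).
Proof.
elim: w1 => [|i w1 IH] /=; first by rewrite andbT.
by rewrite IH dem_cat andbA.
Qed.

Lemma leL_bruhat s t : leL s t -> bruhat s t.
Proof. by case/leL_climb => w _ <-; exact: dem_ge. Qed.

(** Induction downwards from the longest element. At a non-descent i of [s], applying [demazure i]
    to both sides lengthens [s] by one and [t] by at most one; if [t] stays fixed, the original
    lengths differed strictly. *)
Lemma bruhat_ninv s t : bruhat s t ->
  ninv s <= ninv t /\ (ninv t <= ninv s -> s = t).
Proof.
have [k] := ubnP (n * n - ninv s); elim: k => // k IH in s t * => hk st.
have ub u : ninv u <= n * n.
  by apply: leq_trans (max_card _) _; rewrite card_prod card_ord.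
case: (boolP [forall i, i \in DesL s]) => [/forallP/DesL_full e|].
  have -> : s = t.
    apply: bruhat_anti => //; rewrite e; apply/leL_bruhat/leLP => p q pq _.
    by rewrite !permE /=; have := ltn_ord p; have := ltn_ord q; lia.
  by split.
rewrite negb_forall => /existsP[i hi]; have := bruhat_demazure i st.
rewrite {1}/demazure (negbTE hi).
have e := ninv_cover hi; have := ub (pcomp (sadj i) s); rewrite e => he.
rewrite /demazure; case: ifPn => ht /IH; rewrite e => -[]; first by lia.
  by move=> h _; split; lia.
  by lia.
rewrite ninv_cover // => h h'; split; first by lia.
by move=> hts; have /(congr1 (pcomp (sadj i))) := h' hts; rewrite !sadjK.
Qed.
End Bruhat.

(** * Equivalent intervals *)

Section Intervals.
Context {n : nat}.
Implicit Types (s t u g h z : 'S_n) (i j : 'I_n.-1) (w : seq 'I_n.-1) (I J : {set 'S_n}).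

Lemma intervalLP s r g : reflect (leL s g /\ leL g r) (g \in intervalL s r).
Proof. by rewrite inE; apply: andP. Qed.

Lemma is_intervalLP I :
  reflect (exists s r, leL s r /\ I = intervalL s r) (is_intervalL I).
Proof.
apply: (iffP existsP) => [[s /existsP[r /andP[sr /eqP ->]]]|[s [r [sr ->]]]].
  by exists s, r.
by exists s; apply/existsP; exists r; rewrite sr eqxx.
Qed.

Lemma intervalL_convex I g h u : is_intervalL I -> g \in I -> h \in I ->
  leL g u -> leL u h -> u \in I.
Proof.
move=> /is_intervalLP[s [r [_ ->]]] /intervalLP[sg _] /intervalLP[_ hr] gu uh.
by apply/intervalLP; split; [exact: leL_trans gu | exact: leL_trans hr].
Qed.

Lemma intervalL_left s r : leL s r -> s \in intervalL s r.
Proof. by move=> sr; apply/intervalLP; split => //; exact: leL_refl. Qed.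

Lemma intervalL_right s r : leL s r -> r \in intervalL s r.
Proof. by move=> sr; apply/intervalLP; split => //; exact: leL_refl. Qed.

Lemma intervalL_inj s r s' r' : leL s r -> leL s' r' ->
  intervalL s r = intervalL s' r' -> s = s' /\ r = r'.
Proof.
move=> sr sr' e.
have /intervalLP[a1 a2] : s \in intervalL s' r' by rewrite -e intervalL_left.
have /intervalLP[a3 a4] : r \in intervalL s' r' by rewrite -e intervalL_right.
have /intervalLP[a5 a6] : s' \in intervalL s r by rewrite e intervalL_left.
have /intervalLP[a7 a8] : r' \in intervalL s r by rewrite e intervalL_right.
by split; apply: leL_anti.
Qed.

Definition mul_perm I z : {set 'S_n} := [set pcomp g z | g in I].

Lemma pcomp_injr z : injective (fun g => pcomp g z).
Proof. by move=> g h /mulgI. Qed.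

Lemma pcompK z g : pcomp (pcomp g z) (z^-1)%g = g.
Proof. exact: mulKg. Qed.

Lemma pcompVK z g : pcomp (pcomp g (z^-1)%g) z = g.
Proof. exact: mulKVg. Qed.

Lemma mem_mul_perm I z g : (pcomp g z \in mul_perm I z) = (g \in I).
Proof. exact: (mem_imset _ _ (@pcomp_injr z)). Qed.

Lemma mul_permM I z z' : mul_perm (mul_perm I z) z' = mul_perm I (pcomp z z').
Proof. by rewrite /mul_perm -imset_comp; apply: eq_imset => g /=; rewrite pcompA. Qed.

Lemma mul_perm1 I : mul_perm I 1%g = I.
Proof. by rewrite /mul_perm -[RHS]imset_id; apply: eq_imset => g; exact: mul1g. Qed.

Lemma mul_permK I z : mul_perm (mul_perm I z) (z^-1)%g = I.
Proof. by rewrite mul_permM -{2}[I]mul_perm1; congr mul_perm; exact: mulVg. Qed.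

Lemma leL_mul_perm I z g h : is_intervalL I ->
  {in I, forall g, DesL (pcomp g z) = DesL g} ->
  g \in I -> h \in I -> leL g h -> leL (pcomp g z) (pcomp h z).
Proof.
move=> hI hD gI hhI gh; pose P h := leL (pcomp g z) (pcomp h z).
apply: (@leL_ind_step _ P _ _ _ _ gh) => [|u i gu hi uh Pu]; first exact: leL_refl.
have uI : u \in I.
  by apply: (intervalL_convex hI gI hhI gu); apply: leL_trans uh; exact: leL_cover.
rewrite /P -pcompA; apply: leL_trans Pu _; apply: leL_cover.
by rewrite hD.
Qed.

(** Lets descent sets name the label of a cover. If j = i+1, the value i+1 of s_i g stands where [g]
    has i, which precedes i+1 and hence i+2; j = i-1 is symmetric, and a distant j is unaffected. *)
Lemma des_cover i j g : i \notin DesL g -> j \notin DesL g ->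
  j \in DesL (pcomp (sadj i) g) -> i = j.
Proof.
rewrite !notin_DesL in_DesL !sadj_inv => hi hj.
case: (ltngtP i j) => [ij|ji|/val_inj //].
- have [e|ne] := eqVneq i.+1 (j : nat); last first.
    have [|-> ->] := @sadj_out n i j; first by move: ne; lia.
    by rewrite ltnNge (ltnW hj).
  have e1 : ord_lo j = ord_hi i by apply: val_inj => /=; rewrite -e.
  have -> : sadj i (ord_hi j) = ord_hi j.
    by apply: val_inj; rewrite /= sadj_val /=; do ![case: eqP]; lia.
  by rewrite e1 tpermR; move: hj; rewrite e1; lia.
- have [e|ne] := eqVneq j.+1 (i : nat); last first.
    have [|-> ->] := @sadj_out n i j; first by move: ne; lia.
    by rewrite ltnNge (ltnW hj).
  have e1 : ord_hi j = ord_lo i by apply: val_inj => /=; rewrite -e.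
  have -> : sadj i (ord_lo j) = ord_lo j.
    by apply: val_inj; rewrite /= sadj_val /=; do ![case: eqP]; lia.
  by rewrite e1 tpermL; move: hj; rewrite e1; lia.
Qed.

(** The cover is mapped to a cover, whose label j is a descent gained by the image. Since [f]
    respects descents, j is also gained on the side of [g], and [des_cover] leaves only j = i. *)
Lemma simD_step I J (f : 'S_n -> 'S_n) g i : is_intervalL J ->
  order_iso I leL J leL f -> {in I, forall g, DesL (f g) = DesL g} ->
  g \in I -> i \notin DesL g -> pcomp (sadj i) g \in I ->
  f (pcomp (sadj i) g) = pcomp (sadj i) (f g).
Proof.
move=> hJ [f_inj fI fle] fD gI hi gI'; set g' := pcomp (sadj i) g in gI' *.
have fJ x : x \in I -> f x \in J by move=> xI; rewrite -fI imset_f.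
have gg' : leL g g' by exact: leL_cover.
have ng : f g <> f g'.
  by move/f_inj => /(_ gI gI') e; have := ninv_cover hi; rewrite -/g' -e => /n_Sn.
have [j hj jg'] : exists2 j, j \notin DesL (f g) & leL (pcomp (sadj j) (f g)) (f g').
  by apply: leL_first ng; rewrite fle.
have : pcomp (sadj j) (f g) \in J.
  by apply: (intervalL_convex hJ (fJ _ gI) (fJ _ gI') _ jg'); exact: leL_cover.
(* The preimage [h] lies strictly above [g] and weakly below its cover [g'], so it is [g']. *)
rewrite -fI => /imsetP[h hI eh].
have gh : leL g h by rewrite -fle // -eh; exact: leL_cover.
have hg' : leL h g' by rewrite -fle // -eh.
have ngh : g <> h.
  by move=> e; have := ninv_cover hj; rewrite eh e => /n_Sn.
have e : h = g'.
  apply: (leL_ninv_eq hg'); rewrite ninv_cover //.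
  by rewrite ltnNge; apply/negP => /(leL_ninv_eq gh).
rewrite -e -eh; congr (pcomp (sadj _) _); apply/esym.
have := des_cover hi _ _; apply.
  by rewrite -fD.
by rewrite -/g' -e -fD // -eh DesL_sadj.
Qed.

(** As [f] commutes with the covers of [I] and every element is reached from the minimum s, [f] is
    right multiplication by s^-1 f(s). Conversely, equal descents make right multiplication preserve
    covers both ways. *)
Lemma simDP I J : is_intervalL I -> is_intervalL J ->
  simD I J <-> exists z, J = mul_perm I z /\ {in I, forall g, DesL (pcomp g z) = DesL g}.
Proof.
move=> hI hJ; split=> [[f [fiso fD]]|[z [eJ zD]]].
  have [s [r [sr eI]]] := is_intervalLP _ hI.
  have sI : s \in I by rewrite eI intervalL_left.
  pose z := pcomp (s^-1)%g (f s); exists z.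
  have fE g : g \in I -> f g = pcomp g z.
    move=> gI; have sg : leL s g by move: gI; rewrite eI => /intervalLP[].
    pose P g := f g = pcomp g z.
    apply: (@leL_ind_step _ P _ _ _ _ sg) => [|u i su hi ug Pu].
      exact/esym/mulgKV.
    have uI' : pcomp (sadj i) u \in I.
      apply: (intervalL_convex hI sI gI _ ug); exact: leL_trans su (leL_cover hi).
    have uI : u \in I.
      apply: (intervalL_convex hI sI uI' su); exact: leL_cover.
    by rewrite /P (simD_step hJ fiso fD) // Pu pcompA.
  case: fiso => _ fI _; split; last by move=> g gI; rewrite -fE // fD.
  by rewrite -fI; apply: eq_in_imset.
exists (fun g => pcomp g z); split=> //; split; first by move=> g h _ _; exact: pcomp_injr.
  by rewrite eJ.
move=> g h gI hhI; apply/idP/idP; last exact: (leL_mul_perm hI).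
rewrite -{2}[g](pcompK z) -{2}[h](pcompK z).
apply: (leL_mul_perm hJ); rewrite ?eJ ?mem_mul_perm //.
by move=> _ /imsetP[u uI ->]; rewrite pcompK zD.
Qed.

Lemma mul_permw0_interval s r :
  mul_perm (intervalL s r) w0 = intervalL (pcomp r w0) (pcomp s w0).
Proof.
apply/setP => g; rewrite -[g]pcompw0K mem_mul_perm !inE !leL_mulw0.
by rewrite andbC.
Qed.

Lemma is_intervalL_mulw0 I : is_intervalL I -> is_intervalL (mul_perm I w0).
Proof.
move=> /is_intervalLP[s [r [sr ->]]]; apply/is_intervalLP.
by exists (pcomp r w0), (pcomp s w0); rewrite leL_mulw0 mul_permw0_interval.
Qed.

Lemma mul_w0E I : mul_w0 I = mul_perm I w0. Proof. by []. Qed.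

Lemma mul_permw0K I : mul_perm (mul_perm I w0) w0 = I.
Proof. by rewrite -{2}[w0]w0V mul_permK. Qed.

Lemma simD_mulw0 I J : is_intervalL I -> is_intervalL J ->
  simD I J -> simD (mul_perm I w0) (mul_perm J w0).
Proof.
move=> hI hJ /(simDP hI hJ)[z [eJ zD]].
apply/(simDP (is_intervalL_mulw0 hI) (is_intervalL_mulw0 hJ)).
exists (pcomp (pcomp w0 z) w0).
have e u : pcomp (pcomp u w0) (pcomp (pcomp w0 z) w0) = pcomp (pcomp u z) w0.
  by rewrite /pcomp -!mulgA -{2}w0V mulKg.
split.
  rewrite eJ /mul_perm -!imset_comp; apply: eq_imset => u /=.
  by rewrite e.
move=> _ /imsetP[u uI ->]; rewrite (e u); apply/setP => i.
by rewrite (DesL_mulw0 (pcomp u z)) (DesL_mulw0 u) (zD u uI).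
Qed.

Lemma simD_class_mulw0 J : is_intervalL J ->
  [set mul_w0 I | I in simD_class J] =
  [set I | is_intervalL I && `[< simD I (mul_perm J w0) >]].
Proof.
move=> hJ; apply/setP => I; rewrite !inE; apply/imsetP/andP.
  move=> [I']; rewrite inE => /andP[hI' /asboolP s] ->; rewrite mul_w0E.
  by split; [exact: is_intervalL_mulw0 | apply/asboolP; exact: simD_mulw0].
move=> [hI /asboolP s]; exists (mul_perm I w0); last by rewrite mul_w0E mul_permw0K.
rewrite inE is_intervalL_mulw0 //; apply/asboolP; rewrite -[J]mul_permw0K.
by apply: simD_mulw0 => //; exact: is_intervalL_mulw0.
Qed.

Lemma climbs_prod w s : climbs w s -> dem w s = pcomp (word_prod w) s.
Proof.
elim: w => [|i w IH] /=; first by rewrite /pcomp mulg1.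
by move=> /andP[/IH e hi]; rewrite /demazure (negbTE hi) e pcompA.
Qed.

End Intervals.

(** * Modules of intervals *)

Section HeckeModules.
Import GRing.Theory.
Local Open Scope ring_scope.
Context {K : fieldType} {n : nat}.
Implicit Types (M N P : heckeModule K n) (i j : 'I_n.-1) (w : seq 'I_n.-1).

Lemma hactDl M (h h' : hecke K n) (v : M) : hact (h + h') v = hact h v + hact h' v.
Proof. by have := hact_linearl v 1 h h'; rewrite !scale1r. Qed.

Lemma hact_scal M (a : K) (v : M) : hact (a%:A) v = a *: v.
Proof.
have h0 : hact 0 v = 0 by apply: (addrI (hact 0 v)); rewrite -hactDl !addr0.
by have := hact_linearl v a 1 0; rewrite h0 !addr0 hact1.
Qed.

Lemma hact_comb M h (T : finType) (a : T -> K) (v : T -> M) :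
  hact h (\sum_x a x *: v x) = \sum_x a x *: hact h (v x).
Proof. by rewrite linear_sum /=; apply: eq_bigr => x _; rewrite linearZ. Qed.

Lemma hom_comb (U V : vectType K) (F : 'Hom(U, V)) (T : finType) (a : T -> K) (v : T -> U) :
  F (\sum_x a x *: v x) = \sum_x a x *: F (v x).
Proof. by rewrite linear_sum /=; apply: eq_bigr => x _; rewrite linearZ. Qed.

Lemma hom_hact M N (F : 'Hom(M, N)) :
  (forall i v, F (hact (hpi K i) v) = hact (hpi K i) (F v)) ->
  forall h v, F (hact h v) = hact h (F v).
Proof.
move=> Fpi; elim/hecke_ind; elim=> [a|i|x IHx y IHy|x IHx y IHy] v.
- by rewrite hclass_scal !hact_scal linearZ.
- exact: Fpi.
- by rewrite hclass_add !hactDl linearD /= IHx IHy.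
- by rewrite hclass_mul !hactM IHx IHy.
Qed.

Lemma hm_isoP M N : hm_iso M N <->
  exists (F : 'Hom(M, N)) (G : 'Hom(N, M)), [/\ cancel F G, cancel G F,
    forall h v, F (hact h v) = hact h (F v) & forall h v, G (hact h v) = hact h (G v)].
Proof.
split=> [[F [[g gK Kg] FE]]|[F [G [FK GK FE _]]]]; last by exists F; split => //; exists G.
have gL : linear g.
  by move=> a u v; apply: (can_inj gK); rewrite Kg linearP /= !Kg.
pose gl := HB.pack_for {linear N -> M} g (GRing.isLinear.Build _ _ _ _ g gL).
exists F, (linfun gl); have E v : linfun gl v = g v by rewrite lfunE.
split=> [v|v|//|h v]; rewrite !E ?gK ?Kg //.
by apply: (can_inj gK); rewrite Kg FE Kg.
Qed.

Lemma hm_iso_sym M N : hm_iso M N -> hm_iso N M.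
Proof. by move=> /hm_isoP[F [G [? ? ? ?]]]; apply/hm_isoP; exists G, F; split. Qed.

Lemma hm_iso_trans M N P : hm_iso M N -> hm_iso N P -> hm_iso M P.
Proof.
move=> [F [Fb FE]] [G [Gb GE]]; exists (G \o F)%VF.
split; last by move=> h v; rewrite !comp_lfunE FE GE.
apply: (eq_bij (bij_comp Gb Fb)) => v; by rewrite comp_lfunE.
Qed.

Definition hword w : hecke K n := foldr (fun i h => hpi K i * h) 1 w.

Section Basis.
Context {I : {set 'S_n}}.

Definition bcoef (v : bspace I) (g : 'S_n) : K :=
  if insub g is Some x then v x else 0.

Lemma bcoef_sum (J : finType) (F : J -> bspace I) g :
  bcoef (\sum_j F j) g = \sum_j bcoef (F j) g.
Proof.
rewrite /bcoef; case: insubP => [x _ _|_]; last by rewrite big1.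
by rewrite sum_ffunE.
Qed.

Lemma bcoefZ a (v : bspace I) g : bcoef (a *: v) g = a * bcoef v g.
Proof. by rewrite /bcoef; case: insubP => [x _ _|_]; rewrite ?ffunE ?mulr0. Qed.

Lemma bcoef_bvec g h : g \in I -> bcoef (bvec I h) g = (g == h)%:R.
Proof. by move=> gI; rewrite /bcoef insubT ffunE. Qed.

Lemma bcoef_mem (v : bspace I) g : bcoef v g != 0 -> g \in I.
Proof. by rewrite /bcoef; case: insubP => [//|_]; rewrite eqxx. Qed.

Lemma bcoef_bvec_eq g h : bcoef (bvec I h) g != 0 -> g = h.
Proof.
move=> c; have := c; rewrite bcoef_bvec ?(bcoef_mem c) //.
by case: (g =P h) => // _; rewrite mulr0n eqxx.
Qed.

Definition bmap (V : vectType K) (e : 'S_n -> V) : 'Hom(bspace I, V) :=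
  linfun (fun v : bspace I => \sum_x (v x : K) *: e (val x)).

Lemma bmapE (V : vectType K) (e : 'S_n -> V) g : g \in I -> bmap e (bvec I g) = e g.
Proof.
move=> gI; pose f v : V := \sum_x ((v : bspace I) x : K) *: e (val x).
have L : linear f.
  move=> a u v; rewrite /f scaler_sumr -big_split /=; apply: eq_bigr => x _.
  by rewrite !ffunE scalerDl scalerA.
pose F := HB.pack_for {linear bspace I -> V} f (GRing.isLinear.Build _ _ _ _ f L).
rewrite [bmap e]/(linfun F) lfunE /= /f (bigD1 (Sub g gI)) //= ffunE eqxx scale1r.
by rewrite big1 ?addr0 // => x; rewrite -val_eqE /= => /negbTE xg; rewrite ffunE xg scale0r.
Qed.

Lemma hom_bvec (V : vectType K) (F G : 'Hom(bspace I, V)) :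
  {in I, forall g, F (bvec I g) = G (bvec I g)} -> F =1 G.
Proof.
move=> e v; rewrite (bvec_span v) !hom_comb; apply: eq_bigr => x _.
by rewrite e // (valP x).
Qed.

(** Valid also for [g] outside [I]: above the minimum, an element that has left the interval never
    returns, and [bvec] is 0 there. Words thus act through [dem] without membership tests. *)
Lemma Bmod_bvec (hI : is_intervalL I) s r i g : I = intervalL s r -> leL s g ->
  hact (hpi K i) (bvec I g : Bmod K hI) = bvec I (demazure i g).
Proof.
move=> eI sg; rewrite [LHS](op_act_gen (@bop_linear K n I) (bopI hI) (bopB hI) (bopC hI)).
exact: bop_up eI sg.
Qed.

Lemma Bmod_word (hI : is_intervalL I) s r w g : I = intervalL s r -> leL s g ->
  hact (hword w) (bvec I g : Bmod K hI) = bvec I (dem w g).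
Proof.
move=> eI sg; elim: w => [|i w IH]; first exact: hact1.
rewrite -[hword _]/(hpi K i * hword w) hactM IH (Bmod_bvec _ _ eI) //; exact: leL_trans sg (leL_dem _ _).
Qed.
End Basis.

Lemma hom_commute_bvec (I : {set 'S_n}) (hI : is_intervalL I) N (F : 'Hom(Bmod K hI, N)) :
  (forall i g, g \in I -> F (hact (hpi K i) (bvec I g : Bmod K hI)) =
      hact (hpi K i) (F (bvec I g))) ->
  forall h v, F (hact h v) = hact h (F v).
Proof.
move=> e; apply: hom_hact => i v; rewrite (bvec_span (v : bspace I)).
rewrite (hact_comb (M := Bmod K hI)) !hom_comb hact_comb; apply: eq_bigr => x _.
by rewrite e // (valP x).
Qed.
End HeckeModules.

(** * Isomorphisms force equivalence *)

Section Classification.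
Import GRing.Theory.
Local Open Scope ring_scope.
Context {K : fieldType} {n : nat}.
Implicit Types (I J : {set 'S_n}) (i j : 'I_n.-1) (w : seq 'I_n.-1).

Lemma sum_neq0 (T : finType) (F : T -> K) : \sum_x F x != 0 -> exists x, F x != 0.
Proof.
move=> h; apply/existsP; apply: contraNT h; rewrite negb_exists => /forallP h.
by apply/eqP/big1 => x _; apply/eqP; have := h x; rewrite negbK.
Qed.

Lemma interval_ge I s r g : I = intervalL s r -> g \in I -> leL s g.
Proof. by move=> -> /intervalLP[]. Qed.

(** A word sends each basis vector to a basis vector or to 0, so a term of w F(x) comes from a term
    of F(x). *)
Lemma bcoef_word I J (hI : is_intervalL I) (hJ : is_intervalL J) s r s' r'
    (F : 'Hom(Bmod K hI, Bmod K hJ)) w x d :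
  I = intervalL s r -> J = intervalL s' r' ->
  (forall h v, F (hact h v) = hact h (F v)) -> leL s x ->
  bcoef (F (bvec I (dem w x)) : bspace J) d != 0 ->
  exists g, bcoef (F (bvec I x) : bspace J) g != 0 /\ dem w g = d.
Proof.
move=> eI eJ FE sx; rewrite -(Bmod_word hI w eI sx) FE.
set v := F _; rewrite [v in hact _ v](bvec_span (v : bspace J)) (hact_comb (M := Bmod K hJ)).
rewrite bcoef_sum => /sum_neq0[y]; rewrite bcoefZ mulf_eq0 negb_or.
have sy : leL s' (val y) := interval_ge eJ (valP y).
rewrite (Bmod_word hJ w eJ sy) => /andP[vy /bcoef_bvec_eq ->].
by exists (val y); rewrite /bcoef valK.
Qed.

(* The diagonal coefficients of two mutually inverse isomorphisms cannot vanish: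
   some basis vector d occurs in F g with g occurring in G d, and comparing
   lengths in the Bruhat order leaves only one candidate for d. *)
Lemma iso_level I J (hI : is_intervalL I) (hJ : is_intervalL J) s r s' r'
    (F : 'Hom(Bmod K hI, Bmod K hJ)) (G : 'Hom(Bmod K hJ, Bmod K hI)) w :
  I = intervalL s r -> J = intervalL s' r' ->
  (forall h v, F (hact h v) = hact h (F v)) ->
  (forall h v, G (hact h v) = hact h (G v)) -> cancel F G ->
  (forall w', size w' = size w -> climbs w' s' -> dem w' s' \in J -> climbs w' s) ->
  climbs w s -> climbs w s' -> dem w s \in I ->
  dem w s' \in J /\
  bcoef (G (bvec J (dem w s')) : bspace I) (dem w s) != 0.
Proof.
move=> eI eJ FE GE FK climb ws ws' wI.
have [d dF dG] : exists2 d, bcoef (F (bvec I (dem w s)) : bspace J) d != 0 &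
    bcoef (G (bvec J d) : bspace I) (dem w s) != 0.
  have : bcoef (G (F (bvec I (dem w s))) : bspace I) (dem w s) != 0.
    by rewrite FK bcoef_bvec // eqxx oner_eq0.
  set v := F _; rewrite [v in G v](bvec_span (v : bspace J)) hom_comb.
  rewrite bcoef_sum => /sum_neq0[y]; rewrite bcoefZ mulf_eq0 negb_or.
  by move=> /andP[vy h]; exists (val y); rewrite // /bcoef valK.
have dJ := bcoef_mem dF.
have s'd : leL s' d by move: dJ; rewrite eJ => /intervalLP[].
have [g [gF gd]] := bcoef_word eI eJ FE (leL_refl s) dF.
have s'g : leL s' g by have := bcoef_mem gF; rewrite eJ => /intervalLP[].
(* Since [g] is Bruhat above [s'], the element [d = dem w g] is at least as long as [dem w s']: a
   climb from [s'] to [d] has at least [size w] letters. *)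
have [hd _] := bruhat_ninv (bruhat_dem w (leL_bruhat s'g)).
rewrite gd (climbs_ninv ws') in hd.
have [v vs' ev] := leL_climb s'd.
have sz : (size w <= size v)%N.
  by move: hd; rewrite -ev (climbs_ninv vs') leq_add2r.
(* Words act from their right end, so [w2] is the initial stretch of the climb, as long as [w]. *)
pose u := take (size v - size w) v; pose w2 := drop (size v - size w) v.
have ew : v = u ++ w2 by rewrite cat_take_drop.
have sw2 : size w2 = size w by rewrite size_drop subKn.
move: vs' ev; rewrite ew climbs_cat dem_cat => /andP[w2s' us'] ev.
have s'w2 : leL s' (dem w2 s') by exact: leL_dem.
have w2J : dem w2 s' \in J.
  rewrite eJ; apply/intervalLP; split=> //.
  by move: dJ; rewrite -ev eJ => /intervalLP[_]; apply: leL_trans; exact: leL_dem.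
have w2s := climb _ sw2 w2s' w2J.
rewrite -ev in dG.
(* Pull the term [dem w s] of [G] at [d] back through [u], then through [w2]. The element [h] is
   Bruhat above [dem w2 s] and weakly below [dem w s]; these have equal lengths, so all three
   agree. *)
have [h [hG hu]] := bcoef_word eJ eI GE s'w2 dG.
have [h' [h'G hw2]] := bcoef_word eJ eI GE (leL_refl s') hG.
have sh' : leL s h' by have := bcoef_mem h'G; rewrite eI => /intervalLP[].
have [_ b2] := bruhat_ninv (bruhat_dem w2 (leL_bruhat sh')).
rewrite hw2 (climbs_ninv w2s) in b2.
have hle : leL h (dem w s) by rewrite -hu leL_dem.
have hn := leL_ninv hle; rewrite (climbs_ninv ws) -sw2 in hn.
have eh := b2 hn.
have e : dem w2 s = dem w s.
  rewrite eh; apply: leL_ninv_eq hle _.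
  by rewrite -eh (climbs_ninv w2s) (climbs_ninv ws) sw2.
have ewp : word_prod w2 = word_prod w.
  by apply: (@pcomp_injr _ s); rewrite /= -!climbs_prod.
have e' : dem w2 s' = dem w s' by rewrite !climbs_prod // ewp.
by rewrite -e' -e eh; split.
Qed.

(** For a descent j of [g] one has F(g) = pi_j F(g), and every term of a vector in the image of pi_j
    has j as a descent. *)
Lemma iso_Des I J (hI : is_intervalL I) (hJ : is_intervalL J) s r s' r'
    (F : 'Hom(Bmod K hI, Bmod K hJ)) g d :
  I = intervalL s r -> J = intervalL s' r' ->
  (forall h v, F (hact h v) = hact h (F v)) -> leL s g ->
  bcoef (F (bvec I g) : bspace J) d != 0 -> DesL g \subset DesL d.
Proof.
move=> eI eJ FE sg c; apply/subsetP => j jg.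
have e : dem [:: j] g = g by rewrite /= /demazure jg.
have := c; rewrite -{1}e => /(bcoef_word eI eJ FE sg)[h [_ <-]] /=.
by rewrite /demazure; case: ifPn => // hj; rewrite DesL_sadj.
Qed.

(** The claim for shorter words, descents included, decides which words of the next length climb
    from each minimum; this is the hypothesis on climbs in [iso_level], which is applied in both
    directions. The nonzero diagonal coefficients then give membership and equal descents. *)
Lemma iso_climbs I J (hI : is_intervalL I) (hJ : is_intervalL J) s r s' r'
    (F : 'Hom(Bmod K hI, Bmod K hJ)) (G : 'Hom(Bmod K hJ, Bmod K hI)) :
  I = intervalL s r -> J = intervalL s' r' ->
  (forall h v, F (hact h v) = hact h (F v)) ->
  (forall h v, G (hact h v) = hact h (G v)) -> cancel F G -> cancel G F ->
  forall w, (climbs w s && (dem w s \in I)) = (climbs w s' && (dem w s' \in J)) /\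
    (climbs w s && (dem w s \in I) -> DesL (dem w s) = DesL (dem w s')).
Proof.
move=> eI eJ FE GE FK GK w; have [k] := ubnP (size w).
elim: k => // k IH in w *; rewrite ltnS => wk.
have down I0 a b v i : I0 = intervalL a b -> dem (i :: v) a \in I0 -> dem v a \in I0.
  move=> -> /intervalLP[_ h]; apply/intervalLP; split; first exact: leL_dem.
  by apply: leL_trans h; rewrite /= leL_demazure // leL_refl.
have c1 v : (size v <= k)%N -> climbs v s -> dem v s \in I -> climbs v s'.
  case: v => // i v /= vk /andP[vs hi] vI; have vI' := down _ _ _ _ _ eI vI.
  have [e1 e2] := IH v vk; rewrite vs vI' /= in e1 e2.
  by move/esym/andP: e1 => [-> _]; rewrite -e2.
have c2 v : (size v <= k)%N -> climbs v s' -> dem v s' \in J -> climbs v s.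
  case: v => // i v /= vk /andP[vs hi] vI; have vI' := down _ _ _ _ _ eJ vI.
  have [e1 e2] := IH v vk; rewrite vs vI' /= in e1.
  by move: (e1) => /andP[-> _]; rewrite e2.
have c1w v : size v = size w -> climbs v s -> dem v s \in I -> climbs v s'.
  by move=> e; apply: c1; rewrite e.
have c2w v : size v = size w -> climbs v s' -> dem v s' \in J -> climbs v s.
  by move=> e; apply: c2; rewrite e.
have l1 := iso_level eI eJ FE GE FK c2w; have l2 := iso_level eJ eI GE FE GK c1w.
split.
  apply/andP/andP => -[ws wI].
    by have ws' := c1 _ wk ws wI; have [wJ _] := l1 ws ws' wI.
  by have ws' := c2 _ wk ws wI; have [wJ _] := l2 ws ws' wI.
move=> /andP[ws wI]; have ws' := c1 _ wk ws wI.
have [wJ cG] := l1 ws ws' wI; have [_ cF] := l2 ws' ws wJ.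
apply/eqP; rewrite eqEsubset (iso_Des eI eJ FE _ cF) ?leL_dem //.
by rewrite (iso_Des eJ eI GE _ cG) ?leL_dem.
Qed.

Lemma hm_iso_simD I J (hI : is_intervalL I) (hJ : is_intervalL J) :
  hm_iso (Bmod K hI) (Bmod K hJ) -> simD I J.
Proof.
move=> /hm_isoP[F [G [FK GK FE GE]]]; apply/(simDP hI hJ).
have [s [r [sr eI]]] := is_intervalLP _ hI.
have [s' [r' [sr' eJ]]] := is_intervalLP _ hJ.
have main := iso_climbs eI eJ FE GE FK GK.
pose z := pcomp (s^-1)%g s'; exists z.
have ez w : climbs w s -> climbs w s' -> pcomp (dem w s) z = dem w s'.
  by move=> ws ws'; rewrite !climbs_prod // -pcompA; congr pcomp; exact: mulgKV.
split.
  apply/setP => g; apply/idP/imsetP => [gJ|[h hI' ->]].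
    have s'g : leL s' g by move: gJ; rewrite eJ => /intervalLP[].
    have [w ws' ew] := leL_climb s'g; have [e _] := main w.
    move: e; rewrite ws' ew gJ => /andP[ws wI].
    by exists (dem w s) => //; rewrite ez.
  have sh : leL s h by move: hI'; rewrite eI => /intervalLP[].
  have [w ws ew] := leL_climb sh; have [e _] := main w.
  move: e; rewrite ws ew hI' => /esym /andP[ws' wI].
  by rewrite -ew ez.
move=> h hI'; have sh : leL s h by move: hI'; rewrite eI => /intervalLP[].
have [w ws ew] := leL_climb sh; have [e eD] := main w.
move: e eD; rewrite ws ew hI' => /esym /andP[ws' wI] eD.
by rewrite eD // -ew ez.
Qed.

Lemma simD_hm_iso I J (hI : is_intervalL I) (hJ : is_intervalL J) :
  simD I J -> hm_iso (Bmod K hI) (Bmod K hJ).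
Proof.
move=> /(simDP hI hJ)[z [eJ zD]]; apply/hm_isoP.
pose F : 'Hom(Bmod K hI, Bmod K hJ) := bmap (fun g => bvec J (pcomp g z)).
pose G : 'Hom(Bmod K hJ, Bmod K hI) := bmap (fun g => bvec I (pcomp g (z^-1)%g)).
have mJ g : (pcomp g z \in J) = (g \in I) by rewrite eJ mem_mul_perm.
have Fb g : g \in I -> F (bvec I g) = bvec J (pcomp g z) by exact: bmapE.
have Gb g : g \in J -> G (bvec J g) = bvec I (pcomp g (z^-1)%g) by exact: bmapE.
have FG v : G (F v) = v.
  rewrite -comp_lfunE -[RHS]id_lfunE; move: v; apply: (@hom_bvec K n I) => g gI.
  by rewrite comp_lfunE id_lfunE Fb // Gb ?mJ // pcompK.
have GF v : F (G v) = v.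
  rewrite -comp_lfunE -[RHS]id_lfunE; move: v; apply: (@hom_bvec K n J) => g gJ.
  have gI : pcomp g (z^-1)%g \in I by rewrite -mJ pcompVK.
  by rewrite comp_lfunE id_lfunE Gb // Fb // pcompVK.
have FE h v : F (hact h v) = hact h (F v).
  move: h v; apply: hom_commute_bvec => i g gI; rewrite Fb // !Bmod_pi ?mJ //.
  rewrite zD // pcompA mJ; case: ifP => _; first exact: Fb.
  by case: ifP => h; [rewrite Fb | rewrite linear0].
exists F, G; split=> // h v.
by apply: (can_inj FG); rewrite FE !GF.
Qed.
End Classification.

(** * Duality *)

Section Duality.
Import GRing.Theory.
Local Open Scope ring_scope.
Context {K : fieldType} {n : nat}.
Implicit Types (I J : {set 'S_n}) (i j : 'I_n.-1) (g h : 'S_n).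

Lemma htheta_chi_pi i : htheta (hchi (hpi K i)) = 1 - hpi K i.
Proof.
rewrite /hpi hchi_class -[hclass _]/(hpi K i).
exact: hlift_gen (theta_relations K n).
Qed.

Lemma dual_act_pi (M : heckeModule K n) i (d : 'Hom(M, K^o)) v :
  (hact (hpi K i) (d : hm_dual M) : 'Hom(M, K^o)) v = d v - d (hact (hpi K i) v).
Proof.
rewrite [LHS]dual_actE htheta_chi_pi hactDl hact1 linearD /=; congr (_ + _).
apply/eqP; rewrite -subr_eq0 opprK -linearD -hactDl addNr.
have -> : hact 0 v = 0 by rewrite -[0 : hecke K n](scale0r 1) hact_scal scale0r.
by rewrite linear0.
Qed.

(** theta chi (pi_i) = 1 - pi_i, so on the plain dual basis the off-diagonal entries are -1. A cover
    changes the parity of [ninv], and the sign turns them into 1. *)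
Definition signed_dual J g : 'Hom(bspace J, K^o) :=
  bmap (V := K^o) (fun h => (-1) ^+ ninv g * (h == g)%:R).

Lemma signed_dualE J g h : h \in J ->
  signed_dual J g (bvec J h) = (-1) ^+ ninv g * (h == g)%:R.
Proof. exact: bmapE. Qed.

Lemma sadj_eq i g h : (pcomp (sadj i) h == g) = (h == pcomp (sadj i) g).
Proof. by apply/eqP/eqP => [<-|->]; rewrite sadjK. Qed.

(** Descents and non-descents trade places and the action goes downwards, as after right
    multiplication by [w0]. *)
Lemma signed_dual_act J (hJ : is_intervalL J) i g : g \in J ->
  hact (hpi K i) (signed_dual J g : hm_dual (Bmod K hJ)) =
    if i \notin DesL g then signed_dual J g
    else if pcomp (sadj i) g \in J then signed_dual J (pcomp (sadj i) g) else 0.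
Proof.
move=> gJ; apply/lfunP; apply: (@hom_bvec K n J) => h hJ'.
rewrite [LHS](@dual_act_pi (Bmod K hJ)) Bmod_pi //.
have [ig|ig] /= := boolP (i \in DesL g).
  have sg : (-1) ^+ ninv g = - (-1) ^+ ninv (pcomp (sadj i) g) :> K.
    have := @ninv_cover n (pcomp (sadj i) g) i.
    by rewrite DesL_sadj ig sadjK => -> //; rewrite exprS mulN1r.
  have [ih|ih] := boolP (i \in DesL h).
    rewrite subrr; case: ifP => sJ; last by rewrite zero_lfunE.
    rewrite signed_dualE //; case: eqP => [e|]; last by rewrite mulr0.
    by move: ih; rewrite e DesL_sadj ig.
  have hg : (h == g) = false by apply/eqP => e; rewrite e ig in ih.
  rewrite signed_dualE // hg mulr0 sub0r.
  case: ifP => sJ; case: ifP => sJ'; rewrite ?linear0 ?oppr0 ?zero_lfunE //.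
  - by rewrite !signed_dualE // sadj_eq sg mulNr opprK.
  - rewrite signed_dualE // sadj_eq; case: eqP => [e|]; last by rewrite mulr0 oppr0.
    by rewrite -e hJ' in sJ'.
  - rewrite signed_dualE //; case: eqP => [e|]; last by rewrite mulr0.
    by rewrite e sadjK gJ in sJ.
have [ih|ih] := boolP (i \in DesL h).
  rewrite subrr signed_dualE //; case: eqP => [e|]; last by rewrite mulr0.
  by rewrite e (negbTE ig) in ih.
case: ifP => sJ; last by rewrite linear0 subr0.
rewrite [X in _ - X]signed_dualE //; case: eqP => [e|]; last by rewrite mulr0 subr0.
by move: ig; rewrite -e DesL_sadj ih.
Qed.

Lemma dual_iso J (hJ : is_intervalL J) (hJ' : is_intervalL (mul_perm J w0)) :
  hm_iso (Bmod K hJ') (hm_dual (Bmod K hJ)).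
Proof.
set J' := mul_perm J w0.
have mJ' g : (pcomp g w0 \in J) = (g \in J').
  by rewrite -{1}[J]mul_permw0K mem_mul_perm.
have mJ g : (pcomp g w0 \in J') = (g \in J) by rewrite mem_mul_perm.
pose F : 'Hom(Bmod K hJ', hm_dual (Bmod K hJ)) :=
  bmap (V := hm_dual (Bmod K hJ)) (fun g => signed_dual J (pcomp g w0)).
have Fb g : g \in J' -> F (bvec J' g) = signed_dual J (pcomp g w0) by exact: bmapE.
exists F; split; last first.
  apply: hom_commute_bvec => i g gJ'; rewrite Fb // Bmod_pi //.
  rewrite signed_dual_act ?mJ' // DesL_mulw0 negbK pcompA mJ'.
  case: ifP => _; first exact: Fb.
  by case: ifP => h; [rewrite Fb | rewrite linear0].
have Fval (u : bspace J') h : h \in J ->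
    (F u : 'Hom(bspace J, K^o)) (bvec J h) = (-1) ^+ ninv h * bcoef u (pcomp h w0).
  move=> hh; rewrite {1}(bvec_span u) (hom_comb F) sum_lfunE.
  have hJx : pcomp h w0 \in J' by rewrite mJ.
  rewrite (bigD1 (exist (fun g => g \in J') _ hJx)) //= big1 ?addr0 => [|y ny].
    rewrite scale_lfunE Fb // pcompw0K signed_dualE // eqxx mulr1.
    by rewrite /bcoef insubT mulrC.
  rewrite scale_lfunE Fb ?(valP y) // signed_dualE //.
  case: eqP => [e|]; last by rewrite mulr0 scaler0.
  by case/eqP: ny; apply: val_inj; rewrite /= e pcompw0K.
pose G (d : hm_dual (Bmod K hJ)) : Bmod K hJ' :=
  \sum_(x : {g | g \in J}) ((-1) ^+ ninv (val x) * (d : 'Hom(bspace J, K^o)) (bvec J (val x)))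
     *: bvec J' (pcomp (val x) w0).
have sq k : (-1) ^+ k * (-1) ^+ k = 1 :> K by rewrite -exprMn mulrNN mulr1 expr1n.
have FG : cancel G F.
  move=> d; apply/lfunP; apply: (@hom_bvec K n J) => h hh.
  rewrite (hom_comb F) sum_lfunE (bigD1 (exist (fun g => g \in J) _ hh)) //= big1 ?addr0 => [|y ny].
    rewrite scale_lfunE Fb ?mJ // pcompw0K signed_dualE // eqxx mulr1.
    by rewrite /GRing.scale /= mulrAC sq mul1r.
  rewrite scale_lfunE Fb ?mJ ?(valP y) // pcompw0K signed_dualE //.
  case: eqP => [e|]; last by rewrite mulr0 scaler0.
  by case/eqP: ny; apply: val_inj; rewrite /= e.
exists G => // u; apply/ffunP => y.
have e : F (G (F u)) = F u by rewrite FG.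
have yJ : pcomp (val y) w0 \in J by rewrite mJ' (valP y).
have := congr1 (fun d : 'Hom(bspace J, K^o) => d (bvec J (pcomp (val y) w0))) e.
rewrite !Fval // pcompw0K => /(congr1 ( *%R ((-1) ^+ ninv (pcomp (val y) w0)))).
by rewrite !mulrA !sq !mul1r /bcoef valK.
Qed.

Lemma row_strict_classE J : is_intervalL J ->
  row_strict_class K J = [set mul_w0 I | I in simD_class J].
Proof.
move=> hJ; have hJ' := is_intervalL_mulw0 hJ; rewrite simD_class_mulw0 //.
apply/setP => I; rewrite !inE; apply/asboolP/andP => [[hJ0]|[hI /asboolP sI]].
  rewrite inE => /asboolP[hI iso]; split=> //; apply/asboolP.
  apply: (@hm_iso_simD K n I _ hI hJ').
  exact: hm_iso_trans iso (hm_iso_sym (dual_iso hJ0 hJ')).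
exists hJ; rewrite inE; apply/asboolP; exists hI.
by apply: hm_iso_trans (dual_iso hJ hJ'); apply: simD_hm_iso.
Qed.
End Duality.

(** * Linear extensions of planar diagrams *)

Section Fillings.
Context {n : nat} {X : finType}.
Hypothesis cardX : #|X| = n.
Implicit Types (F G H T : X -> 'I_n) (b c : X) (s : 'S_n).

Lemma filling_onto F : injective F -> forall k, exists b, F b = k.
Proof.
move=> Fi k; have /inj_card_bij := Fi; rewrite cardX card_ord => /(_ (leqnn _))[g _ gK].
by exists (g k).
Qed.

Lemma rel_perm_ex F G : injective F -> injective G -> exists s, forall b, s (G b) = F b.
Proof.
move=> Fi Gi; have /inj_card_bij := Gi; rewrite cardX card_ord => /(_ (leqnn _))[g gK Kg].
have hi : injective (F \o g) := inj_comp Fi (can_inj Kg).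
by exists (perm hi) => b; rewrite permE /= gK.
Qed.

(* For injective F and G, the permutation carrying the entries of G to those of F;
   the default value is then never used. *)
Definition rel_perm F G : 'S_n := odflt 1%g [pick s : 'S_n | [forall b, s (G b) == F b]].

Lemma rel_permE F G b : injective F -> injective G -> rel_perm F G (G b) = F b.
Proof.
move=> Fi Gi; rewrite /rel_perm; case: pickP => [s /forallP /(_ b) /eqP //|h].
have [s sE] := rel_perm_ex Fi Gi; have /forallP[] := h s.
by move/negbT: (h s); rewrite negb_forall => /existsP[b']; rewrite sE eqxx.
Qed.

Lemma rel_perm_uniq F G s : injective F -> injective G -> (forall b, s (G b) = F b) ->
  s = rel_perm F G.
Proof.
move=> Fi Gi sE; apply/permP => k; have [b <-] := filling_onto Gi k.
by rewrite sE rel_permE.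
Qed.

Lemma rel_permV F G : injective F -> injective G -> ((rel_perm F G)^-1)%g = rel_perm G F.
Proof.
by move=> Fi Gi; apply: rel_perm_uniq => // b; rewrite -(rel_permE b Fi Gi) permK.
Qed.

Lemma leL_rel_perm F A B : injective F -> injective A -> injective B ->
  leL (rel_perm A F) (rel_perm B F) <-> (forall b c, F b < F c -> A c < A b -> B c < B b).
Proof.
move=> Fi Ai Bi; split=> [/leLP h b c bc|h].
  by have := h _ _ bc; rewrite !rel_permE.
apply/leLP => p q; have [b <-] := filling_onto Fi p; have [c <-] := filling_onto Fi q.
by rewrite !rel_permE //; apply: h.
Qed.

Section Rank.
Context (o : rel X).
Hypotheses (o_tot : total o) (o_tr : transitive o) (o_anti : antisymmetric o).

Fact rank_subproof b : #|[set c | o c b && (c != b)]| < n.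
Proof.
rewrite -cardX -cardsT; apply/proper_card/properP; split; first exact: subsetT.
by exists b; rewrite ?inE // eqxx andbF.
Qed.

Definition rankf b : 'I_n := Ordinal (rank_subproof b).

Lemma rankf_lt b c : (rankf b < rankf c) = o b c && (b != c).
Proof.
have lt d e : o d e -> d != e -> rankf d < rankf e.
  move=> de nde; apply/proper_card/properP; split.
    apply/subsetP => a; rewrite !inE => /andP[ad nad]; rewrite (o_tr ad de) /=.
    by apply: contraNneq nde => ea; apply/eqP/o_anti; rewrite de -ea ad.
  by exists d; rewrite !inE ?de ?nde // eqxx andbF.
apply/idP/andP => [h|[]]; last exact: lt.
have nbc : b != c by apply: contraTneq h => ->; rewrite ltnn.
split=> //; have /orP[//|cb] := o_tot b c.
by have := ltn_trans h (lt _ _ cb _); rewrite eq_sym ltnn => /(_ nbc).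
Qed.

Lemma rankf_inj : injective rankf.
Proof.
move=> b c e; apply/eqP; apply: contraT => nbc.
have /orP[h|h] := o_tot b c.
  by have := rankf_lt b c; rewrite h nbc e ltnn.
by have := rankf_lt c b; rewrite h eq_sym nbc e ltnn.
Qed.

(** Reading words become ratios of two fillings, which turns weak order comparisons into comparisons
    of boxes. *)
Lemma word_perm_rank (T : X -> 'I_n) : injective T ->
  word_perm [seq T b | b <- sort o (enum X)] = rel_perm T rankf.
Proof.
move=> Ti; have eE : [seq rankf b | b <- sort o (enum X)] = enum 'I_n.
  apply: (inj_map val_inj); rewrite val_enum_ord.
  apply: (@irr_sorted_eq _ ltn) => //; first exact: ltn_trans.
  - exact: ltnn.
  - rewrite -map_comp sorted_map.
    have so : sorted o (sort o (enum X)) by apply: sort_sorted.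
    have su : uniq (sort o (enum X)) by rewrite sort_uniq enum_uniq.
    have : sorted (fun b c => o b c && (b != c)) (sort o (enum X)).
      elim: (sort o (enum X)) so su => // b [|c l] IH //= /andP[bc h] /andP[nb u].
      rewrite bc /=; apply/andP; split; last exact: IH.
      by apply: contraNneq nb => ->; rewrite in_cons eqxx.
    by apply: sub_sorted => b c; rewrite /= rankf_lt.
  - exact: iota_ltn_sorted.
  - move=> k; rewrite mem_iota /= add0n; apply/mapP/idP => [[j _ ->]|hk]; first exact: ltn_ord.
    have [b eb] := filling_onto rankf_inj (Ordinal hk); exists (rankf b); last by rewrite eb.
    by apply: map_f; rewrite mem_sort mem_enum.
have ri := rankf_inj.
rewrite /word_perm; case: pickP => [s /eqP|/(_ (rel_perm T rankf))].
  rewrite -eE -map_comp => e; apply: rel_perm_uniq => // b.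
  have bs : b \in sort o (enum X) by rewrite mem_sort mem_enum.
  by have /eq_in_map/(_ b bs) := e.
by rewrite -eE -map_comp => /eqP[]; apply: eq_map => b /=; rewrite rel_permE.
Qed.
End Rank.
End Fillings.

(** * Reading orders and linear extensions of a planar point set *)

Section Planar.
Context {n : nat} {X : finType} (x y : X -> nat) (sg rh P : X -> 'I_n).
Hypothesis cardX : #|X| = n.
Hypothesis xy_inj : forall b c, x b = x c -> y b = y c -> b = c.
Hypotheses (sgI : injective sg) (rhI : injective rh) (PI : injective P).
Hypothesis sgE : forall b c, (sg b < sg c) = (x b < x c) || (x b == x c) && (y b < y c).
Hypothesis rhE : forall b c, (rh b < rh c) = (y b < y c) || (y b == y c) && (x b < x c).
Hypothesis PE : forall b c, (P b < P c) = (x b < x c) || (x b == x c) && (y c < y b).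
Implicit Types (F G T : X -> 'I_n) (b c d : X) (s : 'S_n).

(** A permutation [s] encodes the filling [s (F b)], where [F b] is the position at which [b] is
    read. [sg] and [rh] are the extreme linear extensions, by columns and by rows, and [P] is the
    order of [w_TL]. [antiext] describes the reading orders of a class, [revext] their reversals. *)
Definition linext T := injective T /\ forall b c, x b <= x c -> y b <= y c -> T b <= T c.
Definition antiext F := injective F /\ forall b c, x b <= x c -> y c <= y b -> F b <= F c.
Definition revext F := injective F /\ forall b c, x b <= x c -> y c <= y b -> F c <= F b.

Definition linset F : {set 'S_n} := [set s : 'S_n | `[< linext (fun b => s (F b)) >]].

Lemma linsetP F s : s \in linset F <-> linext (fun b => s (F b)).
Proof. by rewrite inE; split=> /asboolP. Qed.

Lemma lt_inj F b c : injective F -> b <> c -> F b <= F c -> F b < F c.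
Proof.
move=> Fi nbc; rewrite leq_eqVlt => /orP[/eqP e|//].
by case: nbc; apply/Fi/val_inj.
Qed.

Lemma ltW_inj F b c : (b <> c -> F b < F c) -> F b <= F c.
Proof. by move=> h; have [->//|/eqP /h /ltnW] := eqVneq b c. Qed.

Lemma linext_sg : linext sg.
Proof.
split=> // b c xbc ybc; apply: ltW_inj => nbc; rewrite sgE.
case: (ltngtP (x b) (x c)) xbc => //= e _; case: (ltngtP (y b) (y c)) ybc => //= e' _.
by case: nbc; apply: xy_inj.
Qed.

Lemma linext_rh : linext rh.
Proof.
split=> // b c xbc ybc; apply: ltW_inj => nbc; rewrite rhE.
case: (ltngtP (y b) (y c)) ybc => //= e' _; case: (ltngtP (x b) (x c)) xbc => //= e _.
by case: nbc; apply: xy_inj.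
Qed.

Lemma antiext_P : antiext P.
Proof.
split=> // b c xbc ybc; apply: ltW_inj => nbc; rewrite PE.
case: (ltngtP (x b) (x c)) xbc => //= e _; case: (ltngtP (y c) (y b)) ybc => //= e' _.
by case: nbc; apply: xy_inj.
Qed.

Lemma linset_rel_perm F T : injective F -> linext T -> rel_perm T F \in linset F.
Proof.
move=> Fi hT; have Ti := hT.1; apply/linsetP.
have e : (fun b => rel_perm T F (F b)) = T by apply/funext => b; rewrite rel_permE.
by rewrite e.
Qed.

(** A comparable pair of boxes has the same order in [sg] and in [rh], so lying between the
    endpoints forces it. An incomparable pair is read left box first by [F], is not inverted in [sg]
    and is inverted in [rh], hence is free. *)
Lemma linset_interval F : antiext F ->
  linset F = intervalL (rel_perm sg F) (rel_perm rh F).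
Proof.
move=> [Fi hF]; apply/setP => s; apply/idP/intervalLP.
  move/linsetP; set T := fun b => s (F b) => -[Ti hT].
  have -> : s = rel_perm T F by apply: rel_perm_uniq.
  split; apply/(leL_rel_perm cardX) => // b c bc.
    rewrite sgE => cb; have nbc : c <> b by move=> e; rewrite e ltnn in bc.
    apply: lt_inj => //; apply: hT; first by lia.
    rewrite leqNgt; apply/negP => h; have := hF c b; lia.
  move=> cb; rewrite rhE; have nbc : c <> b by move=> e; rewrite e ltnn in bc.
  case: (ltngtP (y c) (y b)) => //= h.
    by have := hT b c; have := hF c b; lia.
  case: (ltngtP (x c) (x b)) => // h'; last by case: nbc; apply: xy_inj.
  by have := hT b c; lia.
have [T eT] : exists T, T = fun b => s (F b) by eexists.
have Ti : injective T by rewrite eT; apply: inj_comp => //; exact: perm_inj.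
have -> : s = rel_perm T F by apply: rel_perm_uniq => // b; rewrite eT.
move=> [/(leL_rel_perm cardX Fi sgI Ti) h1 /(leL_rel_perm cardX Fi Ti rhI) h2].
apply/linsetP; have -> : (fun b => rel_perm T F (F b)) = T by apply/funext => b; rewrite rel_permE.
split=> // b c xbc ybc; have [-> //|/eqP nbc] := eqVneq b c.
have nTbc : T b <> T c :> nat by move/val_inj/Ti.
have nFbc : F b <> F c :> nat by move/val_inj/Fi.
have ls := lt_inj sgI nbc (linext_sg.2 _ _ xbc ybc).
have lr := lt_inj rhI nbc (linext_rh.2 _ _ xbc ybc).
case: (ltngtP (F b) (F c)) => // bc.
  by have := h2 _ _ bc; lia.
by have := h1 _ _ bc ls; lia.
Qed.

Lemma linset_intervalP F : antiext F -> is_intervalL (linset F).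
Proof.
move=> hF; apply/is_intervalLP; exists (rel_perm sg F), (rel_perm rh F).
split; last exact: linset_interval.
have := linset_rel_perm hF.1 linext_sg; rewrite linset_interval //.
by case/intervalLP.
Qed.

Definition revf F b : 'I_n := w0 (F b).

Lemma revfK F : revf (revf F) = F.
Proof. by apply/funext => b; rewrite /revf !w0_val rev_ordK. Qed.

Lemma revf_inj F : injective F -> injective (revf F).
Proof. by move=> Fi; apply: inj_comp => //; exact: perm_inj. Qed.

Lemma revf_le F b c : (revf F b <= revf F c) = (F c <= F b).
Proof. by rewrite /revf !w0_val /=; have := ltn_ord (F b); have := ltn_ord (F c); lia. Qed.

Lemma antiext_revf F : antiext (revf F) <-> revext F.
Proof.
split=> -[Fi hF]; split=> [|b c xbc ycb].
- by rewrite -(revfK F); exact: revf_inj.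
- by have := hF b c xbc ycb; rewrite revf_le.
- exact: revf_inj.
- by rewrite revf_le; exact: hF.
Qed.

Lemma linset_revf F : linset (revf F) = mul_perm (linset F) w0.
Proof.
apply/setP => s; rewrite -[s]pcompw0K mem_mul_perm.
have e : (fun b => pcomp (pcomp s w0) w0 (revf F b)) = (fun b => pcomp s w0 (F b)).
  by apply/funext => b; rewrite !pcompE /revf !w0_val rev_ordK.
by apply/idP/idP => /linsetP h; apply/linsetP; [rewrite -e | rewrite e].
Qed.

(** Reversing the reading order multiplies by [w0] on the right and exchanges the endpoints: the
    minimum now comes from [rh]. *)
Lemma linset_rev_interval F : revext F ->
  linset F = intervalL (rel_perm rh F) (rel_perm sg F) /\ leL (rel_perm rh F) (rel_perm sg F).
Proof.
move=> hF; have hF' := (antiext_revf F).2 hF; have Fi := hF.1.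
have rev_ratio T : injective T -> pcomp (rel_perm T (revf F)) w0 = rel_perm T F.
  move=> Ti; apply: rel_perm_uniq => // b.
  by rewrite pcompE -/(revf F b) rel_permE //; exact: revf_inj.
rewrite -{1}(revfK F) linset_revf linset_interval // mul_permw0_interval !rev_ratio //.
split=> //; have /intervalLP[h _] : rel_perm sg F \in intervalL (rel_perm rh F) (rel_perm sg F).
  rewrite -!rev_ratio // -mul_permw0_interval -linset_interval // mem_mul_perm.
  by apply: linset_rel_perm linext_sg; exact: revf_inj.
exact: h.
Qed.

Hypothesis no_diagonal_cover : forall b c, x b < x c -> y b < y c ->
  exists d, [/\ x b <= x d <= x c, y b <= y d <= y c, d <> b & d <> c].

(** Let b and c carry i and i+1. If c were strictly right of and above b, the intermediate box would
    need an entry strictly between; the opposite position contradicts the order of the entries.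
    Otherwise weakly right and weakly below relates b and c, and [F] and [P] read them alike. *)
Lemma linset_Des F (z : 'S_n) s i : antiext F -> (forall b, z (P b) = F b) -> s \in linset F ->
  (i \in DesL (pcomp s z)) = (i \in DesL s).
Proof.
move=> [Fi hF] zE /linsetP; set T := fun b => s (F b) => -[Ti hT].
have [b eb] := filling_onto cardX Ti (ord_lo i); have [c ec] := filling_onto cardX Ti (ord_hi i).
have nbc : b <> c by move=> e; have := congr1 val ec; rewrite -e eb /= => /n_Sn.
rewrite !in_DesL -eb -ec /T !permK.
have e d : ((pcomp s z)^-1)%g (s (F d)) = P d.
  by apply: (@perm_inj _ (pcomp s z)); rewrite permKV pcompE zE.
rewrite !e; have Tbc : T c = (T b).+1 :> nat by rewrite eb ec.
have nF : F b <> F c :> nat by move/val_inj/Fi.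
have nP : P b <> P c :> nat by move/val_inj/PI.
have [_ hP] := antiext_P.
have := hF b c; have := hF c b; have := hP b c; have := hP c b; have := hT c b.
case: (ltngtP (x b) (x c)) => xbc; case: (ltngtP (y b) (y c)) => ybc; try by lia.
have [d [/andP[x1 x2] /andP[y1 y2] nb nc]] := no_diagonal_cover xbc ybc.
have := lt_inj Ti (nesym nb) (hT b d x1 y1); have := lt_inj Ti nc (hT d c x2 y2); lia.
Qed.

Lemma antiext_simD F : antiext F -> simD (linset F) (linset P).
Proof.
move=> hF; have [z zE] := rel_perm_ex cardX hF.1 PI.
apply/(simDP (linset_intervalP hF) (linset_intervalP antiext_P)); exists z; split.
  apply/setP => s; rewrite -[s](pcompVK z) mem_mul_perm.
  have e : (fun b => pcomp (pcomp s (z^-1)%g) z (P b)) = (fun b => pcomp s (z^-1)%g (F b)).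
    by apply/funext => b; rewrite pcompE zE.
  by apply/idP/idP => /linsetP h; apply/linsetP; [rewrite -e | rewrite e].
by move=> s sI; apply/setP => i; exact: (linset_Des _ hF zE sI).
Qed.

(** Equal descents say only that [F] and [P] agree on boxes carrying consecutive entries of a linear
    extension ([adj]). Within a row or a column such pairs are chained along [rh] or [sg]; a pair in
    general position is made consecutive by a walk in the weak order. *)
Lemma simD_antiext I : is_intervalL I -> simD I (linset P) ->
  exists2 F, antiext F & I = linset F.
Proof.
move=> hI; have hJ := linset_intervalP antiext_P.
move=> /(simDP hI hJ)[z [eJ zD]]; pose F b := z (P b).
have Fi : injective F by apply: inj_comp => //; exact: perm_inj.
exists F; last first.
  apply/setP => s; rewrite -(mem_mul_perm I z) -eJ.
  have e : (fun b => pcomp s z (P b)) = (fun b => s (F b)).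
    by apply/funext => b; rewrite pcompE.
  by apply/idP/idP => /linsetP h; apply/linsetP; [rewrite -e | rewrite e].
have adj T b c : linext T -> T c = (T b).+1 :> nat -> (F c < F b) = (P c < P b).
  move=> hT Tbc; have := linset_rel_perm PI hT; have Ti := hT.1.
  set u := rel_perm T P => uJ; have := uJ; rewrite eJ => /imsetP[g gI eg].
  have hi : T b < n.-1 by have := ltn_ord (T c); lia.
  have e1 : ord_lo (Ordinal hi) = T b by apply: val_inj.
  have e2 : ord_hi (Ordinal hi) = T c by apply: val_inj => /=; lia.
  have := zD _ gI => /setP/(_ (Ordinal hi)); rewrite -eg !in_DesL e1 e2.
  have eu d : (u^-1)%g (T d) = P d by rewrite -(rel_permE cardX d Ti PI) permK.
  have eF d : (g^-1)%g (T d) = F d.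
    by rewrite -(rel_permE cardX d Ti PI) -/u eg pcompE permK.
  by rewrite !eu !eF.
split=> // b c xbc ycb; apply: ltW_inj => nbc.
have ngt a d : a <> d -> ~~ (F d < F a) -> F a < F d.
  by move=> nad; rewrite -leqNgt; exact: lt_inj.
have chain T (Q : X -> Prop) a d : linext T -> T a < T d -> Q a -> Q d ->
    (forall e f, Q e -> Q f -> T f = (T e).+1 :> nat -> F e < F f) ->
    (forall e, T a < T e -> T e < T d -> Q e) -> F a < F d.
  move=> hT + Qa Qd step mid; have [k] := ubnP (T d - T a).
  elim: k a Qa mid => // k IH a Qa mid hk ad.
  have [e|ne] := eqVneq (T d : nat) (T a).+1; first exact: step.
  have hlt : (T a).+1 < n by have := ltn_ord (T d); lia.
  have [e ee] := filling_onto cardX hT.1 (Ordinal hlt).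
  have Te : T e = (T a).+1 :> nat by rewrite ee.
  have Qe : Q e by apply: mid; rewrite Te; lia.
  apply: ltn_trans (step _ _ Qa Qe Te) _.
  by apply: IH => // [f ef fd| |]; [apply: mid; lia | lia | lia].
case: (ltngtP (x b) (x c)) xbc => // xbc _; last first.
  have {}ycb : y c < y b.
    by rewrite ltn_neqAle ycb andbT; apply/eqP => e; apply: nbc; apply: xy_inj.
  (* [sg] fills a column upwards with consecutive entries, while [P] reads it downwards. *)
  have rchain : forall k a d, sg d - sg a < k -> sg a < sg d -> x a = x d -> F d < F a.
    elim=> // k IH a d hk ad xad.
    have [e|ne] := eqVneq (sg d : nat) (sg a).+1.
      by rewrite (adj _ _ _ linext_sg e) PE; move: ad; rewrite sgE; lia.
    have hlt : (sg a).+1 < n by have := ltn_ord (sg d); lia.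
    have [e ee] := filling_onto cardX sgI (Ordinal hlt).
    have Te : sg e = (sg a).+1 :> nat by rewrite ee.
    have xe : x e = x a.
      have : sg a < sg e by lia.
      have : sg e < sg d by lia.
      by rewrite !sgE; lia.
    have h1 : F e < F a by apply: IH; lia.
    have h2 : F d < F e by apply: IH; lia.
    exact: ltn_trans h2 h1.
  by apply: (rchain (sg b - sg c).+1) => //; rewrite sgE; lia.
case: (ltngtP (y c) (y b)) ycb => // ycb _; last first.
  apply: (chain rh (fun d => y d = y b)) => //; first exact: linext_rh.
  - by rewrite rhE; lia.
  - move=> e f ye yf ef; apply: ngt; first by move=> e'; rewrite e' in ef; lia.
    rewrite (adj _ _ _ linext_rh ef) PE.
    have : rh e < rh f by lia.
    by rewrite rhE; lia.
  - by move=> e; rewrite !rhE; lia.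
(* Between the words of [sg] and [rh] the entries of b and c change order. The step where this
   happens swaps the values i and i+1, so b and c carry consecutive entries there. *)
pose Q (u : 'S_n) := u (P c) < u (P b) -> F b < F c.
have sr : leL (rel_perm sg P) (rel_perm rh P).
  have := linset_rel_perm PI linext_sg; rewrite linset_interval; last exact: antiext_P.
  by case/intervalLP.
suff : Q (rel_perm rh P) by rewrite /Q !rel_permE //; apply; rewrite rhE; lia.
apply: (@leL_ind_step _ Q _ _ _ _ sr) => [|u i su hi uh Qu].
  by rewrite /Q !rel_permE // sgE; lia.
have uJ : u \in linset P.
  rewrite linset_interval; last exact: antiext_P.
  by apply/intervalLP; split=> //; apply: leL_trans uh; exact: leL_cover.
rewrite /Q !pcompE => h.
case: (ltngtP (u (P b)) (u (P c))) => [bc|cb|/val_inj/perm_inj/PI //]; last exact: Qu.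
have /andP[/eqP e1 /eqP e2] : (u (P b) == ord_lo i) && (u (P c) == ord_hi i).
  apply: contraT; rewrite negb_and => hne.
  by have := sadj_lt hne bc; rewrite ltnNge (ltnW h).
move/linsetP: uJ => hT.
apply: ngt => //; rewrite (adj _ _ _ hT); last by rewrite /= e1 e2.
by rewrite PE; lia.
Qed.

Lemma simD_class_linset :
  forall I, (I \in simD_class (linset P)) <-> exists2 F, antiext F & I = linset F.
Proof.
move=> I; rewrite inE; split=> [/andP[hI /asboolP h]|[F hF ->]].
  exact: simD_antiext.
by rewrite linset_intervalP //; apply/asboolP; exact: antiext_simD.
Qed.

Lemma mul_w0_class_linset :
  forall I, (I \in [set mul_w0 I | I in simD_class (linset P)]) <->
    exists2 F, revext F & I = linset F.
Proof.
move=> I; split=> [/imsetP[I' /simD_class_linset[F hF ->] ->]|[F hF ->]].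
  exists (revf F); last by rewrite linset_revf.
  by apply/antiext_revf; rewrite revfK.
apply/imsetP; exists (linset (revf F)).
  by apply/simD_class_linset; exists (revf F) => //; apply/antiext_revf.
by rewrite linset_revf mul_w0E mul_permw0K.
Qed.

(** The minima are the ratios of [rh] to [F] and to [G]. Inversion turns the right weak order into
    the left one and these ratios into those of [F] and [G] to [rh], the form taken by words of
    tableaux on the reflected shape. *)
Lemma class_le_linset F G : revext F -> revext G ->
  class_le (linset F) (linset G) = leL (rel_perm F rh) (rel_perm G rh).
Proof.
move=> hF hG; have [eF lF] := linset_rev_interval hF; have [eG lG] := linset_rev_interval hG.
have Fi := hF.1; have Gi := hG.1.
rewrite -(rel_permV cardX rhI Fi) -(rel_permV cardX rhI Gi) -leR_V.
apply/idP/idP => [|h].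
  move=> /existsP[s /existsP[r /existsP[s' /existsP[r' /and5P[sr s'r' /eqP e /eqP e']]]]].
  rewrite eF in e; rewrite eG in e'.
  by have [-> _] := intervalL_inj lF sr e; have [-> _] := intervalL_inj lG s'r' e'.
apply/existsP; exists (rel_perm rh F); apply/existsP; exists (rel_perm sg F).
apply/existsP; exists (rel_perm rh G); apply/existsP; exists (rel_perm sg G).
by rewrite lF lG h -eF -eG !eqxx.
Qed.

Lemma linset_rev_inj F G : revext F -> revext G -> linset F = linset G -> F = G.
Proof.
move=> hF hG e; have [eF lF] := linset_rev_interval hF; have [eG lG] := linset_rev_interval hG.
have [h _] : rel_perm rh F = rel_perm rh G /\ rel_perm sg F = rel_perm sg G.
  by apply: intervalL_inj => //; rewrite -eF -eG.
have Fi := hF.1; have Gi := hG.1; apply/funext => b.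
rewrite -(rel_permE cardX b Fi rhI) -(rel_permE cardX b Gi rhI).
by rewrite -(rel_permV cardX rhI Fi) -(rel_permV cardX rhI Gi) h.
Qed.

End Planar.

(** * Tableaux of a diagram *)

(** [t0] supplies the values of the inverse outside [B], isomorphisms being encoded by total
    functions. *)
Lemma posets_isomorphic_sym (T U : finType) (A : {set T}) (rA : rel T)
    (B : {set U}) (rB : rel U) (t0 : T) :
  posets_isomorphic A rA B rB -> posets_isomorphic B rB A rA.
Proof.
move=> [f [fi fA fr]].
pose g u := odflt t0 [pick t in A | f t == u].
have gK t : t \in A -> g (f t) = t.
  move=> tA; rewrite /g; case: pickP => [t' /andP[t'A /eqP]|/(_ t)]; first exact: fi.
  by rewrite tA eqxx.
have Kg u : u \in B -> g u \in A /\ f (g u) = u.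
  by rewrite -fA => /imsetP[t tA ->]; rewrite gK.
exists g; split.
- by move=> u v /Kg[_ eu] /Kg[_ ev] e; rewrite -eu -ev e.
- apply/setP => t; apply/imsetP/idP => [[u /Kg[h _] ->] //|tA].
  by exists (f t); rewrite ?gK // -fA imset_f.
- by move=> u v /Kg[hu eu] /Kg[hv ev]; rewrite -fr // eu ev.
Qed.

Section Boxes.
Context (D : diagram).
Let X : finType := {: D}.
Let x (b : X) : nat := bcol b.
Let y (b : X) : nat := brow b.
Implicit Types (b c d : X).

Lemma box_inj b c : x b = x c -> y b = y c -> b = c.
Proof.
rewrite /x /y /bcol /brow => e1 e2; apply: val_inj; move: e1 e2.
by case: (val b) (val c) => [? ?] [? ?] /= -> ->.
Qed.

Lemma order_TL_total : total (@order_TL D).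
Proof. by move=> b c; rewrite /order_TL; lia. Qed.

Lemma order_TL_trans : transitive (@order_TL D).
Proof. by move=> b c d; rewrite /order_TL; lia. Qed.

Lemma order_TL_anti : antisymmetric (@order_TL D).
Proof. by move=> b c h; apply: box_inj; move: h; rewrite /x /y /order_TL; lia. Qed.

Definition order_lex b c : bool := (x b < x c) || (x b == x c) && (y b <= y c).

Lemma order_lex_total : total order_lex.
Proof. by move=> b c; rewrite /order_lex; lia. Qed.

Lemma order_lex_trans : transitive order_lex.
Proof. by move=> b c d; rewrite /order_lex; lia. Qed.

Lemma order_lex_anti : antisymmetric order_lex.
Proof. by move=> b c h; apply: box_inj; move: h; rewrite /order_lex; lia. Qed.

Let D' := flip_x (transpose D).
Let h := (\max_(c <- transpose D) c.2)%N.

Lemma flip_height b : x b <= h.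
Proof.
have : (y b, x b) \in transpose D by apply/imfsetP; exists (val b) => //; exact: valP.
move=> yx; rewrite /h. exact: (bigop.leq_bigmax_seq (F := fun c : nat * nat => c.2) (y b, x b) yx isT).
Qed.

Fact flip_subproof b : (y b, h.+1 - x b) \in D'.
Proof.
apply/imfsetP; exists (y b, x b) => //.
by apply/imfsetP; exists (val b) => //; exact: valP.
Qed.

Definition flip b : D' := [` flip_subproof b]%fset.

Lemma flip_col b : bcol (flip b) = y b. Proof. by []. Qed.
Lemma flip_row b : brow (flip b) = h.+1 - x b. Proof. by []. Qed.

Lemma flip_bij : bijective flip.
Proof.
have fi : injective flip.
  move=> b c /(congr1 val) [e1 e2]; apply: box_inj => //.
  by move: e2; have := flip_height b; have := flip_height c; lia.
have onto p : exists b, flip b = p.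
  have /imfsetP[q /= /imfsetP[r /= rD ->] e] := valP p.
  by exists [` rD]%fset; apply: val_inj; rewrite [RHS]e.
have [g gK] := choice onto.
by exists g => [b|p]; [apply: fi; rewrite gK | rewrite gK].
Qed.

End Boxes.

Arguments flip {D}.

Section Diagram.
Context {n : nat} (D : diagram).
Hypothesis cardD : #|{: D}| = n.
Let X : finType := {: D}.
Let x (b : X) : nat := bcol b.
Let y (b : X) : nat := brow b.
Implicit Types (b c d : X).

Lemma bij_fillingP (T : {ffun D -> 'I_n}) : bij_filling T <-> injective T.
Proof.
split=> [/andP[/injectiveP]//|Ti]; apply/andP; split; first exact/injectiveP.
by apply/forallP => k; have [b <-] := filling_onto cardD Ti k; apply/existsP; exists b.
Qed.

Definition rank_TL : D -> 'I_n := rankf cardD (@order_TL D).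

Lemma rank_TL_inj : injective rank_TL.
Proof. exact: (rankf_inj (@order_TL_total D) (@order_TL_trans D) (@order_TL_anti D)). Qed.

Lemma rank_TL_lt b c : (rank_TL b < rank_TL c) =
  (x b < x c) || (x b == x c) && (y c < y b).
Proof.
rewrite (rankf_lt cardD (@order_TL_total D) (@order_TL_trans D) (@order_TL_anti D)) /order_TL -/(x b) -/(x c) -/(y b) -/(y c).
case: (eqVneq b c) => [->|/eqP nbc]; first by rewrite /= !ltnn !andbF.
case: (ltngtP (x b) (x c)) => //= e; rewrite andbT leq_eqVlt.
by case: eqP => // e'; case: nbc; apply: box_inj.
Qed.

Lemma w_TL_rel_perm (T : {ffun D -> 'I_n}) : injective T -> w_TL T = rel_perm T rank_TL.
Proof.
exact: (word_perm_rank cardD (@order_TL_total D) (@order_TL_trans D) (@order_TL_anti D)).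
Qed.

Definition rank_lex : D -> 'I_n := rankf cardD (@order_lex D).

Lemma rank_lex_inj : injective rank_lex.
Proof. exact: (rankf_inj (@order_lex_total D) (@order_lex_trans D) (@order_lex_anti D)). Qed.

Lemma rank_lex_lt b c : (rank_lex b < rank_lex c) =
  (x b < x c) || (x b == x c) && (y b < y c).
Proof.
rewrite (rankf_lt cardD (@order_lex_total D) (@order_lex_trans D) (@order_lex_anti D)) /order_lex.
case: (eqVneq b c) => [->|/eqP nbc]; first by rewrite /= !ltnn !andbF.
case: (ltngtP (x b) (x c)) => //= e; rewrite andbT leq_eqVlt.
by case: eqP => // e'; case: nbc; apply: box_inj.
Qed.

Lemma ST_linext (T : {ffun D -> 'I_n}) : T \in ST n D <-> linext x y T.
Proof.
rewrite inE; split=> [/andP[/bij_fillingP Ti /forallP h]|[Ti h]].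
  by split=> // b c xbc ybc; have /forallP/(_ c) := h b; rewrite -/(x b) xbc -/(y b) ybc.
apply/andP; split; first exact/bij_fillingP.
by apply/forallP => b; apply/forallP => c; apply/implyP => /andP[]; apply: h.
Qed.

Lemma w_TL_ST : [set w_TL T | T in ST n D] = linset x y rank_TL.
Proof.
apply/setP => s; apply/imsetP/idP => [[T /ST_linext hT ->]|/linsetP hs].
  by rewrite (w_TL_rel_perm hT.1); apply: (linset_rel_perm cardD rank_TL_inj hT).
pose T := [ffun b => s (rank_TL b)]; have eT : T = (fun b => s (rank_TL b)) :> (_ -> _).
  by apply/funext => b; rewrite ffunE.
have hT : linext x y T by rewrite eT.
exists T; first exact/ST_linext.
rewrite (w_TL_rel_perm hT.1); apply: (rel_perm_uniq cardD) => [||b]; first exact: hT.1.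
  exact: rank_TL_inj.
by rewrite eT.
Qed.

Lemma card_flip : #|{: flip_x (transpose D)}| = n.
Proof. by rewrite -(bij_eq_card (@flip_bij D)). Qed.

End Diagram.

(** * The reflected transpose of a diagram and its class *)

Section DiagramClass.
Context {n : nat} (D : diagram).
Hypothesis cardD : #|{: D}| = n.
Hypothesis no_diagonal_cover : forall b c : D, bcol b < bcol c -> brow b < brow c ->
  exists d : D, [/\ bcol b <= bcol d <= bcol c, brow b <= brow d <= brow c, d <> b & d <> c].
Let X : finType := {: D}.
Let x (b : X) : nat := bcol b.
Let y (b : X) : nat := brow b.
Let D' := flip_x (transpose D).
Let P' := rank_TL (card_flip cardD).
Let rh (b : X) : 'I_n := P' (flip b).

Lemma flip_inj : injective (@flip D).
Proof. exact: bij_inj (@flip_bij D). Qed.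

Lemma rank_flip_inj : injective rh.
Proof. by apply: inj_comp flip_inj; exact: rank_TL_inj. Qed.

(** Columns of the reflected transpose are rows of [D], and top to bottom there is left to right in
    [D]; so the order of [w_TL] on the new shape reads [D] by rows. *)
Lemma rank_flip_lt b c : (rh b < rh c) = (y b < y c) || (y b == y c) && (x b < x c).
Proof.
rewrite /rh rank_TL_lt !flip_col !flip_row; congr (_ || (_ && _)).
by have := flip_height b; have := flip_height c; rewrite -/(x b) -/(x c); lia.
Qed.

(** Going up in the new shape is going left in [D], so a standard filling of it is a reading order
    of [D] run backwards. *)
Lemma ST_flip (T : {ffun D' -> 'I_n}) :
  T \in ST n D' <-> revext x y (fun b => T (flip b)).
Proof.
have [g gK Kg] := @flip_bij D.
rewrite (ST_linext (card_flip cardD)); split=> -[Ti hT]; split.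
- exact: inj_comp Ti flip_inj.
- move=> b c xbc ycb; apply: hT; rewrite ?flip_col ?flip_row //.
  by apply: leq_sub2l.
- move=> p q e; rewrite -(Kg p) -(Kg q); congr flip; apply: Ti; by rewrite /= !Kg.
- move=> p q; rewrite -(Kg p) -(Kg q) !flip_col !flip_row => h1 h2; apply: hT => //.
  by move: h2; have := flip_height (g p); have := flip_height (g q); rewrite /x; lia.
Qed.

Lemma w_TL_flip (T : {ffun D' -> 'I_n}) : injective T ->
  w_TL T = rel_perm (fun b => T (flip b)) rh.
Proof.
move=> Ti; rewrite (w_TL_rel_perm (card_flip cardD)) //.
apply: (rel_perm_uniq cardD) => [||b]; first exact: inj_comp Ti flip_inj.
  exact: rank_flip_inj.
by rewrite (rel_permE (card_flip cardD)) //; exact: rank_TL_inj.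
Qed.

Let J := [set w_TL T | T in ST n D].

Lemma w_TL_ST_interval : is_intervalL J.
Proof.
rewrite /J (w_TL_ST cardD).
apply: (linset_intervalP cardD (@box_inj D) (@rank_lex_inj n D cardD) rank_flip_inj
  (rank_lex_lt cardD) rank_flip_lt).
exact: antiext_P (@box_inj D) (@rank_TL_inj n D cardD) (rank_TL_lt cardD).
Qed.

Lemma class_mulw0_iso :
  posets_isomorphic [set mul_w0 I | I in simD_class J] class_le (ST n D') tleq.
Proof.
apply: posets_isomorphic_sym; first exact: [ffun p => P' p].
have sgI := @rank_lex_inj n D cardD; have PI := @rank_TL_inj n D cardD.
have xyI := @box_inj D.
have classE I : I \in [set mul_w0 I | I in simD_class J] <->
    exists2 F, revext x y F & I = linset x y F.
  rewrite /J (w_TL_ST cardD).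
  exact: (mul_w0_class_linset cardD xyI sgI rank_flip_inj PI (rank_lex_lt cardD)
    rank_flip_lt (rank_TL_lt cardD) no_diagonal_cover).
have [g gK Kg] := @flip_bij D.
exists (fun T : {ffun D' -> 'I_n} => linset x y (fun b => T (flip b))); split.
- move=> T U /ST_flip hT /ST_flip hU.
  move/(linset_rev_inj cardD xyI sgI rank_flip_inj (rank_lex_lt cardD) rank_flip_lt hT hU) => e.
  by apply/ffunP => p; rewrite -(Kg p); have := congr1 (fun f => f (g p)) e.
- apply/setP => I; apply/imsetP/idP => [[T /ST_flip hT ->]|/classE[F hF ->]].
    by apply/classE; exists (fun b => T (flip b)).
  pose T : {ffun D' -> 'I_n} := [ffun p => F (g p)].
  have eT : F = (fun b => T (flip b)) by apply/funext => b; rewrite ffunE gK.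
  by exists T; [apply/ST_flip; rewrite -eT | rewrite -eT].
- move=> T U /ST_flip hT /ST_flip hU; rewrite /tleq.
  have inj (V : {ffun D' -> 'I_n}) : revext x y (fun b => V (flip b)) -> injective V.
    by case/ST_flip/(ST_linext (card_flip cardD)).
  rewrite !w_TL_flip; try exact: inj.
  exact: (class_le_linset cardD xyI sgI rank_flip_inj (rank_lex_lt cardD) rank_flip_lt hT hU).
Qed.
End DiagramClass.

(** * Immaculate and extended tableaux *)

Section Transfer.
Local Open Scope nat_scope.
Context {n : nat} (alpha : seq nat).

Definition box_in c r : bool := (0 < r <= size alpha) && (0 < c <= cpart alpha r).

Lemma mem_tcd_boxes p : (p \in tcd_boxes alpha) = box_in p.1 p.2.
Proof.
apply/allpairsPdep/idP => [[r [c [hr hc ->]]]|].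
  by move: hr hc; rewrite !mem_iota /box_in /=; lia.
case: p => c r; rewrite /box_in /= => h; exists r, c; rewrite !mem_iota; split=> //; lia.
Qed.

Lemma mem_tcd p : (p \in tcd alpha) = box_in p.1 p.2.
Proof. by rewrite -mem_tcd_boxes inE. Qed.

Lemma boxP (b : tcd alpha) : box_in (bcol b) (brow b).
Proof. by rewrite /bcol /brow -mem_tcd; exact: valP. Qed.

Lemma box_ex c r : box_in c r -> exists b : tcd alpha, bcol b = c /\ brow b = r.
Proof. by rewrite -[c]/(c, r).1 -[r in box_in _ r]/(c, r).2 -mem_tcd => h; exists [` h]%fset. Qed.

Lemma tcd_boxes_uniq : uniq (tcd_boxes alpha).
Proof.
apply: allpairs_uniq_dep => [|r _|[r c] [r' c'] _ _ /= [-> ->] //]; exact: iota_uniq.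
Qed.

Lemma card_tcd : #|{: tcd alpha}| = sumn alpha.
Proof.
rewrite -cardfE card_imfset //= undup_id ?tcd_boxes_uniq // size_allpairs_dep.
congr sumn; apply: (@eq_from_nth _ 0); rewrite size_map size_iota // => i hi.
by rewrite (nth_map 0) ?size_iota ?nth_iota.
Qed.

Context (j : nat -> nat -> nat) (D : diagram) (B : {set {ffun tcd alpha -> 'I_n}}).
Hypothesis mem_D : forall p, (p \in D) = [exists b : tcd alpha, p == (brow b, j (bcol b) (brow b))].
Hypothesis j_row : forall c c' r, box_in c r -> box_in c' r -> c < c' -> j c r < j c' r.
Hypothesis j_B : forall T : {ffun tcd alpha -> 'I_n}, T \in B <-> bij_filling T /\
  (forall b c, brow b <= brow c -> j (bcol b) (brow b) <= j (bcol c) (brow c) -> T b <= T c).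
Hypothesis j_diag : forall b c : tcd alpha, brow b < brow c ->
  j (bcol b) (brow b) < j (bcol c) (brow c) ->
  exists d : tcd alpha, [/\ brow b <= brow d <= brow c,
    j (bcol b) (brow b) <= j (bcol d) (brow d) <= j (bcol c) (brow c), d <> b & d <> c].

Fact to_box_subproof (b : tcd alpha) : (brow b, j (bcol b) (brow b)) \in D.
Proof. by rewrite mem_D; apply/existsP; exists b. Qed.

Definition to_box (b : tcd alpha) : D := [` to_box_subproof b]%fset.

Lemma j_inj (b c : tcd alpha) : brow b = brow c ->
  j (bcol b) (brow b) = j (bcol c) (brow c) -> b = c.
Proof.
move=> er ej; apply: box_inj => //; have := boxP b; have := boxP c; rewrite er => hc hb.
move: ej; rewrite er; case: (ltngtP (bcol b) (bcol c)) => // h.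
  by have := j_row hb hc h; lia.
by have := j_row hc hb h; lia.
Qed.

Lemma to_box_bij : bijective to_box.
Proof.
have onto p : exists b, to_box b = p.
  have := valP p; rewrite /= mem_D => /existsP[b /eqP e].
  by exists b; apply: val_inj; rewrite [RHS]e.
have [g gK] := choice onto; exists g => // b.
have := congr1 val (gK (to_box b)) => -[e1 e2].
exact: j_inj e1 e2.
Qed.

(** Row r becomes column r and [j] increases along rows, so right to left becomes top to bottom. *)
Lemma to_box_order b c : order_TL (to_box b) (to_box c) = order_RB b c.
Proof.
rewrite /order_TL /order_RB.
rewrite -[bcol (to_box b)]/(brow b) -[bcol (to_box c)]/(brow c).
rewrite -[brow (to_box b)]/(j _ _) -[brow (to_box c)]/(j _ _).
case: (ltngtP (brow b) (brow c)) => //= e.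
have hb := boxP b; have := boxP c; rewrite -e => hc.
case: (ltngtP (bcol b) (bcol c)) => h; last by rewrite h leqnn.
  by have := j_row hb hc h; lia.
by have := j_row hc hb h; lia.
Qed.

Lemma w_RB_to_box (T : {ffun D -> 'I_n}) :
  w_RB [ffun b => T (to_box b)] = w_TL T.
Proof.
have [g gK Kg] := to_box_bij.
rewrite /w_TL /w_RB; congr word_perm.
have -> : sort (@order_TL D) (enum {: D}) = map to_box (sort (@order_RB (tcd alpha)) (enum {: tcd alpha})).
  have -> : sort (@order_TL D) (enum {: D}) =
      sort (@order_TL D) (map to_box (enum {: tcd alpha})).
    apply/perm_sortP.
    - exact: order_TL_total.
    - exact: order_TL_trans.
    - exact: order_TL_anti.
    apply: uniq_perm; rewrite ?(map_inj_uniq (can_inj gK)) ?enum_uniq //.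
    by move=> p; rewrite mem_enum inE -[p]Kg map_f // mem_enum.
  by rewrite sort_map; congr (map _ (sort _ _));
    apply/funext => b; apply/funext => c; exact: to_box_order.
by rewrite -map_comp; apply: eq_map => b; rewrite /= ffunE.
Qed.

Hypothesis card_alpha : sumn alpha = n.

Lemma card_to_box : #|{: D}| = n.
Proof. by rewrite -(bij_eq_card to_box_bij) card_tcd. Qed.

Lemma ST_to_box (T : {ffun D -> 'I_n}) : T \in ST n D <-> [ffun b => T (to_box b)] \in B.
Proof.
have [g gK Kg] := to_box_bij; have gi := can_inj gK.
have ci : #|{: tcd alpha}| = n by rewrite card_tcd.
rewrite (ST_linext card_to_box) j_B (bij_fillingP ci).
split=> -[Ti hT]; split.
- by move=> b c; rewrite !ffunE => /Ti/gi.
- by move=> b c rbc jbc; rewrite !ffunE; apply: hT.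
- move=> p q; rewrite -(Kg p) -(Kg q) => e; congr to_box; apply: Ti; by rewrite !ffunE.
- move=> p q; rewrite -(Kg p) -(Kg q) => h1 h2.
  by have := hT _ _ h1 h2; rewrite !ffunE.
Qed.

Lemma w_RB_ST : [set w_RB T | T in B] = [set w_TL T | T in ST n D].
Proof.
have [g gK Kg] := to_box_bij.
apply/setP => s; apply/imsetP/imsetP => -[T hT ->].
  pose T' : {ffun D -> 'I_n} := [ffun p => T (g p)].
  have e : [ffun b => T' (to_box b)] = T by apply/ffunP => b; rewrite !ffunE gK.
  by exists T'; [apply/ST_to_box; rewrite e | rewrite -w_RB_to_box e].
by exists [ffun b => T (to_box b)]; [apply/ST_to_box | rewrite w_RB_to_box].
Qed.

Lemma row_strict_family (K : fieldType) (J : {set 'S_n}) :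
  J = [set w_RB T | T in B] ->
  row_strict_class K J = [set mul_w0 I | I in simD_class J] /\
  posets_isomorphic (row_strict_class K J) class_le (ST n (flip_x (transpose D))) tleq.
Proof.
rewrite w_RB_ST => ->.
have nd (p q : D) : bcol p < bcol q -> brow p < brow q ->
    exists d : D, [/\ bcol p <= bcol d <= bcol q, brow p <= brow d <= brow q, d <> p & d <> q].
  have [g gK Kg] := to_box_bij; rewrite -(Kg p) -(Kg q) => h1 h2.
  have [d [d1 d2 d3 d4]] := j_diag h1 h2.
  by exists (to_box d); split=> // /(can_inj gK).
have e := @row_strict_classE K n _ (w_TL_ST_interval card_to_box).
by rewrite e; split=> //; exact: (class_mulw0_iso card_to_box nd).
Qed.
End Transfer.

(** * The diagrams of the immaculate and the extended families *)

Section Immaculate.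
Local Open Scope nat_scope.
Context (K : fieldType) (n : nat) (alpha : seq nat).
Hypothesis halpha : is_composition n alpha.

Lemma cpart_gt0 r : 0 < r <= size alpha -> 0 < cpart alpha r.
Proof.
by case: r => // r hr; have /andP[/allP h _] := halpha; apply/h/mem_nth.
Qed.

Lemma first_box r : 0 < r <= size alpha -> exists b : tcd alpha, bcol b = 1 /\ brow b = r.
Proof. by move=> hr; apply: box_ex; rewrite /box_in hr; have := cpart_gt0 hr; lia. Qed.

Lemma rows_increasingP (T : {ffun tcd alpha -> 'I_n}) :
  reflect (forall b c, brow b = brow c -> bcol b < bcol c -> T b < T c) (rows_increasing T).
Proof.
apply: (iffP forallP) => [h b c e bc|h b].
  by have /forallP/(_ c)/implyP := h b; apply; rewrite e eqxx.
by apply/forallP => c; apply/implyP => /andP[/eqP e bc]; apply: h.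
Qed.

Lemma column_increasingP k (T : {ffun tcd alpha -> 'I_n}) :
  reflect (forall b c, bcol b = k -> bcol c = k -> brow b < brow c -> T b < T c)
    (column_increasing k T).
Proof.
apply: (iffP forallP) => [h b c eb ec bc|h b].
  by have /forallP/(_ c)/implyP := h b; apply; rewrite eb ec eqxx.
by apply/forallP => c; apply/implyP => /and3P[/eqP eb /eqP ec bc]; apply: h.
Qed.

Lemma columns_increasingP (T : {ffun tcd alpha -> 'I_n}) :
  reflect (forall b c, bcol b = bcol c -> brow b < brow c -> T b < T c)
    (columns_increasing T).
Proof.
apply: (iffP forallP) => [h b c e bc|h b].
  by have /column_increasingP := h b; apply.
by apply/column_increasingP => c d ec ed cd; apply: h; rewrite ?ec ?ed.
Qed.

Lemma filling_lt (T : {ffun tcd alpha -> 'I_n}) b c :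
  bij_filling T -> b <> c -> T b <= T c -> T b < T c.
Proof. by move=> /andP[/injectiveP Ti _]; exact: lt_inj. Qed.

Definition shift_V i : nat := \sum_(i.+1 <= r < (size alpha).+1) (cpart alpha r - 1).

Definition row_V c r : nat := if c == 1 then 1 else c + shift_V r.

Lemma shift_V_lt r r' : r < r' <= size alpha -> shift_V r' + (cpart alpha r' - 1) <= shift_V r.
Proof.
move=> /andP[rr' hr']; rewrite /shift_V.
have h1 : r' < (size alpha).+1 by rewrite ltnS.
rewrite (big_cat_nat rr' (ltnW h1)) /= (big_ltn h1) /= [X in X <= _]addnC.
exact: leq_addl.
Qed.


Lemma mem_diagram_V p : (p \in diagram_V alpha) =
  [exists b : tcd alpha, p == (brow b, row_V (bcol b) (brow b))].
Proof.
rewrite !inE; apply/orP/existsP.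
  case=> [/mapP[r]|/allpairsPdep[r [c [hr hc ->]]]].
    rewrite mem_iota => hr ->; have [|b [e1 e2]] := @first_box r; first by lia.
    by exists b; rewrite e1 e2.
  move: hr hc; rewrite !mem_iota => hr hc.
  have [|b [e1 e2]] := @box_ex alpha c r; first by rewrite /box_in; lia.
  exists b; have c1 : (c == 1) = false by lia.
  by rewrite e1 e2 /row_V c1.
move=> [b /eqP ->]; have := boxP b; rewrite /box_in /row_V => hb.
case: eqP => e.
  by left; apply/mapP; exists (brow b); rewrite // mem_iota; lia.
right; apply/allpairsPdep; exists (brow b), (bcol b); rewrite !mem_iota.
split=> //; lia.
Qed.

Lemma row_V_lt c c' r : box_in alpha c r -> box_in alpha c' r -> c < c' ->
  row_V c r < row_V c' r.
Proof. by rewrite /box_in /row_V; do ![case: eqP]; lia. Qed.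

(** Beyond the first column, the rows of alpha fill disjoint bands of the diagram, higher rows lying
    lower. A box in such a band is therefore above every box coming from a higher row. *)
Lemma row_V_first c r c' r' : box_in alpha c r -> box_in alpha c' r' -> r < r' ->
  row_V c r <= row_V c' r' -> c = 1.
Proof.
rewrite /box_in /row_V => hb hb' rr'.
have := @shift_V_lt r r'; do ![case: eqP]; lia.
Qed.

(** A relation between different rows starts in the first column by [row_V_first]; it goes up that
    column and then along the upper row. *)
Lemma SIT_row_V (T : {ffun tcd alpha -> 'I_n}) : T \in SIT n alpha <->
  bij_filling T /\ (forall b c, brow b <= brow c ->
    row_V (bcol b) (brow b) <= row_V (bcol c) (brow c) -> T b <= T c).
Proof.
rewrite inE; split.
  move=> /and3P[bT /rows_increasingP hr /column_increasingP hc]; split=> // b c rbc jbc.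
  have hrow d e : brow d = brow e -> bcol d <= bcol e -> T d <= T e.
    move=> rde; rewrite leq_eqVlt => /orP[/eqP e1|h]; last by apply/ltnW/hr.
    by rewrite (@box_inj _ d e).
  have [hb hbc] := (boxP b, boxP c).
  case: (ltngtP (brow b) (brow c)) rbc => // [rbc|rbc] _.
    have b1 := row_V_first hb hbc rbc jbc.
    have [|d [d1 d2]] := @first_box (brow c); first by move: hbc; rewrite /box_in; lia.
    apply: leq_trans (ltnW (hc b d b1 d1 _)) (hrow d c d2 _); first by rewrite d2.
    by move: hbc; rewrite d1 /box_in; lia.
  apply: hrow => //; rewrite leqNgt; apply/negP => h.
  by rewrite rbc in hb jbc; have := row_V_lt hbc hb h; lia.
move=> [bT hT]; rewrite bT; apply/and3P; split=> //.
  apply/rows_increasingP => b c e bc; apply: filling_lt => //.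
    by move=> ebc; rewrite ebc ltnn in bc.
  apply: hT; first by rewrite e.
  by rewrite e; apply/ltnW/row_V_lt => //; [rewrite -e|]; exact: boxP.
apply/column_increasingP => b c e1 e2 bc; apply: filling_lt => //.
  by move=> ebc; rewrite ebc ltnn in bc.
by apply: hT; [exact: ltnW | rewrite e1 e2 /row_V].
Qed.

Lemma row_V_diag (b c : tcd alpha) : brow b < brow c ->
  row_V (bcol b) (brow b) < row_V (bcol c) (brow c) ->
  exists d : tcd alpha, [/\ brow b <= brow d <= brow c,
    row_V (bcol b) (brow b) <= row_V (bcol d) (brow d) <= row_V (bcol c) (brow c),
    d <> b & d <> c].
Proof.
move=> rbc jbc; have [hb hc] := (boxP b, boxP c).
have b1 := row_V_first hb hc rbc (ltnW jbc).
have [|d [d1 d2]] := @first_box (brow c); first by move: hc; rewrite /box_in; lia.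
exists d; rewrite d1 d2 b1 (ltnW rbc) leqnn; split=> //.
- by move: jbc; rewrite b1 /row_V /= => /ltnW.
- by move=> e; rewrite -e d2 ltnn in rbc.
- by move=> e; rewrite b1 -e d1 /row_V /= ltnn in jbc.
Qed.

Lemma row_strict_SIT :
  row_strict_class K (wRB_SIT n alpha) =
    [set mul_w0 I | I in simD_class (wRB_SIT n alpha)] /\
  posets_isomorphic (row_strict_class K (wRB_SIT n alpha)) class_le
    (ST n (flip_x (transpose (diagram_V alpha)))) tleq.
Proof.
have /andP[_ /eqP hs] := halpha.
exact: (row_strict_family mem_diagram_V row_V_lt SIT_row_V row_V_diag hs).
Qed.

Lemma mem_diagram_X p : (p \in diagram_X alpha) =
  [exists b : tcd alpha, p == (brow b, bcol b)].
Proof.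
apply/imfsetP/existsP => [[q /= hq ->]|[b /eqP ->]].
  by exists [` hq]%fset.
by exists (val b) => //; exact: valP.
Qed.

Lemma SET_order (T : {ffun tcd alpha -> 'I_n}) : T \in SET n alpha <->
  bij_filling T /\ (forall b c, brow b <= brow c -> bcol b <= bcol c -> T b <= T c).
Proof.
rewrite inE; split.
  move=> /and3P[bT /rows_increasingP hr /columns_increasingP hc]; split=> // b c rbc cbc.
  (* The row of c reaches [bcol c], hence also the column of b. *)
  have [d [d1 d2]] : exists d : tcd alpha, bcol d = bcol b /\ brow d = brow c.
    by apply: box_ex; have := boxP b; have := boxP c; rewrite /box_in; lia.
  apply: (@leq_trans (T d)).
    move: rbc; rewrite leq_eqVlt => /orP[/eqP e|h]; first by rewrite (@box_inj _ b d) ?d1 ?d2.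
    by apply/ltnW/hc; rewrite ?d1 ?d2.
  move: cbc; rewrite leq_eqVlt => /orP[/eqP e|h]; first by rewrite (@box_inj _ d c) ?d1 ?d2.
  by apply/ltnW/hr; rewrite ?d1 ?d2.
move=> [bT hT]; rewrite bT; apply/and3P; split=> //.
  apply/rows_increasingP => b c e bc; apply: filling_lt => //.
    by move=> ebc; rewrite ebc ltnn in bc.
  by apply: hT; rewrite ?e // ltnW.
apply/columns_increasingP => b c e bc; apply: filling_lt => //.
  by move=> ebc; rewrite ebc ltnn in bc.
by apply: hT; rewrite ?e // ltnW.
Qed.

Lemma row_strict_SET :
  row_strict_class K (wRB_SET n alpha) =
    [set mul_w0 I | I in simD_class (wRB_SET n alpha)] /\
  posets_isomorphic (row_strict_class K (wRB_SET n alpha)) class_le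
    (ST n (flip_x (transpose (diagram_X alpha)))) tleq.
Proof.
have /andP[_ /eqP hs] := halpha.
apply: (row_strict_family (alpha := alpha) (j := fun c r => c) (B := SET n alpha)) => //.
- exact: mem_diagram_X.
- exact: SET_order.
move=> b c rbc cbc.
have [d [d1 d2]] : exists d : tcd alpha, bcol d = bcol b /\ brow d = brow c.
  by apply: box_ex; have := boxP b; have := boxP c; rewrite /box_in; lia.
exists d; rewrite d1 d2 leqnn (ltnW rbc) (ltnW cbc) leqnn; split=> //.
  by move=> e; rewrite -e d2 ltnn in rbc.
by move=> e; rewrite -e d1 ltnn in cbc.
Qed.
End Immaculate.

(** * The canonical class *)

Section Chains.
Local Open Scope nat_scope.
Context (n : nat) (alpha : seq nat).
Hypothesis halpha : is_composition n alpha.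
Let l := size alpha.

(* The diagram is extended by infinitely many infinite rows above the last one,
   so that every chain can be followed leftwards until the first column. *)
Definition wide c r : bool := (l < r) || (c <= cpart alpha r).

Fact next_ex c r : exists r', (r < r') && wide c r'.
Proof. by exists (maxn r l).+1; rewrite /wide ltnS leq_maxl ltnS leq_maxr. Qed.

(** The greedy step read backwards: the row where the chain through column c+1 of row r meets column
    c. *)
Definition next_row c r : nat := ex_minn (next_ex c r).

Lemma next_gt c r : r < next_row c r.
Proof. by rewrite /next_row; case: ex_minnP => r' /andP[]. Qed.

Lemma next_wide c r : wide c (next_row c r).
Proof. by rewrite /next_row; case: ex_minnP => r' /andP[]. Qed.

Lemma next_min c r r' : r < r' -> wide c r' -> next_row c r <= r'.
Proof. by rewrite /next_row => h1 h2; case: ex_minnP => m _; apply; rewrite h1. Qed.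

Lemma next_mono c r r' : r <= r' -> next_row c r <= next_row c r'.
Proof. by move=> h; apply: next_min (next_wide c r'); exact: leq_ltn_trans (next_gt c r'). Qed.

Lemma next_lt c r r' : r < r' -> wide c r' -> next_row c r < next_row c r'.
Proof. by move=> h w; apply: leq_ltn_trans (next_min h w) (next_gt _ _). Qed.

Lemma wide_le c c' r : c <= c' -> wide c' r -> wide c r.
Proof. by rewrite /wide => h /orP[->//|h']; rewrite (leq_trans h h') orbT. Qed.

Lemma wide1 r : 0 < r -> wide 1 r.
Proof.
by move=> hr; rewrite /wide; case: ltnP => //= h; apply: (cpart_gt0 halpha); rewrite hr.
Qed.

Lemma next1 r : next_row 1 r = r.+1.
Proof. by apply/eqP; rewrite eqn_leq next_gt next_min ?wide1. Qed.

Lemma next_virtual c r : l <= r -> next_row c r = r.+1.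
Proof.
by move=> h; apply/eqP; rewrite eqn_leq next_gt next_min // /wide ltnS h.
Qed.

Lemma next_le c r : r <= l -> next_row c r <= l.+1.
Proof. by move=> h; apply: next_min; rewrite ?ltnS // /wide ltnS leqnn. Qed.

(* Lowest row of the block of the first column containing row r. *)
Fixpoint bot r : nat :=
  if r is r'.+1 then
    if [|| r' == 0, l <= r' | 1 < cpart alpha r'] then r'.+1 else bot r'
  else 0.

Lemma bot_le r : bot r <= r.
Proof. by elim: r => //= r IH; case: ifP => // _; exact: leqW. Qed.

Lemma bot_next r : wide 2 r -> bot r.+1 = r.+1.
Proof. by rewrite /wide /= => /orP[/ltnW ->|->]; rewrite ?orbT. Qed.

Lemma bot_mono r r' : r <= r' -> bot r <= bot r'.
Proof.
elim: r' => [|r' IH]; first by rewrite leqn0 => /eqP ->.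
rewrite leq_eqVlt => /orP[/eqP -> //|]; rewrite ltnS => h; apply: leq_trans (IH h) _ => /=.
by case: ifP => // _; apply: leqW; exact: bot_le.
Qed.

Lemma bot_idem r : bot (bot r) = bot r.
Proof. by elim: r => // r IH /=; case: ifP => //= ->. Qed.

Lemma bot_gt0 r : 0 < r -> 0 < bot r.
Proof.
elim: r => //= r IH _; case: ifPn => //; rewrite negb_or => /andP[r0 _].
by apply: IH; rewrite lt0n.
Qed.

Lemma bot_virtual r : l < r -> bot r = r.
Proof. by case: r => // r; rewrite ltnS /= => ->; rewrite orbT. Qed.

(* The chain of a box is indexed by the row at which it leaves the first column. *)
Fixpoint chain c r : nat :=
  if c is c'.+1 then (if c' == 0 then bot r else chain c' (next_row c' r)) else 0.

Lemma chain1 r : chain 1 r = bot r. Proof. by []. Qed.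

Lemma chainS c r : 0 < c -> chain c.+1 r = chain c (next_row c r).
Proof. by case: c. Qed.

Lemma chain2 r : wide 2 r -> chain 2 r = r.+1.
Proof. by move=> h; rewrite chainS // next1 chain1 bot_next. Qed.

Lemma chain_mono c r r' : r <= r' -> chain c r <= chain c r'.
Proof.
elim: c r r' => // c IH r r' h /=; case: ifP => _; first exact: bot_mono.
by apply: IH; exact: next_mono.
Qed.

(** Column 1 is excluded because a whole block shares one chain there. In column 2 the index is r+1;
    further right, the step to the left preserves strict inequalities. *)
Lemma chain_lt c r r' : 1 < c -> wide c r -> wide c r' -> r < r' -> chain c r < chain c r'.
Proof.
elim: c r r' => // c IH r r' c1 w w' h.
have [e|ne] := eqVneq c 1; first by subst c; rewrite !chain2.
have c2 : 1 < c by lia.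
rewrite !chainS; try lia.
apply: IH => //; rewrite ?next_wide //.
by apply: next_lt => //; apply: wide_le w'.
Qed.

Lemma chain_inj c r r' : 1 < c -> wide c r -> wide c r' -> chain c r = chain c r' -> r = r'.
Proof.
move=> c1 w w' e; case: (ltngtP r r') => // h.
  by have := chain_lt c1 w w' h; rewrite e ltnn.
by have := chain_lt c1 w' w h; rewrite e ltnn.
Qed.

Lemma chain_succ c r : 0 < c -> wide c.+1 r -> chain c r < chain c.+1 r.
Proof.
move=> c0 w; have [e|ne] := eqVneq c 1.
  by subst c; rewrite chain2 // chain1 ltnS bot_le.
rewrite chainS //; apply: chain_lt; rewrite ?next_gt ?next_wide //; first by lia.
exact: wide_le w.
Qed.

Lemma chain_row c c' r : 0 < c < c' -> wide c' r -> chain c r < chain c' r.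
Proof.
elim: c' => [|c' IH]; first by rewrite ltn0 andbF.
move=> /andP[c0]; rewrite ltnS leq_eqVlt => /orP[/eqP <-|h] w.
  exact: chain_succ.
apply: ltn_trans (IH _ _) (chain_succ _ w); first by rewrite c0.
  exact: wide_le w.
exact: ltn_trans h.
Qed.

Lemma chain_virtual c r : 0 < c -> l < r -> (chain c r).+1 = r + c.
Proof.
elim: c r => // c IH r _ h; have [e|ne] := eqVneq c 0.
  by subst c; rewrite chain1 bot_virtual // addn1.
rewrite chainS ?next_virtual; try lia.
by rewrite IH; lia.
Qed.

(** Separates the columns: by [chain_virtual], a chain still in virtual rows at column c has index
    at least l + c, so it meets no actual box of column c. *)
Lemma chain_upper c r : 0 < c -> r <= l -> chain c r < l + c.
Proof.
case: c => // -[|c] _ h; first by rewrite chain1 addn1 ltnS (leq_trans (bot_le r)).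
rewrite chainS //; have := chain_mono c.+1 (next_le c.+1 h).
by have := @chain_virtual c.+1 l.+1 isT (ltnSn l); lia.
Qed.

Lemma wide_box c r : box_in alpha c r -> wide c r.
Proof. by rewrite /box_in /wide => /andP[_ /andP[_ ->]]; rewrite orbT. Qed.

Lemma box_wide c r : 0 < r <= l -> 0 < c -> wide c r -> box_in alpha c r.
Proof.
move=> /andP[r0 rl] c0 /orP[|h]; first by rewrite ltnNge rl.
by apply/andP; split; apply/andP.
Qed.

(** Used contrapositively: it forces the predecessor of a box on its chain to lie no higher than the
    row of a box to be compared with it. *)
Lemma chain_past c c' r r' : 0 < c' < c -> r' < next_row c r ->
  chain c' r' < chain c.+1 r.
Proof.
move=> /andP[c'0 c'c] h; rewrite chainS; last by lia.
apply: leq_ltn_trans (chain_mono c' (ltnW h)) _.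
by apply: chain_row (next_wide c r); rewrite c'0.
Qed.

(** Local form of the order by chains; the third clause is what remains of the triple condition once
    all columns increase. *)
Definition chain_increasing (T : {ffun tcd alpha -> 'I_n}) : Prop :=
  [/\ forall b c, brow b = brow c -> bcol b < bcol c -> T b < T c,
      forall b c, bcol b = bcol c -> brow b < brow c -> T b < T c
    & forall b c, bcol b = (bcol c).+1 -> brow b < brow c -> T b < T c].

(** Induction on the column of b. When b is more than one column to the right of c, replace it by
    its predecessor on the chain: the index is the same, the entry is larger by the third clause,
    and the row is not above that of c by [chain_past]. *)
Lemma chain_increasing_le T : chain_increasing T -> forall b c : tcd alpha, brow b <= brow c ->
  chain (bcol b) (brow b) <= chain (bcol c) (brow c) -> T b <= T c.
Proof.
move=> [hr hc hd] b c; have [k] := ubnP (bcol b); elim: k b => // k IH b hk rbc jbc.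
have [hb hbc] := (boxP b, boxP c).
have hrow d e : brow d = brow e -> bcol d <= bcol e -> T d <= T e.
  move=> rde; rewrite leq_eqVlt => /orP[/eqP e1|h]; last by apply/ltnW/hr.
  by rewrite (@box_inj _ d e).
have [e|ne] := eqVneq (brow b) (brow c).
  apply: hrow => //; rewrite leqNgt; apply/negP => h.
  have : chain (bcol c) (brow b) < chain (bcol b) (brow b).
    by apply: chain_row (wide_box hb); move: hbc; rewrite /box_in; lia.
  by move: jbc; rewrite e; lia.
have {ne rbc}rbc : brow b < brow c by rewrite ltn_neqAle ne.
have [cbc|cbc] := leqP (bcol b) (bcol c).
  have [d [d1 d2]] : exists d : tcd alpha, bcol d = bcol b /\ brow d = brow c.
    by apply: box_ex; move: hb hbc; rewrite /box_in; lia.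
  by apply: leq_trans (ltnW (hc b d _ _)) (hrow d c _ _); rewrite ?d1 ?d2.
have [e|ne] := eqVneq (bcol b) (bcol c).+1; first exact/ltnW/hd.
have c2 : 0 < bcol c < (bcol b).-1 by move: hbc; rewrite /box_in; lia.
set m := (bcol b).-1 in c2; have em : bcol b = m.+1 by rewrite /m; lia.
have [h|h] := leqP (next_row m (brow b)) (brow c); last first.
  by have := chain_past c2 h; rewrite -em ltnNge jbc.
have [d [d1 d2]] : exists d : tcd alpha, bcol d = m /\ brow d = next_row m (brow b).
  apply: box_ex; apply: box_wide (next_wide _ _); last by lia.
  by have := next_gt m (brow b); move: hbc; rewrite /box_in -/l; lia.
apply: (@leq_trans (T d)); first by apply/ltnW/hd; rewrite ?d1 ?d2 ?next_gt.
apply: IH; rewrite ?d1 ?d2 //; first by lia.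
by rewrite -chainS ?em // in jbc *; lia.
Qed.

Lemma chain_le_increasing (T : {ffun tcd alpha -> 'I_n}) : bij_filling T ->
  (forall b c : tcd alpha, brow b <= brow c ->
     chain (bcol b) (brow b) <= chain (bcol c) (brow c) -> T b <= T c) ->
  chain_increasing T.
Proof.
move=> bT hT; split=> b c e h; apply: filling_lt => //.
- by move=> ebc; rewrite ebc ltnn in h.
- apply: hT; first by rewrite e.
  rewrite e ltnW // chain_row ?h ?andbT //; last exact/wide_box/boxP.
  by have := boxP b; rewrite /box_in; lia.
- by move=> ebc; rewrite ebc ltnn in h.
- by apply: hT; [exact: ltnW | rewrite e chain_mono // ltnW].
- by move=> ebc; rewrite ebc ltnn in h.
- apply: hT; first exact: ltnW.
  have := boxP c => hc; rewrite e chainS; last by move: hc; rewrite /box_in; lia.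
  by apply: chain_mono; apply: next_min h _; exact: wide_box.
Qed.

(** Outside column 1 the intermediate box is the predecessor of b on its chain; in column 1 it is
    the first box of the row of c or the next box of the column, except when c is that next box. *)
Lemma chain_diag (b c : tcd alpha) : brow b < brow c ->
  chain (bcol b) (brow b) < chain (bcol c) (brow c) ->
  exists d : tcd alpha, [/\ brow b <= brow d <= brow c,
    chain (bcol b) (brow b) <= chain (bcol d) (brow d) <= chain (bcol c) (brow c),
    d <> b & d <> c].
Proof.
move=> rbc jbc; have [hb hc] := (boxP b, boxP c).
have [c1|c1] := ltnP 1 (bcol b).
  set m := (bcol b).-1; have em : bcol b = m.+1 by rewrite /m; lia.
  have m0 : 0 < m by lia.
  have nx : next_row m (brow b) <= brow c.
    rewrite leqNgt; apply/negP => h.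
    have cm : bcol c < m.
      rewrite ltnNge; apply/negP => h'; move: h; rewrite ltnNge => /negP; apply.
      by apply: next_min => //; apply: wide_le h' (wide_box hc).
    have := @chain_past m (bcol c) _ _ _ h; rewrite -em cm andbT.
    by move: hc; rewrite /box_in; lia.
  have [d [d1 d2]] : exists d : tcd alpha, bcol d = m /\ brow d = next_row m (brow b).
    apply: box_ex; apply: box_wide (next_wide _ _) => //.
    by have := next_gt m (brow b); move: hc; rewrite /box_in -/l; lia.
  have ed : chain (bcol d) (brow d) = chain (bcol b) (brow b) by rewrite d1 d2 em chainS.
  exists d; rewrite ed leqnn (ltnW jbc) d2 nx (ltnW (next_gt _ _)); split=> // e.
    by move: d1; rewrite e em => /esym/n_Sn.
  by rewrite -ed e ltnn in jbc.
have b1 : bcol b = 1 by move: hb; rewrite /box_in; lia.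
have [c2|c2] := ltnP 1 (bcol c).
  have [|d [d1 d2]] := first_box halpha (r := brow c); first by move: hc; rewrite /box_in; lia.
  exists d; rewrite d1 d2 b1 (ltnW rbc) leqnn chain_mono ?(ltnW rbc) //=; split=> //.
  - by apply: (ltnW (chain_row (c := 1) _ (wide_box hc))); rewrite c2.
  - by move=> e; rewrite -e d2 ltnn in rbc.
  - by move=> e; rewrite -e d1 in c2.
have c1' : bcol c = 1 by move: hc; rewrite /box_in; lia.
have [h|h] := ltnP (brow b).+1 (brow c).
  have [|d [d1 d2]] := first_box halpha (r := (brow b).+1); first by move: hc; rewrite /box_in; lia.
  exists d; rewrite d1 d2 b1 c1' leqnSn (ltnW h) !chain_mono ?(ltnW h) //; split=> // e.
    by move: d2; rewrite e => /n_Sn.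
  by rewrite -d2 e ltnn in h.
(* The indices differ, so a block ends at b: its row has a second box, whose index is that of c. *)
have ec : brow c = (brow b).+1 by lia.
have a1 : 1 < cpart alpha (brow b).
  move: jbc; rewrite b1 c1' ec !chain1 /=; case: ifP => [|_]; last by rewrite ltnn.
  move=> h' _; move: h' hb hc; rewrite /box_in ec -/l; lia.
have [d [d1 d2]] : exists d : tcd alpha, bcol d = 2 /\ brow d = brow b.
  by apply: box_ex; move: hb; rewrite /box_in; lia.
have w2 : wide 2 (brow b) by rewrite /wide a1 orbT.
exists d; rewrite d1 d2 b1 c1' ec leqnn leqnSn chain2 // !chain1 bot_next // leqnn andbT.
rewrite (leq_trans (bot_le _)) //; split=> // e.
  by rewrite -e d1 in b1.
by rewrite -e d1 in c1'.
Qed.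

Fact canonical_bound (b : tcd alpha) : (sumn (take (brow b).-1 alpha) + bcol b).-1 < n.
Proof.
have /andP[_ /eqP hs] := halpha; have := boxP b; rewrite /box_in => /andP[hr hc].
have : sumn (take (brow b).-1 alpha) + cpart alpha (brow b) <= n.
  rewrite -hs -[X in _ <= sumn X](cat_take_drop (brow b).-1 alpha) sumn_cat leq_add2l.
  by rewrite (drop_nth 0) /= ?leq_addr //; lia.
by lia.
Qed.

Definition canonical_filling : {ffun tcd alpha -> 'I_n} :=
  [ffun b => Ordinal (canonical_bound b)].

Lemma canonical_rows (b c : tcd alpha) : brow b < brow c ->
  canonical_filling b < canonical_filling c.
Proof.
move=> h; rewrite !ffunE /=.
have := boxP b; have := boxP c; rewrite /box_in => /andP[hr hc] /andP[hr' hc'].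
have : sumn (take (brow b) alpha) <= sumn (take (brow c).-1 alpha).
  have -> : take (brow b) alpha = take (brow b) (take (brow c).-1 alpha).
    by rewrite take_takel //; lia.
  by rewrite -[X in _ <= sumn X](cat_take_drop (brow b)) sumn_cat leq_addr.
have -> : sumn (take (brow b) alpha) = sumn (take (brow b).-1 alpha) + cpart alpha (brow b).
  have e : brow b = (brow b).-1.+1 by lia.
  by rewrite {1}e (take_nth 0) ?sumn_rcons //; lia.
by lia.
Qed.

Lemma canonical_cols (b c : tcd alpha) : brow b = brow c -> bcol b < bcol c ->
  canonical_filling b < canonical_filling c.
Proof.
move=> e h; rewrite !ffunE /= e; have := boxP b; rewrite /box_in; lia.
Qed.

Lemma canonical_increasing : chain_increasing canonical_filling.
Proof.
by split=> b c e h; [exact: canonical_cols | exact: canonical_rows | exact: canonical_rows].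
Qed.

Lemma canonical_inj : bij_filling canonical_filling.
Proof.
have /andP[_ /eqP hs] := halpha; have ci : #|{: tcd alpha}| = n by rewrite card_tcd.
apply/(bij_fillingP ci) => b c e; apply: box_inj.
  case: (ltngtP (brow b) (brow c)) => h.
  - by have := canonical_rows h; rewrite e ltnn.
  - by have := canonical_rows h; rewrite e ltnn.
  case: (ltngtP (bcol b) (bcol c)) => // h'.
  - by have := canonical_cols h h'; rewrite e ltnn.
  - by have := canonical_cols (esym h) h'; rewrite e ltnn.
case: (ltngtP (brow b) (brow c)) => // h.
- by have := canonical_rows h; rewrite e ltnn.
- by have := canonical_rows h; rewrite e ltnn.
Qed.

Lemma increasing_SYCT T : bij_filling T -> chain_increasing T -> T \in SYCT n alpha.
Proof.
move=> bT [hr hc hd]; rewrite inE bT /=; apply/and3P; split.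
- exact/rows_increasingP.
- by apply/column_increasingP => b c e1 e2; apply: hc; rewrite e1 e2.
apply/forallP => b; apply/forallP => c; apply/implyP => /and3P[/eqP e h h'].
by have := hd b c e h; rewrite ltnNge ltnW.
Qed.

(** Sharing the column order of the canonical filling makes all columns increase; a violation of the
    third clause would then, through the triple condition, produce a descent in a column. *)
Lemma canonical_SYCTE T : T \in canonical_SYCT n alpha <->
  bij_filling T /\ chain_increasing T.
Proof.
rewrite inE; split.
  move=> /andP[]; rewrite inE => /and4P[bT /rows_increasingP hr _ ht].
  move=> /existsP[U /and3P[_ /forallP hU /forallP hUT]].
  have hc b c : bcol b = bcol c -> brow b < brow c -> T b < T c.
    move=> e h; have /forallP/(_ c)/implyP := hUT b; rewrite e eqxx => /(_ isT)/eqP <-.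
    have := canonical_rows h; rewrite !ffunE /=.
    have /eqP := hU b; have /eqP := hU c; lia.
  split=> //; split=> // b c e h; rewrite ltnNge; apply/negP => h'.
  have ncb : c <> b by move=> ebc; rewrite ebc ltnn in h.
  have := filling_lt bT ncb h' => cb.
  move/forallP/(_ b)/forallP/(_ c)/implyP: ht; rewrite e eqxx h cb => /(_ isT).
  move=> /existsP[d /and3P[/eqP e1 /eqP e2 h3]].
  by have := hc b d; rewrite e e1 e2 => /(_ erefl h); rewrite ltnNge ltnW.
move=> [bT iT]; rewrite increasing_SYCT //=; apply/existsP; exists canonical_filling.
rewrite increasing_SYCT //; [|exact: canonical_inj|exact: canonical_increasing].
apply/and3P; split=> //.
  apply/forallP => b; rewrite ffunE /= prednK // addn_gt0.
  by have := boxP b; rewrite /box_in => /andP[_ /andP[-> _]]; rewrite orbT.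
have cmp (V : {ffun tcd alpha -> 'I_n}) : chain_increasing V -> forall b c, bcol b = bcol c ->
    (V b < V c) = (brow b < brow c).
  move=> [_ hc _] b c e; case: (ltngtP (brow b) (brow c)) => h.
  - exact: hc.
  - by rewrite ltnNge (ltnW (hc c b (esym e) h)).
  by rewrite (@box_inj _ b c) // ltnn.
apply/forallP => b; apply/forallP => c; apply/implyP => /eqP e.
by rewrite !cmp //; exact: canonical_increasing.
Qed.

End Chains.

(** * The chains Y_j *)

Section Algorithm.
Local Open Scope nat_scope.
Context (n : nat) (alpha : seq nat).
Hypothesis halpha : is_composition n alpha.
Let l := size alpha.
Implicit Types (p b : nat * nat) (A Y : seq (nat * nat)).

Definition chainb p : nat := chain alpha p.1 p.2.

Lemma tcd_wide p : p \in tcd_boxes alpha -> wide alpha p.1 p.2.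
Proof. by rewrite mem_tcd_boxes; exact: wide_box. Qed.

Lemma tcd_col p : p \in tcd_boxes alpha -> 0 < p.1.
Proof. by rewrite mem_tcd_boxes => /andP[_ /andP[]]. Qed.

Lemma tcd_row p : p \in tcd_boxes alpha -> 0 < p.2 <= l.
Proof. by rewrite mem_tcd_boxes => /andP[]. Qed.

Lemma tcd_first r : 0 < r <= l -> (1, r) \in tcd_boxes alpha.
Proof. by move=> hr; rewrite mem_tcd_boxes; apply/andP; rewrite (cpart_gt0 halpha hr). Qed.

Lemma tcd_chain_inj p p' : p \in tcd_boxes alpha -> p' \in tcd_boxes alpha ->
  p.1 = p'.1 -> 1 < p.1 -> chainb p = chainb p' -> p = p'.
Proof.
case: p p' => [c r] [c' r'] /= hp hp' e c1; rewrite /chainb /= -e => ec.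
rewrite -e in hp' *; congr (_, _).
exact: (chain_inj halpha c1 (tcd_wide hp) (tcd_wide hp') ec).
Qed.

Lemma lt_count (T : eqType) (a1 a2 : pred T) (s : seq T) x :
  subpred a1 a2 -> x \in s -> a2 x -> ~~ a1 x -> count a1 s < count a2 s.
Proof.
move=> sub; elim: s => //= y s IH; rewrite in_cons => /orP[/eqP <-|xs] a2x na1x.
  by rewrite a2x (negbTE na1x) add0n add1n ltnS sub_count.
by have := IH xs a2x na1x; have := sub y; case: (a1 y); case: (a2 y) => //=; lia.
Qed.

(** A chain has no gaps: on the way left from p, a virtual row met before column c would give an
    index of at least l + c, too large for the actual box (c, y). *)
Lemma chain_column p c y : p \in tcd_boxes alpha -> (c, y) \in tcd_boxes alpha ->
  c < p.1 -> chainb p = chain alpha c y ->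
  exists2 p', p' \in tcd_boxes alpha & p'.1 = c.+1 /\ chainb p' = chainb p.
Proof.
move=> + hc; case: p => m r; elim: m r => // m IH r hp /=.
rewrite ltnS leq_eqVlt => /orP[/eqP ecm|cm] e; first by exists (m.+1, r) => //; rewrite ecm.
have c0 := tcd_col hc; have /andP[_ yl] := tcd_row hc; rewrite /= in c0 yl.
have m0 : 0 < m by lia.
have e' : chain alpha m (next_row alpha m r) = chain alpha c y by rewrite -chainS.
have [h|h] := leqP (next_row alpha m r) l; last first.
  have := chain_upper halpha c0 yl; have := chain_virtual halpha m0 h; rewrite e' -/l; lia.
have hm : (m, next_row alpha m r) \in tcd_boxes alpha.
  rewrite mem_tcd_boxes; apply: box_wide (next_wide _ _ _) => //=.
  by have := next_gt alpha m r; lia.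
have [p' hp' [e1 e2]] := IH _ hm cm e'.
by exists p' => //; split=> //; rewrite e2 /chainb chainS.
Qed.

(** Boxes of the next column strictly below [kappa] have at most its index, while [A] holds those of
    at least that index; the only candidate is thus the next box of the chain. In column 1, where a
    block shares its index, [kappa] must be the lowest box of its block. The fuel bounds the boxes
    of the chain still to the right. *)
Lemma extend_mem fuel A Y (kappa : nat * nat) : 
  kappa \in tcd_boxes alpha -> (kappa.1 = 1 -> bot alpha kappa.2 = kappa.2) ->
  (forall p, p \in Y -> p.1 <= kappa.1) ->
  (forall p, p \in A -> p \in tcd_boxes alpha /\ chainb kappa <= chainb p) ->
  (forall p, p \in tcd_boxes alpha -> chainb kappa <= chainb p -> p \in A) ->
  count (fun p => (kappa.1 < p.1) && (chainb p == chainb kappa)) A <= fuel ->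
  forall p, (p \in extend fuel A Y kappa) =
    (p \in Y) || [&& p \in tcd_boxes alpha, kappa.1 < p.1 & chainb p == chainb kappa].
Proof.
elim: fuel A Y kappa => [|fuel IH] A Y kappa hk hbot hY hA hA' hfuel p.
  have [hp|_] := boolP [&& p \in tcd_boxes alpha, _ & _]; last by rewrite orbF.
  case/and3P: hp => hp cp /eqP e.
  have pA : p \in A by apply: hA' => //; rewrite e.
  have : has (fun p => (kappa.1 < p.1) && (chainb p == chainb kappa)) A.
    by apply/hasP; exists p => //; rewrite cp e eqxx.
  by rewrite has_count ltnNge hfuel.
have k0 := tcd_col hk.
have next_box q : q \in tcd_boxes alpha -> q.1 = kappa.1.+1 ->
    chainb q = chain alpha kappa.1 (next_row alpha kappa.1 q.2).
  by move=> _ e; rewrite /chainb e chainS.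
pose S := [seq b <- A | [&& b \notin Y, b.1 == kappa.1.+1 & b.2 < kappa.2]].
have memF q : (q \in S) =
    [&& q \in tcd_boxes alpha, q.1 == kappa.1.+1 & chainb q == chainb kappa].
  rewrite mem_filter; apply/andP/and3P.
    move=> [/and3P[_ /eqP e h] /hA[hq cq]]; split=> //; first exact/eqP.
    rewrite eqn_leq cq andbT next_box // /chainb; apply: chain_mono.
    by apply: next_min => //; exact: tcd_wide.
  move=> [hq /eqP e /eqP cq]; split; last by apply: hA'; rewrite ?cq.
  rewrite e eqxx /=; apply/andP; split.
    by apply/negP => /hY; rewrite e ltnn.
  have := next_box _ hq e; rewrite cq.
  have [c1 h|c1 h] := ltnP 1 kappa.1.
    have -> := chain_inj halpha c1 (tcd_wide hk) (next_wide _ _ _) h.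
    exact: next_gt.
  have k1 : kappa.1 = 1 by lia.
  move: h; rewrite /chainb k1 !chain1 (next1 halpha) hbot // bot_next => [->|]; first exact: ltnSn.
  by have := tcd_wide hq; rewrite e k1.
rewrite /= -/S; case eF: (sort (fun b c : nat * nat => b.2 <= c.2) S) => [|b F'].
  have [hp|_] := boolP [&& p \in tcd_boxes alpha, _ & _]; last by rewrite orbF.
  case/and3P: hp => hp cp /eqP e.
  have [|p' hp' [e1 e2]] := @chain_column p kappa.1 kappa.2 hp _ cp e.
    by rewrite -surjective_pairing.
  have : p' \in sort (fun b c : nat * nat => b.2 <= c.2) S.
    by rewrite mem_sort memF hp' e1 e2 e !eqxx.
  by rewrite eF.
have : b \in sort (fun b c : nat * nat => b.2 <= c.2) S.
  by rewrite eF in_cons eqxx.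
rewrite mem_sort memF => /and3P[hb /eqP b1 /eqP bc].
have bA : b \in A by apply: hA'; rewrite ?bc.
rewrite (IH A _ b) //.
- rewrite mem_rcons in_cons b1 bc; case: eqP => [->|npb] /=.
    by rewrite hb b1 ltnSn bc eqxx orbT.
  congr (_ || _); apply/and3P/and3P => -[hp cp e]; split=> //; first by lia.
  rewrite ltn_neqAle cp andbT; apply/eqP => ecp; case: npb.
  apply: tcd_chain_inj => //; [by rewrite b1 | by rewrite -ecp; lia|].
  by rewrite bc (eqP e).
- by rewrite b1; lia.
- by move=> q; rewrite mem_rcons in_cons b1 => /orP[/eqP ->|/hY]; rewrite ?b1 //; lia.
- by move=> q; rewrite bc; exact: hA.
- by move=> q; rewrite bc; exact: hA'.
rewrite -ltnS; apply: leq_trans hfuel; apply: (@lt_count _ _ _ _ b) => //.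
- by move=> q; rewrite b1 bc => /andP[h ->]; rewrite andbT; lia.
- by rewrite b1 ltnSn bc eqxx.
- by rewrite ltnn.
Qed.

Lemma mem_column1 d d' p : (p \in column1 d d') = (p.1 == 1) && (d' < p.2 <= d).
Proof.
apply/mapP/idP => [[y + ->]|]; first by rewrite mem_rev mem_iota /=; lia.
case: p => c r /= /andP[/eqP -> h]; exists r => //; rewrite mem_rev mem_iota; lia.
Qed.

Lemma last_column1 d d' b : d' < d -> last b (column1 d d') = (1, d'.+1).
Proof.
move=> h; rewrite /column1; have -> : d - d' = (d - d'.+1).+1 by lia.
by rewrite /= rev_cons map_rcons last_rcons.
Qed.

Lemma mem_BB p : (p \in BB alpha) = (p \in tcd_boxes alpha) && in_BB alpha p.
Proof. by rewrite mem_sort mem_filter andbC. Qed.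

Lemma BB_first r : (1, r) \in BB alpha -> (r == l) || wide alpha 2 r.
Proof.
rewrite mem_BB /in_BB /= /wide => /andP[_ /orP[/andP[_ ->]|->//]].
by rewrite !orbT.
Qed.

Lemma BB_column c r : (c.+2, r) \in BB alpha -> next_row alpha c.+1 r = l.+1.
Proof.
rewrite mem_BB /in_BB /= => /andP[hb /hasPn h]; apply/eqP; rewrite eqn_leq.
have /andP[_ rl] := tcd_row hb; rewrite next_le // ltnNge; apply/negP => hn.
have hbox : (c.+1, next_row alpha c.+1 r) \in tcd_boxes alpha.
  rewrite mem_tcd_boxes; apply: box_wide (next_wide _ _ _) => //=.
  by have := next_gt alpha c.+1 r; rewrite -/l; lia.
by have := h _ hbox; rewrite /= eqxx orbT next_gt.
Qed.

Lemma BB_column_chain c r : (c.+2, r) \in BB alpha -> (chain alpha c.+2 r).+1 = l + c.+2.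
Proof.
move=> h; rewrite chainS // BB_column //.
by have := @chain_virtual _ _ halpha c.+1 l.+1 isT (ltnSn l); rewrite -/l; lia.
Qed.

Definition BB_lt p p' : bool := (p.1 < p'.1) || (p.1 == p'.1) && (p.2 < p'.2).

(** In column 1 the boxes of [BB] end distinct blocks. Each later column has at most one of them;
    its predecessor is in row l+1, so its index exceeds those of all earlier columns by
    [chain_upper]. *)
Lemma BB_chain_lt p p' : p \in BB alpha -> p' \in BB alpha -> BB_lt p p' ->
  chainb p < chainb p'.
Proof.
move=> hp hp'; have := hp; have := hp'; rewrite !mem_BB => /andP[tp' _] /andP[tp _].
case: p p' hp hp' tp tp' => [c r] [c' r'] hp hp' tp tp'.
have /= c0 := tcd_col tp; have /= /andP[r0 rl] := tcd_row tp.
have /= /andP[r0' rl'] := tcd_row tp'.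
rewrite /BB_lt /chainb /= => /orP[cc'|/andP[/eqP e rr']].
  case: c' hp' tp' cc' => [|[|c']] hp' tp' cc'; try lia.
  by have := chain_upper halpha c0 rl; have := BB_column_chain hp'; rewrite -/l; lia.
subst c'; case: c c0 hp hp' tp tp' => [|[|c]] // _ hp hp' tp tp'.
  rewrite !chain1; have := BB_first hp => /orP[/eqP e|w]; first by lia.
  apply: leq_trans (bot_mono alpha rr'); rewrite bot_next // ltnS; exact: bot_le.
by have := BB_column hp; have := next_min rr' (wide_le (leqnSn _) (tcd_wide tp')); rewrite /=; lia.
Qed.

Lemma BB_uniq : uniq (BB alpha).
Proof. by rewrite sort_uniq filter_uniq // tcd_boxes_uniq. Qed.

Lemma BB_sorted : sorted BB_lt (BB alpha).
Proof.
set le := fun b c : nat * nat => (b.1 < c.1) || (b.1 == c.1) && (b.2 <= c.2).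
have so : sorted le (BB alpha) by apply: sort_sorted => b c; rewrite /le; lia.
have : sorted (fun b c => le b c && (b != c)) (BB alpha).
  elim: (BB alpha) so BB_uniq => // b [|c s] IH //= /andP[bc h] /andP[nb u].
  rewrite bc /=; apply/andP; split; last exact: IH.
  by apply: contraNneq nb => ->; rewrite in_cons eqxx.
apply: sub_sorted => b c; rewrite /le /BB_lt => /andP[/orP[->//|/andP[/eqP e h]] nbc].
rewrite e ltnn eqxx /= ltn_neqAle h andbT.
by apply: contraNneq nbc => e'; rewrite [b]surjective_pairing [c]surjective_pairing e e'.
Qed.

Lemma BB_chain_sorted : sorted ltn (map chainb (BB alpha)).
Proof.
suff H s : sorted BB_lt s -> {subset s <= BB alpha} -> sorted ltn (map chainb s).
  exact: (H _ BB_sorted).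
elim: s => // b [|c s] IH //= /andP[bc hs] h.
rewrite BB_chain_lt ?h ?in_cons ?eqxx ?orbT //=; apply: IH => // p hp.
by apply: h; rewrite in_cons hp orbT.
Qed.

Lemma block_end r : 0 < r <= l ->
  exists r', [/\ r <= r' <= l, (r' == l) || (1 < cpart alpha r') & bot alpha r' = bot alpha r].
Proof.
move=> /andP[r0 rl]; have [k] := ubnP (l - r); elim: k => // k IH in r r0 rl * => hk.
have [h|] := boolP ((r == l) || (1 < cpart alpha r)); first by exists r; rewrite leqnn rl.
rewrite negb_or => /andP[nl h].
have [||| r' [h1 h2 h3]] := IH r.+1; try lia.
exists r'; split=> //; first by lia.
by rewrite h3 /=; case: ifP => //; rewrite -/l; lia.
Qed.

(** Walk left along the chain: either the predecessor is virtual and the box reached lies in [BB],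
    or column 1 is reached and the top box of the block does. *)
Lemma chain_BB p : p \in tcd_boxes alpha -> exists2 b, b \in BB alpha & chainb b = chainb p.
Proof.
case: p => c; elim: c => [|c IH] r hp; first by have := tcd_col hp.
case: c IH hp => [|c] IH hp.
  have [r' [h1 h2 h3]] := block_end (tcd_row hp); exists (1, r') => //.
  have := tcd_row hp => /= h0.
  move: h0 h1 => /andP[r0 _] /andP[rr' r'l].
  rewrite mem_BB tcd_first ?(leq_trans r0 rr') //= /in_BB /= -/l.
  move: r'l h2; rewrite leq_eqVlt => /orP[->|->]; first by rewrite orbT.
  by rewrite orbC.
have [h|h] := leqP (next_row alpha c.+1 r) l.
  have hm : (c.+1, next_row alpha c.+1 r) \in tcd_boxes alpha.
    rewrite mem_tcd_boxes; apply: box_wide (next_wide _ _ _) => //=.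
    by have := next_gt alpha c.+1 r; rewrite -/l; lia.
  by have [b hb e] := IH _ hm; exists b.
exists (c.+2, r) => //; rewrite mem_BB hp /in_BB /=; apply/hasPn => -[c' r'] hc' /=.
apply/negP => /andP[hcc' hr']; move: h; rewrite ltnNge => /negP; apply.
have /= /andP[_ h] := tcd_row hc'; apply: leq_trans h; apply: next_min => //.
by apply: wide_le (tcd_wide hc') => /=; lia.
Qed.

(** The box just above b in column 1 starts a block whose chain is still to come, so the least
    remaining index is at most its row. Successive boxes of [BB] in column 1 thus delimit exactly
    one block. *)
Lemma block_start b bs : {subset b :: bs <= BB alpha} -> path ltn (chainb b) (map chainb bs) ->
  (forall p, p \in tcd_boxes alpha -> chainb b < chainb p -> chainb p \in map chainb bs) ->
  if bs is b' :: _ then b'.1 = 1 -> bot alpha b'.2 = b.2.+1 else True.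
Proof.
case: bs => // b' bs sub /= /andP[bb' hpath] hval b'1.
have bBB : b \in BB alpha by apply: sub; rewrite in_cons eqxx.
have hb : b \in tcd_boxes alpha by move: bBB; rewrite mem_BB => /andP[].
have hb' : b' \in tcd_boxes alpha.
  by have := sub b'; rewrite !in_cons eqxx orbT mem_BB => /(_ isT)/andP[].
have b1 : b.1 = 1.
  have b0 := tcd_col hb; have /andP[_ b'l] := tcd_row hb'.
  case: (ltngtP b.1 1) => //; first by lia.
  case: b bBB bb' {hb b0 sub hval} => -[|[|c]] r //= bBB bb' _.
  have := BB_column_chain bBB; move: bb'; rewrite /chainb b'1 /= -/(bot alpha _).
  by have := bot_le alpha b'.2; lia.
have eb : b = (1, b.2) by rewrite [LHS]surjective_pairing b1.
move: bb'; rewrite /chainb b1 b'1 !chain1 => bb'.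
have rr' : b.2 < b'.2 by rewrite ltnNge; apply/negP => /(bot_mono alpha); rewrite leqNgt bb'.
have /andP[_ b'l] := tcd_row hb'.
have w : wide alpha 2 b.2.
  have : (b.2 == l) || wide alpha 2 b.2 by apply: BB_first; rewrite -eb.
  by move=> /orP[|//]; lia.
apply/eqP; rewrite eqn_leq; apply/andP; split; last by rewrite -(bot_next w) bot_mono.
have hs : (1, b.2.+1) \in tcd_boxes alpha.
  by apply: tcd_first; exact: leq_trans rr' b'l.
have cs : chainb (1, b.2.+1) = b.2.+1 by rewrite /chainb [LHS]chain1 bot_next.
have cb : chainb b <= b.2 by rewrite /chainb b1 chain1 bot_le.
have := hval _ hs; rewrite cs ltnS cb => /(_ isT).
rewrite in_cons => /orP[/eqP e|h]; first by rewrite e /chainb b'1 chain1.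
apply: ltnW; move: hpath; rewrite path_sortedE; last exact: ltn_trans.
by move=> /andP[/allP/(_ _ h) + _]; rewrite /chainb b'1 chain1.
Qed.

(** [v] is the index of the last list removed; that [A] holds exactly the boxes of larger index is
    the state needed by [extend_mem]. *)
Lemma Ylists_mem bs A d v :
  (forall p, (p \in A) = (p \in tcd_boxes alpha) && (v < chainb p)) ->
  path ltn v (map chainb bs) -> {subset bs <= BB alpha} ->
  (forall p, p \in tcd_boxes alpha -> v < chainb p -> chainb p \in map chainb bs) ->
  (if bs is b :: _ then b.1 = 1 -> bot alpha b.2 = d.+1 else True) ->
  size (Ylists A d bs) = size bs /\
  forall k p, k < size bs -> (p \in nth [::] (Ylists A d bs) k) =
    (p \in tcd_boxes alpha) && (chainb p == nth 0 (map chainb bs) k).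
Proof.
elim: bs A d v => // b bs IH A d v hA /= /andP[vb hpath] sub hval hd.
have bBB : b \in BB alpha by apply: sub; rewrite in_cons eqxx.
have hb : b \in tcd_boxes alpha by move: bBB; rewrite mem_BB => /andP[].
have minb p : p \in tcd_boxes alpha -> v < chainb p -> chainb b <= chainb p.
  move=> hp vp; have := hval p hp vp; rewrite in_cons => /orP[/eqP ->//|h].
  apply: ltnW; move: hpath; rewrite path_sortedE; last exact: ltn_trans.
  by move=> /andP[/allP/(_ _ h)].
set start := if b.1 == 1 then column1 b.2 d else [:: b].
set Y := extend _ _ _ _.
have memY p : (p \in Y) = (p \in tcd_boxes alpha) && (chainb p == chainb b).
  rewrite /Y /start; case: eqP => [b1|nb1].
    have eb : b = (1, b.2) by rewrite [LHS]surjective_pairing b1.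
    (* The segment from b down to row d+1 is the whole block, and the extension starts at its lowest
       box. *)
    have bd := hd b1; have db : d < b.2 by rewrite -bd bot_le.
    have /andP[_ bl] := tcd_row hb.
    have botd : bot alpha d.+1 = d.+1 by rewrite -bd bot_idem.
    have hk : (1, d.+1) \in tcd_boxes alpha.
      by apply: tcd_first; exact: leq_trans db bl.
    have ck : chainb (1, d.+1) = chainb b by rewrite {2}/chainb b1 chain1 bd /chainb /= -/(bot alpha d.+1) botd.
    rewrite last_column1 // extend_mem //.
    - rewrite mem_column1 ck /=; case: (p =P p) => // _.
      have [hp|hp] /= := boolP (p \in tcd_boxes alpha); last first.
        rewrite orbF; apply/negP => /andP[/eqP p1 /andP[dp pb]]; move/negP: hp; apply.
        rewrite [p]surjective_pairing p1; apply: tcd_first.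
        by rewrite (leq_ltn_trans _ dp) ?(leq_trans pb bl).
      have p0 := tcd_col hp; have [c1|c1] := ltnP 1 p.1; first by rewrite (gtn_eqF c1).
      have p1 : p.1 = 1 by lia.
      rewrite p1 eqxx orbF /= /chainb p1 b1 !chain1 bd.
      apply/andP/eqP => [[h1 h2]|e].
        by apply/eqP; rewrite eqn_leq -{1}bd bot_mono // -{1}botd bot_mono.
      split; first by rewrite -e bot_le.
      rewrite leqNgt; apply/negP => h; have /andP[_ pl] := tcd_row hp.
      have : (b.2 == l) || wide alpha 2 b.2 by apply: BB_first; rewrite -eb.
      move=> /orP[|w]; first by lia.
      by have := bot_mono alpha h; rewrite bot_next // e; lia.
    - by move=> q; rewrite mem_column1 => /andP[/eqP -> _].
    - by move=> q; rewrite hA ck => /andP[hq vq]; split=> //; exact: minb.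
    - by move=> q hq; rewrite hA hq ck => h; exact: leq_trans vb h.
    - exact: count_size.
  rewrite /= extend_mem //.
  - rewrite inE; case: (p =P b) => [->|npb]; first by rewrite hb eqxx.
    have [hp|//] /= := boolP (p \in tcd_boxes alpha).
    have [//|cp] := ltnP b.1 p.1; symmetry; apply/eqP => e.
    have b0 := tcd_col hb; have p0 := tcd_col hp; have /andP[_ pl] := tcd_row hp.
    move: cp; rewrite leq_eqVlt => /orP[/eqP ecp|cp].
      by apply: npb; apply: tcd_chain_inj => //; rewrite ecp; lia.
    have := chain_upper halpha p0 pl; rewrite -/(chainb p) e -/l.
    case: b nb1 b0 cp bBB {hval hd minb start Y e npb hb vb hpath} sub => -[|[|c]] r //= _ _ cp bBB _.
    by have := BB_column_chain bBB; rewrite /chainb /=; lia.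
  - by move=> q; rewrite inE => /eqP ->.
  - by move=> q; rewrite hA => /andP[hq vq]; split=> //; exact: minb.
  - by move=> q hq; rewrite hA hq => h; exact: leq_trans vb h.
  - exact: count_size.
have hA' p : (p \in [seq c <- A | c \notin Y]) = (p \in tcd_boxes alpha) && (chainb b < chainb p).
  rewrite mem_filter memY hA; have [hp|_] /= := boolP (p \in tcd_boxes alpha); last by rewrite ?andbF.
  apply/andP/idP => [[h1 h2]|h]; first by rewrite ltn_neqAle eq_sym h1 minb.
  by rewrite gtn_eqF // (ltn_trans vb h).
have hval' p : p \in tcd_boxes alpha -> chainb b < chainb p -> chainb p \in map chainb bs.
  move=> hp hbp; have := hval p hp (ltn_trans vb hbp); rewrite in_cons => /orP[/eqP e|//].
  by rewrite e ltnn in hbp.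
have [|||szY nthY] := IH _ b.2 (chainb b) hA' hpath.
- by move=> p hp; apply: sub; rewrite in_cons hp orbT.
- exact: hval'.
- exact: block_start hpath hval'.
split; first by rewrite szY.
by case=> [|k] p hk /=; [exact: memY | exact: nthY].
Qed.

Lemma chain_gt0 p : p \in tcd_boxes alpha -> 0 < chainb p.
Proof.
move=> hp; have c0 := tcd_col hp; have /andP[r0 _] := tcd_row hp.
have [c1|c1] := ltnP 1 p.1.
  have := @chain_row _ _ halpha 1 p.1 p.2; rewrite c1 => /(_ isT (tcd_wide hp)).
  exact: leq_ltn_trans.
by have -> : chainb p = bot alpha p.2; [rewrite /chainb (_ : p.1 = 1) //; lia | exact: bot_gt0].
Qed.

(** The algorithm does not extend the first list to the right. This agrees with the chains: its
    index is 1, and indices increase strictly along rows, so index 1 occurs only in column 1. *)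
Lemma Y_all_mem :
  size (Y_all alpha) = size (BB alpha) /\
  forall k p, k < size (BB alpha) -> (p \in nth [::] (Y_all alpha) k) =
    (p \in tcd_boxes alpha) && (chainb p == nth 0 (map chainb (BB alpha)) k).
Proof.
rewrite /Y_all; case eBB: (BB alpha) => [|b bs]; first by [].
have sub : {subset b :: bs <= BB alpha} by rewrite eBB.
have hval p : p \in tcd_boxes alpha -> chainb p \in map chainb (b :: bs).
  by move=> /chain_BB[b' hb' <-]; rewrite -eBB map_f.
have hpath : path ltn (chainb b) (map chainb bs) by have := BB_chain_sorted; rewrite eBB.
have bBB : b \in BB alpha by apply: sub; rewrite in_cons eqxx.
have hb : b \in tcd_boxes alpha by move: bBB; rewrite mem_BB => /andP[].
have /andP[_ bl] := tcd_row hb; have b0 := tcd_col hb.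
have h11 : (1, 1) \in tcd_boxes alpha.
  by apply: tcd_first; have := tcd_row hb => /andP[h1 h2]; exact: leq_trans h1 h2.
have cb : chainb b = 1.
  apply/eqP; rewrite eqn_leq chain_gt0 // andbT; have := hval _ h11.
  rewrite /= in_cons => /orP[/eqP <- //|h]; apply: ltnW; move: hpath.
  by rewrite path_sortedE; [move=> /andP[/allP/(_ _ h)] | exact: ltn_trans].
have col1 p : p \in tcd_boxes alpha -> chainb p = 1 -> p.1 = 1.
  move=> hp e; have p0 := tcd_col hp; apply/eqP; rewrite eqn_leq p0 andbT leqNgt.
  apply/negP => p1; have := chain_row halpha (c := 1) _ (tcd_wide hp).
  rewrite p1 -/(chainb p) e chain1 => /(_ isT).
  by have /andP[p20 _] := tcd_row hp; rewrite ltnNge bot_gt0.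
have b1 := col1 _ hb cb; have eb : b = (1, b.2) by rewrite [LHS]surjective_pairing b1.
have memY1 p : (p \in column1 b.2 0) = (p \in tcd_boxes alpha) && (chainb p == chainb b).
  rewrite mem_column1 cb; apply/andP/andP => [[/eqP p1 /andP[p0 pb]]|[hp /eqP cp]].
    have hp : p \in tcd_boxes alpha.
      by rewrite [p]surjective_pairing p1; apply: tcd_first; rewrite p0 (leq_trans pb bl).
    split=> //; rewrite eqn_leq chain_gt0 // andbT -{1}cb /chainb p1 b1 !chain1.
    exact: bot_mono.
  have p1 := col1 _ hp cp; split; first exact/eqP.
  have /andP[p0 pl] := tcd_row hp; rewrite p0 leqNgt; apply/negP => h.
  have : (b.2 == l) || wide alpha 2 b.2 by apply: BB_first; rewrite -eb.
  move=> /orP[/eqP e|w]; first by rewrite e ltnNge pl in h.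
  have := bot_mono alpha h; rewrite bot_next // -(chain1 alpha p.2) -p1 -/(chainb p) cp.
  by have /andP[] := tcd_row hb; case: (b.2).
have hA p : (p \in [seq c <- tcd_boxes alpha | c \notin column1 b.2 0]) =
    (p \in tcd_boxes alpha) && (chainb b < chainb p).
  rewrite mem_filter memY1 andbC; have [hp|//] /= := boolP (p \in tcd_boxes alpha).
  by rewrite cb ltn_neqAle chain_gt0 // andbT eq_sym.
have hval' p : p \in tcd_boxes alpha -> chainb b < chainb p -> chainb p \in map chainb bs.
  move=> hp hbp; have := hval p hp; rewrite in_cons => /orP[/eqP e|//].
  by rewrite e ltnn in hbp.
have sub' : {subset bs <= BB alpha} by move=> p hp; apply: sub; rewrite in_cons hp orbT.
have [szY nthY] := Ylists_mem hA hpath sub' hval' (block_start sub hpath hval').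
split; first by rewrite /= szY.
by case=> [|k] p hk /=; [exact: memY1 | exact: nthY].
Qed.

(** Values of [chain] may have gaps; their rank among those of [BB] is the subscript j of Y_j. *)
Definition chain_index c r : nat := (index (chain alpha c r) (map chainb (BB alpha))).+1.

Lemma chain_index_le (b c : tcd alpha) :
  (chain_index (bcol b) (brow b) <= chain_index (bcol c) (brow c)) =
  (chain alpha (bcol b) (brow b) <= chain alpha (bcol c) (brow c)).
Proof.
have mem (d : tcd alpha) : chain alpha (bcol d) (brow d) \in map chainb (BB alpha).
  have hd : val d \in tcd_boxes alpha by rewrite mem_tcd_boxes; exact: boxP.
  have [b' hb' e] := chain_BB hd.
  by rewrite -[chain _ _ _]/(chainb (val d)) -e map_f.
rewrite /chain_index ltnS; have hs := BB_chain_sorted; set s := map _ _ in hs mem *.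
have us : uniq s by apply: sorted_uniq hs; [exact: ltn_trans | exact: ltnn].
have lt x y : x \in s -> y \in s -> index x s < index y s -> x < y.
  move=> hx hy h; rewrite -(nth_index 0 hx) -(nth_index 0 hy).
  by apply: (sorted_ltn_nth ltn_trans 0 hs); rewrite ?inE ?index_mem.
case: (ltngtP (index _ s) (index _ s)) => h.
- by rewrite ltnW // lt.
- by apply/esym/negbTE; rewrite -ltnNge lt.
by rewrite -(nth_index 0 (mem b)) h nth_index // leqnn.
Qed.

Lemma mem_diagram_C p : (p \in diagram_C alpha) =
  [exists b : tcd alpha, p == (brow b, chain_index (bcol b) (brow b))].
Proof.
have [szY nthY] := Y_all_mem; have hs := BB_chain_sorted.
have us : uniq (map chainb (BB alpha)) by apply: sorted_uniq hs; [exact: ltn_trans | exact: ltnn].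
rewrite inE mem_filter; apply/andP/existsP.
  move=> [/hasP[q hq hX] /allpairsPdep[i [k [hi hk ep]]]]; subst p.
  rewrite mem_iota in hi; rewrite mem_iota szY in hk.
  have hk' : k.-1 < size (BB alpha) by lia.
  move: hX => /mapP[c]; rewrite mem_iota /= => hc eq.
  move: hq; rewrite nthY // => /andP[hqb /eqP cq].
  have [|b [e1 e2]] := @box_ex alpha c i; first by rewrite -(mem_tcd_boxes alpha (c, i)) -eq.
  exists b; rewrite e1 e2 /chain_index -[chain _ _ _]/(chainb (c, i)) -eq cq.
  by have k0 : 0 < k; [lia | rewrite index_uniq ?size_map // prednK].
move=> [b /eqP ->].
have hb : val b \in tcd_boxes alpha by rewrite mem_tcd_boxes; exact: boxP.
have [b' hb' e] := chain_BB hb.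
have mb : chain alpha (bcol b) (brow b) \in map chainb (BB alpha).
  by rewrite -[chain _ _ _]/(chainb (val b)) -e map_f.
have hi : index (chain alpha (bcol b) (brow b)) (map chainb (BB alpha)) < size (BB alpha).
  by rewrite -(size_map chainb) index_mem.
split.
  apply/hasP; exists (val b).
    by rewrite /= nthY // hb /= nth_index.
  apply/mapP; exists (bcol b); last by rewrite [LHS]surjective_pairing.
  by rewrite mem_iota /=; have := boxP b; rewrite /box_in; lia.
apply/allpairsPdep; exists (brow b), (chain_index (bcol b) (brow b)).
rewrite !mem_iota szY; split=> //; first by have := boxP b; rewrite /box_in; lia.
Qed.

Lemma row_strict_canonical (K : fieldType) :
  row_strict_class K (wRB_canonical n alpha) =
    [set mul_w0 I | I in simD_class (wRB_canonical n alpha)] /\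
  posets_isomorphic (row_strict_class K (wRB_canonical n alpha)) class_le
    (ST n (flip_x (transpose (diagram_C alpha)))) tleq.
Proof.
have /andP[_ /eqP hs] := halpha.
have lt (b c : tcd alpha) : (chain_index (bcol b) (brow b) < chain_index (bcol c) (brow c)) =
    (chain alpha (bcol b) (brow b) < chain alpha (bcol c) (brow c)).
  by rewrite [LHS]ltnNge chain_index_le -ltnNge.
apply: (row_strict_family (j := chain_index) (B := canonical_SYCT n alpha)) => //.
- exact: mem_diagram_C.
- move=> c c' r /box_ex[b [<- er]] /box_ex[b' [<- er']] h.
  have b0 : 0 < bcol b by have := boxP b; rewrite /box_in; lia.
  rewrite -{1}er -er' lt er er'; apply: (chain_row halpha); first by rewrite b0 h.
  by rewrite -er'; exact/wide_box/boxP.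
- move=> T; rewrite canonical_SYCTE //; split=> -[bT hT]; split=> //.
    by move=> b c rbc; rewrite chain_index_le; exact: chain_increasing_le.
  apply: chain_le_increasing => // b c rbc; rewrite -chain_index_le; exact: hT.
move=> b c rbc; rewrite lt => jbc.
have [d [h1 h2 h3 h4]] := chain_diag halpha rbc jbc.
by exists d; rewrite !chain_index_le.
Qed.

End Algorithm.

Theorem proposition5p19 (R : realType) (n : nat) (alpha : seq nat)
    (hn : 0 < n) (halpha : is_composition n alpha) :
  [/\ row_strict_class R[i] (wRB_SIT n alpha) =
        [set mul_w0 I | I in simD_class (wRB_SIT n alpha)] /\
      posets_isomorphic
        (row_strict_class R[i] (wRB_SIT n alpha)) class_le
        (ST n (flip_x (transpose (diagram_V alpha)))) tleq,
      row_strict_class R[i] (wRB_SET n alpha) =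
        [set mul_w0 I | I in simD_class (wRB_SET n alpha)] /\
      posets_isomorphic
        (row_strict_class R[i] (wRB_SET n alpha)) class_le
        (ST n (flip_x (transpose (diagram_X alpha)))) tleq
    & row_strict_class R[i] (wRB_canonical n alpha) =
        [set mul_w0 I | I in simD_class (wRB_canonical n alpha)] /\
      posets_isomorphic
        (row_strict_class R[i] (wRB_canonical n alpha)) class_le
        (ST n (flip_x (transpose (diagram_C alpha)))) tleq].
Proof.
split; [exact: row_strict_SIT | exact: row_strict_SET | exact: row_strict_canonical].
Qed.
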